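(* Let $\boldsymbol\ell=(\ell_1,\ell_2,\ell_3,\ell_4)$ be a quadruple of positive integers and let $\lambda=(\mathbf a,\mathbf b,\mathbf c,\mathbf d)\in\Lambda=\Lambda(\boldsymbol\ell)$, with $L=\mathrm{GL}_{|\mathbf a'|}\times\mathrm{GL}_{|\mathbf b'|}\times\mathrm{GL}_{|\mathbf c'|}$ acting diagonally on $\mathfrak X(\lambda)$. (1) The double flag variety $\mathfrak X(\lambda)$ has finitely many $L$-orbits if and only if every summand $\mu$ of $\lambda$ in $\Lambda$ satisfies $(\mu|\mu)\geq 1$. (2) Moreover, if $\lambda$ satisfies the condition in (1), there is a one-to-one correspondence between the $L$-orbits of $\mathfrak X(\lambda)$ and the decompositions (up to permutation of the terms) $\lambda=\sum_{i=1}^k\mu_i$ with $k\geq 1$, $\mu_i\in\Lambda$, $(\mu_i|\mu_i)=1$. (3) If $\lambda$ satisfies the condition in (1) and $(\lambda|\lambda)=1$, then any representative of the open dense $L$-orbit in $\mathfrak X(\lambda)$ is an indecomposable object of $\mathrm{Rep}'\mathscr Q$ of dimension vector $\lambda$.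
   Context: $\mathbb{K}$ is an algebraically closed field of characteristic zero; $\mathrm{GL}_m=\mathrm{GL}_m(\mathbb{K})$. For a sequence $\mathbf d=(d_1,\dots,d_k)$ of nonnegative integers put $|\mathbf d|=\sum d_i$; $\mathscr F\!\ell(\mathbf d)$ is the variety of flags $(0=F_0\subset F_1\subset\dots\subset F_k)$ with $\dim F_i/F_{i-1}=d_i$ in a fixed space $F_k$ of dimension $|\mathbf d|$. $\Lambda(\boldsymbol\ell)$ is the set of nonzero quadruples $\lambda=(\mathbf a,\mathbf b,\mathbf c,\mathbf d)$ of sequences of nonnegative integers, of lengths $\ell_1,\ell_2,\ell_3,\ell_4$, such that $|\mathbf a|=|\mathbf b|=|\mathbf c|=|\mathbf d|=:|\lambda|$ and $|\mathbf a'|+|\mathbf b'|+|\mathbf c'|=|\lambda|$, where $\mathbf a'=(a_1,\dots,a_{\ell_1-1})$ denotes $\mathbf a$ with its last entry removed, and similarly for $\mathbf b',\mathbf c'$. It is a semigroup under pointwise addition. An element $\mu\in\Lambda(\boldsymbol\ell)$ is a summand of $\lambda$ if $\lambda-\mu\in\Lambda(\boldsymbol\ell)\cup\{0\}$ (in particular $\lambda$ is a summand of itself). The Tits form is $$(\lambda|\lambda)=\tfrac12\Big(\sum_i a_i^2+\sum_j b_j^2+\sum_k c_k^2+\sum_m d_m^2-2|\lambda|^2\Big).$$ Put $n=|\lambda|$ and fix $V=V_1\oplus V_2\oplus V_3$ with $\dim V_1=|\mathbf a'|$, $\dim V_2=|\mathbf b'|$, $\dim V_3=|\mathbf c'|$,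 so $\dim V=n$. Then $\mathfrak X(\lambda)=\mathscr F\!\ell(\mathbf a')\times\mathscr F\!\ell(\mathbf b')\times\mathscr F\!\ell(\mathbf c')\times\mathscr F\!\ell(\mathbf d)$, where the first three factors are flags in $V_1,V_2,V_3$ and the fourth one consists of flags in $V$; $L=\mathrm{GL}(V_1)\times\mathrm{GL}(V_2)\times\mathrm{GL}(V_3)\subset\mathrm{GL}(V)$ acts diagonally. $\mathscr Q=\mathscr Q(\boldsymbol\ell)$ is the star-shaped quiver with vertices $A_i$ ($1\le i\le\ell_1$), $B_i$ ($1\le i\le\ell_2$), $C_i$ ($1\le i\le\ell_3$), $D_i$ ($1\le i\le\ell_4$), where $A_{\ell_1}=B_{\ell_2}=C_{\ell_3}=D_{\ell_4}$ is the central vertex, and arrows $\alpha_i:A_i\to A_{i+1}$, $\beta_i:B_i\to B_{i+1}$, $\gamma_i:C_i\to C_{i+1}$, $\delta_i:D_i\to D_{i+1}$. $\mathrm{Rep}\,\mathscr Q$ is the category of finite-dimensional representations of $\mathscr Q$ over $\mathbb K$, and $\mathrm{Rep}'\mathscr Q$ is the full subcategory of those $\pi$ such that $\pi(\chi)$ is injective for every arrow $\chi$ and $\pi(D_{\ell_4})=\mathrm{Im}\,\pi(\alpha_{\ell_1-1})\oplus\mathrm{Im}\,\pi(\beta_{\ell_2-1})\oplus\mathrm{Im}\,\pi(\gamma_{\ell_3-1})$ (an image is taken to be $0$ if the corresponding $\ell_j=1$). The dimension vector of $\pi$ is the quadruple of sequences $(\dim\pi(X_i)-\dim\pi(X_{i-1}))_i$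 for $X=A,B,C,D$, with $\pi(X_0)=0$. A point $F=(F^{(1)},F^{(2)},F^{(3)},F^{(4)})\in\mathfrak X(\lambda)$ is regarded as an object of $\mathrm{Rep}'\mathscr Q$ of dimension vector $\lambda$ by placing $F^{(1)}_i,F^{(2)}_i,F^{(3)}_i$ at $A_i,B_i,C_i$ (below the central vertex), $F^{(4)}_i$ at $D_i$ (so $V$ at the central vertex), all arrows being inclusions. *)

(* Defs.v *)
From HB Require Import structures.
From mathcomp Require Import all_boot all_order all_algebra.
From mathcomp Require Import mpoly.

Set Implicit Arguments.
Unset Strict Implicit.
Unset Printing Implicit Defensive.

Import GRing.Theory.
Local Open Scope ring_scope.

(* The four arms of the star are indexed by 'I_4, in the order A, B, C, D; the
   quadruple of lengths is l : 'I_4 -> nat. *)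
Definition armA : 'I_4 := @Ordinal 4 0 isT.
Definition armB : 'I_4 := @Ordinal 4 1 isT.
Definition armC : 'I_4 := @Ordinal 4 2 isT.
Definition armD : 'I_4 := @Ordinal 4 3 isT.

Section Quadruples.
Variable l : 'I_4 -> nat.

(* Quadruples of sequences of natural numbers of lengths l; the pointwise
   addition is that of the nmodType {ffun _ -> nat}. *)
Definition quad := {ffun {j : 'I_4 & 'I_(l j)} -> nat}.

Definition part (lam : quad) (j : 'I_4) : seq nat :=
  [seq lam (Tagged (fun j => 'I_(l j)) i) | i <- enum 'I_(l j)].

Definition chop (s : seq nat) : seq nat := take (size s).-1 s.

Definition total (lam : quad) : nat := sumn (part lam armD).

Definition in_Lambda (lam : quad) : Prop :=
  [/\ lam != 0,
      forall j, sumn (part lam j) = total lam &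
      (sumn (chop (part lam armA)) + sumn (chop (part lam armB))
        + sumn (chop (part lam armC)))%N = total lam].

Definition summand (mu lam : quad) : Prop :=
  exists nu : quad, (in_Lambda nu \/ nu = 0) /\ lam = mu + nu.

Definition tits (lam : quad) : rat :=
  2%:R^-1 * (\sum_x (lam x)%:R ^+ 2 - 2%:R * (total lam)%:R ^+ 2).

Definition finiteness_condition (lam : quad) : Prop :=
  forall mu : quad, in_Lambda mu -> summand mu lam -> 1 <= tits mu.

Definition decomposition (lam : quad) (s : seq quad) : Prop :=
  [/\ (0 < size s)%N, \sum_(mu <- s) mu = lam &
      forall mu, mu \in s -> in_Lambda mu /\ tits mu = 1].

End Quadruples.

(* The map induced by f is a bijection from A modulo eA to B modulo eB. *)
Definition quotient_bijection (S T : Type) (A : S -> Prop)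
    (eA : S -> S -> Prop) (B : T -> Prop) (eB : T -> T -> Prop)
    (f : S -> T) : Prop :=
  [/\ forall x, A x -> B (f x),
      forall x x', A x -> A x' -> (eA x x' <-> eB (f x) (f x')) &
      forall y, B y -> exists2 x, A x & eB (f x) y].

Section Zariski.
Variables (K : fieldType) (W : vectType K).

(* U is open in A for the topology induced on A by the Zariski topology of the
   affine space W; it does not depend on the basis of W. *)
Definition zariski_open_in (A U : W -> Prop) : Prop :=
  exists S : {mpoly K[\dim {: W}]} -> Prop,
    forall x, A x ->
      (U x <-> exists2 p, S p & p.@[fun i => coord (vbasis {: W}) i x] != 0).

End Zariski.

Section DoubleFlags.
Variables (K : fieldType) (l : 'I_4 -> nat) (V : vectType K).
Variables (V1 V2 V3 : {vspace V}) (lam : quad l).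

(* The flag 0 = F_0 <= F_1 <= ... <= F_k = W is given by [:: F_1; ...; F_k]. *)
Definition is_flag (W : {vspace V}) (d : seq nat) (F : seq {vspace V}) : Prop :=
  [/\ size F = size d,
      last 0%VS F = W &
      forall i, (i < size d)%N ->
        (nth 0%VS (0%VS :: F) i <= nth 0%VS F i)%VS /\
        \dim (nth 0%VS F i) = (\dim (nth 0%VS (0%VS :: F) i) + nth 0 d i)%N].

Definition point := {ffun 'I_4 -> seq {vspace V}}.

Definition double_flag (F : point) : Prop :=
  [/\ is_flag V1 (chop (part lam armA)) (F armA),
      is_flag V2 (chop (part lam armB)) (F armB),
      is_flag V3 (chop (part lam armC)) (F armC) &
      is_flag fullv (part lam armD) (F armD)].

Definition in_GL (g : 'End(V)) : Prop := lker g == 0%VS.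

(* GL(V1) x GL(V2) x GL(V3) inside GL(V), when V is the direct sum of the Vi *)
Definition in_L (h : 'End(V)) : Prop :=
  [/\ in_GL h, (h @: V1)%VS = V1, (h @: V2)%VS = V2 & (h @: V3)%VS = V3].

(* Action of (h, g) in L x GL(V): h moves the flags in V1, V2, V3 and g moves
   the flag in V. It is transitive on the double flag variety. *)
Definition act (h g : 'End(V)) (F : point) : point :=
  [ffun j => [seq ((if j == armD then g else h) @: U)%VS | U <- F j]].

Definition same_orbit (F F' : point) : Prop :=
  exists2 h, in_L h & F' = act h h F.

Definition finitely_many_orbits : Prop :=
  exists s : seq point,
    forall F, double_flag F -> exists2 F', F' \in s & same_orbit F' F.

(* Zariski topology of the double flag variety, as the quotient of the
   algebraic group L x GL(V) by a (parabolic) stabilizer: the quotient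
   topology for the orbit maps (h, g) |-> (h, g) F. *)
Definition flag_open (U : point -> Prop) : Prop :=
  forall F, double_flag F ->
    @zariski_open_in K ('End(V) * 'End(V))%type
      (fun hg => in_L hg.1 /\ in_GL hg.2)
      (fun hg => U (act hg.1 hg.2 F)).

Definition flag_dense (O : point -> Prop) : Prop :=
  forall U, flag_open U -> (exists2 F, double_flag F & U F) ->
    exists2 F, double_flag F & U F /\ O F.

Definition open_dense_orbit (F : point) : Prop :=
  [/\ double_flag F, flag_open (same_orbit F) & flag_dense (same_orbit F)].

End DoubleFlags.

Section StarQuiver.
Variables (K : fieldType) (l : 'I_4 -> nat).

(* Arrows are indexed by their sources, which are the non-central vertices:
   Some (j; i) is the (i+1)-st vertex of arm j, and None is the center. *)
Definition arrow := {j : 'I_4 & 'I_(l j).-1}.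
Definition vertex := option arrow.
Definition center : vertex := None.

(* The (i+1)-st vertex of arm j, for i < l j *)
Definition vtx (j : 'I_4) (i : nat) : vertex :=
  omap (fun i' : 'I_(l j).-1 => Tagged (fun j => 'I_(l j).-1) i') (insub i).

Definition src (a : arrow) : vertex := Some a.
Definition tgt (a : arrow) : vertex := vtx (tag a) (tagged a).+1.

Record rep := Rep {
  rep_space : vertex -> vectType K;
  rep_map : forall a, 'Hom(rep_space (src a), rep_space (tgt a)) }.

Definition is_morphism (pi rho : rep)
    (phi : forall v, 'Hom(rep_space pi v, rep_space rho v)) : Prop :=
  forall a, (phi (tgt a) \o rep_map pi a)%VF = (rep_map rho a \o phi (src a))%VF.

Definition rep_iso (pi rho : rep) : Prop :=
  exists (phi : forall v, 'Hom(rep_space pi v, rep_space rho v))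
         (psi : forall v, 'Hom(rep_space rho v, rep_space pi v)),
    [/\ is_morphism phi, is_morphism psi,
        forall v, (psi v \o phi v)%VF = \1%VF &
        forall v, (phi v \o psi v)%VF = \1%VF].

Definition rep_sum (pi rho : rep) : rep :=
  @Rep (fun v => (rep_space pi v * rep_space rho v)%type)
    (fun a => linfun (fun x => (rep_map pi a x.1, rep_map rho a x.2))).

Definition rep_zero (pi : rep) : Prop := forall v, \dim {: rep_space pi v} = 0%N.

(* The image of the arrow a, as a subspace at the vertex v = tgt a *)
Definition image_at (pi : rep) (v : vertex) (a : arrow) :
    {vspace rep_space pi v} :=
  if tgt a =P v is ReflectT e
  then ecast w {vspace rep_space pi w} e (limg (rep_map pi a)) else 0%VS.

(* The image of the last arrow of arm j; the sum has no term if l j = 1 and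
   exactly one otherwise. *)
Definition last_image (pi : rep) (j : 'I_4) : {vspace rep_space pi center} :=
  (\sum_(i < (l j).-1 | i.+1 == (l j).-1)
     image_at pi center (Tagged (fun j => 'I_(l j).-1) i))%VS.

Definition in_Rep' (pi : rep) : Prop :=
  [/\ forall a, lker (rep_map pi a) == 0%VS,
      (last_image pi armA + last_image pi armB + last_image pi armC)%VS = fullv &
      directv (last_image pi armA + last_image pi armB + last_image pi armC)].

Definition indecomposable' (pi : rep) : Prop :=
  [/\ in_Rep' pi, ~ rep_zero pi &
      forall rho sigma, in_Rep' rho -> in_Rep' sigma ->
        rep_iso pi (rep_sum rho sigma) -> rep_zero rho \/ rep_zero sigma].

Definition dim_vector (pi : rep) (x : {j : 'I_4 & 'I_(l j)}) : int :=
  let dim_at i := \dim {: rep_space pi (vtx (tag x) i)} in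
  let i := nat_of_ord (tagged x) in
  (dim_at i)%:Z - (if i is i'.+1 then (dim_at i')%:Z else 0).

Variable V : vectType K.

Definition point_space (F : point V) (v : vertex) : {vspace V} :=
  if v is Some a then nth fullv (F (tag a)) (tagged a) else fullv.

(* When U <= W, the map vsproj W \o vsval is the inclusion of U into W. *)
Definition rep_of_point (F : point V) : rep :=
  @Rep (fun v => subvs_of (point_space F v))
    (fun a => linfun (vsproj (point_space F (tgt a)) \o vsval)).

End StarQuiver.

(* Main.v *)
(** Objects of Rep' are treated as configurations U of subspaces of V.  The endomorphisms of U
    are the intersection C :&: P inside End(V), where C preserves the flags in V1, V2, V3 and P
    the flag in V; Ext^1(U, U) is the quotient of End(V) by C + P, and counting dimensions
    (lambda|lambda) = dim C + dim P - dim End(V) = dim End(U) - dim Ext^1(U, U).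

    If there are finitely many orbits, one of them is dense, which forces
    dim C + dim P > dim End(V) as the scalars act trivially.  Having finitely many orbits
    passes to summands because one-dimensional configurations cancel in direct sums.

    Conversely, under the condition on summands, an argument of Ringel shows that an
    indecomposable configuration has only scalar endomorphisms, hence no Ext^1 and form 1.
    Configurations without Ext^1 form open orbits, and two nonempty open sets meet, so such a
    configuration is determined by its dimension vector; one exists for every dimension vector
    of form 1, where the endomorphism algebra is smallest.  The Krull-Schmidt theorem then
    identifies orbits with decompositions into vectors of form 1. *)

From HB Require Import structures.
From Stdlib Require Import Classical ClassicalEpsilon.
Require Import Defs.
From mathcomp Require Import all_boot all_order all_algebra zify ring.
From mathcomp Require Import mpoly.

Set Implicit Arguments.
Unset Strict Implicit.
Unset Printing Implicit Defensive.

Import Order.TTheory GRing.Theory Num.Theory.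
Local Open Scope ring_scope.

(** All geometry takes place in the affine space End(V) x End(V). A pair (h, g) moves the flags on
    arms A, B, C by h and the flag on arm D by g; this is transitive on the configurations of a
    given dimension vector, and the pairs producing one isomorphism class are the (k c h0, k p g0)
    with k invertible and c, p invertible in the two preservers. Dimension theory is replaced by
    explicit polynomials: a polynomial map from a space of smaller dimension satisfies an algebraic
    relation, so such sets cannot cover everything when dim C + dim P is at most dim End(V), and a
    rigid configuration is deformed by means of an adjugate matrix. The obstacle in passing to
    summands is that indecomposables are not yet under control, so a general complement cannot be
    cancelled. A one-dimensional term can, because its endomorphisms are scalars; the complement of
    a summand is therefore removed one dimension at a time. Characteristic zero enters where
    multiplicities of dimension vectors are compared as sums of scalars in K. *)

Local Notation total := Defs.total.

(* An object of Rep' with arrows replaced by inclusions: U j i is the i-th term of the flag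
   on arm j, with U j 0 = 0 and U j (l j) = V; values beyond l j are irrelevant. *)
Local Notation config V := ('I_4 -> nat -> {vspace V}).

(** * Chains of subspaces *)

Section LinearAlgebra.
Variable K : fieldType.
Implicit Types V W : vectType K.

Lemma linfun_linear V W (f : V -> W) : linear f -> linfun f =1 f.
Proof.
move=> lin_f; pose flM := GRing.isLinear.Build _ _ _ _ f lin_f.
pose fL : {linear _ -> _} := HB.pack f flM.
exact: (lfunE fL).
Qed.

Lemma dim_hom V W : \dim {: 'Hom(V, W)} = (\dim {: V} * \dim {: W})%N.
Proof. by rewrite !dimvf. Qed.

Lemma dim_pair V W : \dim {: (V * W)%type} = (\dim {: V} + \dim {: W})%N.
Proof. by rewrite !dimvf. Qed.

Lemma dim_subvs V (A : {vspace V}) : \dim {: subvs_of A} = \dim A.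
Proof. by rewrite dimvf. Qed.

Lemma directv_projections V (I : finType) (G : I -> {vspace V}) :
  directv (\sum_i G i) -> (\sum_i G i)%VS = fullv ->
  exists p : I -> 'End(V),
    [/\ forall i v, p i v \in G i, forall v, \sum_i p i v = v &
        forall i j v, v \in G j -> p i v = if i == j then v else 0].
Proof.
move=> dG sG; exists (fun i => sumv_pi (\sum_i G i)%VS i).
have sumP v : \sum_i sumv_pi (\sum_i G i)%VS i v = v.
  by apply: (sumv_pi_sum (erefl _)); rewrite sG memvf.
split=> // [i v|i j v vG]; first exact: memv_sum_pi.
have /directv_sum_unique uniqG := dG.
have := uniqG (fun i => sumv_pi (\sum_i G i)%VS i v) (fun i => if i == j then v else 0).
rewrite sumP -big_mkcond big_pred1_eq eqxx => H.
have mem_if k : true -> (if k == j then v else 0) \in G k.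
  by move=> _; case: eqP => [->|] //; rewrite mem0v.
have mem_pi k : true -> sumv_pi (\sum_i G i)%VS k v \in G k.
  by move=> _; apply: memv_sum_pi.
by have /esym/forallP/(_ i)/eqP := H mem_pi mem_if.
Qed.

Lemma lfun_between V W (A : {vspace V}) (B : {vspace W}) :
  \dim A = \dim B -> exists f : 'Hom(V, W), (f @: A)%VS = B.
Proof.
move=> dAB.
have [f fA] : exists f : 'Hom(V, W), map f (vbasis A) = vbasis B :> seq W.
  have [f] := linear_of_free (vbasis A) (vbasis B).
  move=> ff; exists (linfun f).
  rewrite -ff ?(basis_free (vbasisP A)) ?size_tuple //.
  by apply: eq_map => x; rewrite lfunE.
exists f; rewrite -(span_basis (vbasisP A)) limg_span fA.
exact: (span_basis (vbasisP B)).
Qed.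

(** Precomposition with the projection [p] embeds Hom(A, B) into Hom(V, W). These spaces are the
    blocks from which the preservers are assembled. *)
Lemma hom_between V W (p : 'End(V)) (A : {vspace V}) (B : {vspace W}) :
  (forall v, p v \in A) -> (forall v, v \in A -> p v = v) ->
  exists S : {vspace 'Hom(V, W)}, \dim S = (\dim A * \dim B)%N /\
    forall f, f \in S <-> (forall v, f (p v) = f v) /\ (forall v, f v \in B).
Proof.
move=> pA pid.
pose phi (g : 'Hom(subvs_of A, subvs_of B)) : 'Hom(V, W) :=
  (linfun vsval \o g \o linfun (vsproj A) \o p)%VF.
have phiE g v : phi g v = vsval (g (vsproj A (p v))) by rewrite /phi !comp_lfunE !lfunE.
pose Phi := linfun phi; have PhiE : Phi =1 phi.
  apply: linfun_linear => c g h; apply/lfunP=> v.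
  by rewrite add_lfunE scale_lfunE !phiE add_lfunE scale_lfunE linearP.
exists (limg Phi); split.
  rewrite limg_dim_eq ?dim_hom ?dim_subvs //.
  rewrite capfv; apply/eqP/lker0P => g h; rewrite !PhiE => /lfunP eq_gh.
  apply/lfunP=> v; apply: subvs_inj.
  by have := eq_gh (vsval v); rewrite !phiE pid ?subvsP // vsvalK.
move=> f; split=> [/memv_imgP[g _ ->]|[fp fB]].
  by split=> v; rewrite PhiE !phiE ?subvsP // (pid (p v)).
apply/memv_imgP; exists (linfun (vsproj B) \o f \o linfun vsval)%VF; rewrite ?memvf //.
apply/lfunP=> v; rewrite PhiE phiE !comp_lfunE !lfunE /= vsprojK //.
by rewrite vsprojK ?pA // fp.
Qed.

End LinearAlgebra.

Section Chains.
Variable K : fieldType.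
Implicit Types V W : vectType K.

(* One step: a complement Z of U_i + X in U_i.+1 + X taken inside U_i.+1 meets U_i + X
   trivially, so p may be reset to 0 on Z without changing it on U_i + X. *)
Lemma filtered_extension V W (U : nat -> {vspace V}) (U' : nat -> {vspace W})
    (X : {vspace V}) (q : 'Hom(V, W)) m :
  U 0%N = 0%VS ->
  (forall i, (i < m)%N -> (U i <= U i.+1)%VS) ->
  (forall i, (i < m)%N -> (U' i <= U' i.+1)%VS) ->
  (forall i v, (i <= m)%N -> v \in X -> v \in U i -> q v \in U' i) ->
  exists p : 'Hom(V, W), (forall v, v \in X -> p v = q v) /\
    forall i, (i <= m)%N -> (p @: U i <= U' i)%VS.
Proof.
move=> U0; elim: m => [|m IHm] Uinc U'inc qX.
  by exists q; split=> // i; rewrite leqn0 => /eqP->; rewrite U0 limg0 sub0v.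
have [i lt_im|i lt_im|i v le_im|p [pq pU]] := IHm _ _ _; first exact/Uinc/leqW.
  exact/U'inc/leqW.
  by apply: qX; apply: leqW.
pose Y := (U m + X)%VS; pose Z := (U m.+1 :\: Y)%VS.
have YZ0 : (Y :&: Z = 0)%VS by rewrite capvC capv_diff.
pose r := daddv_pi Y Z.
have rY v : v \in Y -> r v = v by apply: daddv_pi_id.
have rZ v : v \in Z -> r v = 0.
  move=> vZ; have vYZ : v \in (Y + Z)%VS by rewrite (subvP (addvSr _ _)).
  have := daddv_pi_add YZ0 vYZ; rewrite -/r (daddv_pi_id _ vZ) ?(capvC Z) //.
  by move/(canRL (addrK _)); rewrite subrr.
have XY : (X <= Y)%VS := addvSr _ _; have UY : (U m <= Y)%VS := addvSl _ _.
exists (p \o r)%VF; split=> [v vX|i].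
  by rewrite comp_lfunE rY ?pq // (subvP XY).
rewrite leq_eqVlt => /predU1P[->|]; last first.
  rewrite ltnS => le_im; apply: subv_trans (pU i le_im).
  apply/subvP=> _ /memv_imgP[v vU ->]; rewrite comp_lfunE rY ?memv_img //.
  apply: (subvP UY); elim: {+}m le_im Uinc => [|k IHk]; first by rewrite leqn0 => /eqP<-.
  rewrite leq_eqVlt => /predU1P[<- //|le_ik] Uinc.
  by apply: (subvP (Uinc k _)) => //; apply: IHk => // j ltjk; apply/Uinc/leqW.
rewrite -(addv_diff_cap (U m.+1) Y) limgD subv_add; apply/andP; split.
  apply/subvP=> _ /memv_imgP[v vZ ->].
  by rewrite comp_lfunE rZ // linear0 mem0v.
rewrite capvC -vspace_modl ?Uinc // limgD subv_add; apply/andP; split.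
  apply: subv_trans (U'inc m (ltnSn _)); apply: subv_trans (pU m (leqnn _)).
  apply/subvP=> _ /memv_imgP[v vU ->].
  by rewrite comp_lfunE rY ?memv_img // (subvP UY).
apply/subvP=> _ /memv_imgP[v /memv_capP[vX vU] ->].
by rewrite comp_lfunE rY ?(subvP XY) // pq // qX.
Qed.

(** Spans of initial segments of one basis of [W]. *)
Lemma exists_chain V (W : {vspace V}) (d : nat -> nat) m :
  (\sum_(i < m) d i = \dim W)%N ->
  exists U : nat -> {vspace V}, [/\ U 0%N = 0%VS, U m = W,
    forall i, (U i <= U i.+1)%VS &
    forall i, (i <= m)%N -> \dim (U i) = (\sum_(k < i) d k)%N].
Proof.
move=> dW; pose U i := <<take (\sum_(k < i) d k) (vbasis W)>>%VS.
have le_sum i : (i <= m)%N -> (\sum_(k < i) d k <= \dim W)%N.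
  move=> le_im; rewrite -dW (big_ord_widen _ _ le_im).
  by rewrite [leqRHS](bigID (fun k : 'I_m => (k < i)%N)) leq_addr.
have dU i : (i <= m)%N -> \dim (U i) = (\sum_(k < i) d k)%N.
  move=> le_im; apply/eqP; have := basis_free (vbasisP W).
  rewrite -(cat_take_drop (\sum_(k < i) d k) (vbasis W)) => /catl_free.
  by rewrite /free size_takel // size_tuple le_sum.
have UW i : (U i <= W)%VS by apply/span_subvP => v /mem_take /vbasis_mem.
exists U; split=> //.
- by rewrite /U big_ord0 take0 span_nil.
- by apply/eqP; rewrite eqEdim UW dU // dW leqnn.
- move=> i; apply: sub_span => v; rewrite big_ord_recr /= => /(nthP 0)[k].
  by rewrite takeD mem_cat => lt_k <-; rewrite mem_nth.
Qed.

End Chains.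

(** * Flags in the summands of a direct decomposition *)

Section MultiChain.
Variables (K : fieldType) (J : finType) (m : J -> nat).
Implicit Types V W : vectType K.

(** One notion for both halves of a double flag: the three flags in V1, V2, V3, and the single flag
    in V. *)
Definition multichain V (U : J -> nat -> {vspace V}) : Prop :=
  [/\ forall j, U j 0%N = 0%VS,
      forall j i, (i < m j)%N -> (U j i <= U j i.+1)%VS,
      (\sum_j U j (m j))%VS = fullv &
      directv (\sum_j U j (m j))].

Definition preserves V W (U : J -> nat -> {vspace V}) (U' : J -> nat -> {vspace W})
    (f : 'Hom(V, W)) : Prop :=
  forall j i, (i <= m j)%N -> (f @: U j i <= U' j i)%VS.

Let cell := {j : J & 'I_(m j)}.
(** Complements of the successive steps of the flags. They split V into blocks with respect to which
    preserving maps are block triangular. *)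
Definition piece V (U : J -> nat -> {vspace V}) (x : {j : J & 'I_(m j)}) : {vspace V} :=
  (U (tag x) (tagged x).+1 :\: U (tag x) (tagged x))%VS.

Lemma chain_mono V (U : J -> nat -> {vspace V}) j i i' :
  multichain U -> (i <= i')%N -> (i' <= m j)%N -> (U j i <= U j i')%VS.
Proof.
move=> [_ Uinc _ _]; elim: i' => [|i' IHi]; first by rewrite leqn0 => /eqP->.
rewrite leq_eqVlt => /predU1P[->//|]; rewrite ltnS => le_ii' lt_i'm.
by apply: (subv_trans (IHi le_ii' (ltnW lt_i'm))); apply: Uinc.
Qed.

Lemma chain_sum V (U : J -> nat -> {vspace V}) j i :
  multichain U -> (i <= m j)%N -> U j i = (\sum_(k < i) (U j k.+1 :\: U j k))%VS.
Proof.
move=> mU; elim: i => [|i IHi] lt_im; first by rewrite big_ord0; have [-> _ _ _] := mU.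
rewrite big_ord_recr /= -(IHi (ltnW lt_im)) addvC addv_diff.
by apply/esym/addv_idPl; apply: chain_mono.
Qed.

Lemma sum_piece V (U : J -> nat -> {vspace V}) :
  multichain U -> (\sum_x piece U x)%VS = fullv.
Proof.
move=> mU; have [_ _ <- _] := mU.
under [RHS]eq_bigr => j _ do rewrite (chain_sum mU (leqnn _)).
by rewrite sig_big_dep.
Qed.

Lemma dim_piece V (U : J -> nat -> {vspace V}) x : multichain U ->
  \dim (piece U x) = (\dim (U (tag x) (tagged x).+1) - \dim (U (tag x) (tagged x)))%N.
Proof.
move=> mU; rewrite -(dimv_cap_compl (U (tag x) (tagged x).+1) (U (tag x) (tagged x))).
have [_ Uinc _ _] := mU.
by rewrite (capv_idPr _) ?Uinc // addKn.
Qed.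

Lemma directv_piece V (U : J -> nat -> {vspace V}) :
  multichain U -> directv (\sum_x piece U x).
Proof.
move=> mU; rewrite directvEgeq /= sum_piece //.
have [U0 Uinc <- dU] := mU; rewrite (directvP dU) /=.
rewrite -(sig_big_dep xpredT (fun _ => xpredT)
  (fun j (i : 'I_(m j)) => \dim (U j i.+1 :\: U j i)%VS)) /=.
apply: leq_sum => j _.
suffices H i : (i <= m j)%N -> \sum_(k < i) \dim (U j k.+1 :\: U j k) = \dim (U j i).
  by rewrite H.
elim: i => [|i IHi] lt_im; first by rewrite big_ord0 U0 dimv0.
rewrite big_ord_recr /= IHi ?(ltnW lt_im) //.
rewrite -(dimv_cap_compl (U j i.+1) (U j i)).
by rewrite (capv_idPr _) ?Uinc.
Qed.

Lemma preserves_piece V W (U : J -> nat -> {vspace V}) (U' : J -> nat -> {vspace W}) f :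
  multichain U -> multichain U' ->
  preserves U U' f <->
  forall x : cell, (f @: piece U x <= U' (tag x) (tagged x).+1)%VS.
Proof.
move=> mU mU'; split=> [pf x|pf j i le_im].
  by apply: subv_trans (limgS _ (diffvSl _ _)) (pf _ _ _).
rewrite (chain_sum mU) // limg_sum; apply/subv_sumP => k _.
have lt_km := leq_trans (ltn_ord k) le_im.
apply: subv_trans (pf (Tagged (fun j => 'I_(m j)) (Ordinal lt_km))) _ => /=.
exact: chain_mono.
Qed.

(** The left-hand side is twice the dimension of the parabolic algebra with diagonal blocks of sizes
    [d]: a full square of blocks plus a second copy of the diagonal ones. *)
Lemma sum_chain_squares (d D : nat -> nat) k :
  D 0%N = 0%N -> (forall i, (i < k)%N -> D i.+1 = D i + d i)%N ->
  (2 * \sum_(i < k) d i * D i.+1 = D k ^ 2 + \sum_(i < k) d i ^ 2)%N.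
Proof.
move=> D0; elim: k => [|k IHk] DS; first by rewrite !big_ord0 D0.
rewrite !big_ord_recr /= mulnDr IHk; last by move=> i /ltnW; apply: DS.
by rewrite (DS k) //; set S := (\sum_(i < k) d i ^ 2)%N; rewrite -!mulnn; nia.
Qed.

(** By [preserves_piece] a map preserves the chains as soon as each block lands one step higher, so
    the preserving maps are the direct sum over the blocks of the spaces given by [hom_between]. *)
Lemma preserves_space V W (U : J -> nat -> {vspace V}) (U' : J -> nat -> {vspace W}) :
  multichain U -> multichain U' ->
  exists2 S : {vspace 'Hom(V, W)}, (forall f, f \in S <-> preserves U U' f) &
    \dim S = \sum_x \dim (piece U x) * \dim (U' (tag x) (tagged x).+1).
Proof.
move=> mU mU'.
have [p [pG psum pid]] := directv_projections (directv_piece mU) (sum_piece mU).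
have /fin_all_exists[S SP] : forall x : cell, exists S : {vspace 'Hom(V, W)},
    \dim S = (\dim (piece U x) * \dim (U' (tag x) (tagged x).+1))%N /\
    forall f, f \in S <-> (forall v, f (p x v) = f v) /\
                          (forall v, f v \in U' (tag x) (tagged x).+1).
  by move=> x; apply: hom_between => // v /(pid x); rewrite eqxx.
exists (\sum_x S x)%VS => [f|].
  rewrite preserves_piece //; split=> [/memv_sumP[fs fsS ->] x|fU].
    apply/subvP=> _ /memv_imgP[v vx ->]; rewrite sum_lfunE memv_suml // => y _.
    have [_ /(_ (fs y))[/(_ (fsS y isT))[fp fU] _]] := SP y.
    rewrite -fp (pid _ _ _ vx); case: eqP => [->|_]; last by rewrite linear0 mem0v.
    by have [_ /(_ (fs x))[/(_ (fsS x isT))[_ fU'] _]] := SP x; rewrite fU'.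
  have ->: f = \sum_x (f \o p x)%VF.
    apply/lfunP=> v; rewrite sum_lfunE -[in LHS](psum v) linear_sum.
    by apply: eq_bigr => x _; rewrite comp_lfunE.
  apply: memv_sumr => x _; have [_ SxP] := SP x; apply/SxP; split=> v.
    by rewrite !comp_lfunE (pid _ _ _ (pG x v)) eqxx.
  by rewrite comp_lfunE; apply: (subvP (fU x)); rewrite memv_img.
have /directvP -> : directv (\sum_x S x).
  apply/directv_sum_independent => fs fsS fs0 x _; apply/lfunP=> v.
  have fsp y w : fs y (p y w) = fs y w.
    by have [_ /(_ (fs y))[/(_ (fsS y isT))[fp _] _]] := SP y.
  have /lfunP/(_ (p x v)) := fs0; rewrite sum_lfunE (bigD1 x) //= big1 => [|y ne_yx].
    by rewrite fsp addr0 !zero_lfunE.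
  by rewrite -fsp (pid _ _ _ (pG x v)) (negPf ne_yx) linear0.
by apply: eq_bigr => x _; have [] := SP x.
Qed.

Lemma dim_preserves V (U : J -> nat -> {vspace V}) : multichain U ->
  exists2 S : {vspace 'End(V)}, (forall f, f \in S <-> preserves U U f) &
    (2 * \dim S = \sum_j (\dim (U j (m j)) ^ 2
        + \sum_(i < m j) (\dim (U j i.+1) - \dim (U j i)) ^ 2))%N.
Proof.
move=> mU; have [S SP dS] := preserves_space mU mU; exists S => //.
rewrite dS -(sig_big_dep xpredT (fun _ => xpredT)
  (fun j (i : 'I_(m j)) => \dim (U j i.+1 :\: U j i)%VS * \dim (U j i.+1))%N) /=.
rewrite big_distrr /=; apply: eq_bigr => j _.
have [U0 Uinc _ _] := mU.
under eq_bigr => i _ do rewrite (dim_piece (Tagged (fun j => 'I_(m j)) i) mU) /=.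
apply: (@sum_chain_squares (fun i => \dim (U j i.+1) - \dim (U j i))%N
                           (fun i => \dim (U j i))); first by rewrite U0 dimv0.
by move=> i lt_i; rewrite subnKC // dimvS // Uinc.
Qed.

(** Corresponding pieces have equal dimensions; the sum of isomorphisms between them carries each
    chain term, a sum of pieces, to the corresponding one. *)
Lemma multichain_transport V W (U : J -> nat -> {vspace V}) (U' : J -> nat -> {vspace W}) :
  multichain U -> multichain U' ->
  (forall j i, (i <= m j)%N -> \dim (U j i) = \dim (U' j i)) ->
  exists h : 'Hom(V, W), [/\ lker h = 0%VS, limg h = fullv &
    forall j i, (i <= m j)%N -> (h @: U j i)%VS = U' j i].
Proof.
move=> mU mU' dUU'.
have [p [pG psum pid]] := directv_projections (directv_piece mU) (sum_piece mU).
have /fin_all_exists[f fP] : forall x : cell, exists f : 'Hom(V, W),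
    (f @: piece U x)%VS = piece U' x.
  by move=> x; apply: lfun_between; rewrite !dim_piece // !dUU' // ltnW.
pose h := \sum_x (f x \o p x)%VF.
have hE x v : v \in piece U x -> h v = f x v.
  move=> vx; rewrite /h sum_lfunE (bigD1 x) //= big1 ?addr0 => [|y ne_yx].
    by rewrite comp_lfunE (pid _ _ _ vx) eqxx.
  by rewrite comp_lfunE (pid _ _ _ vx) (negPf ne_yx) linear0.
have hG x : (h @: piece U x)%VS = piece U' x.
  by rewrite -fP; apply: eq_in_limg => v /hE.
have hU j i : (i <= m j)%N -> (h @: U j i)%VS = U' j i.
  move=> le_im; rewrite !(chain_sum _ le_im) // limg_sum; apply: eq_bigr => k _.
  exact: (hG (Tagged (fun j => 'I_(m j)) (Ordinal (leq_trans (ltn_ord k) le_im)))).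
have hf : limg h = fullv.
  by rewrite -(sum_piece mU) limg_sum -(sum_piece mU'); apply: eq_bigr => x _.
exists h; split=> //; apply/eqP; rewrite -dimv_eq0.
have := limg_ker_dim h fullv; rewrite capfv hf.
have -> : \dim {: V} = \dim {: W}.
  have [_ _ <- /directvP ->] := mU; have [_ _ <- /directvP ->] := mU'.
  by apply: eq_bigr => j _; apply: dUU'.
by move=> /eqP; rewrite -[X in _ == X]add0n eqn_add2r.
Qed.

(** For a single multichain, morphisms extend from compatible subspaces, one summand at a time by
    [filtered_extension]. With both multichains of a configuration a common extension may fail to
    exist: the difference of the two separate extensions is the obstruction in Ext^1. *)
Lemma preserving_extension V W (U : J -> nat -> {vspace V}) (U' : J -> nat -> {vspace W})
    (X : {vspace V}) (q : 'Hom(V, W)) :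
  multichain U -> multichain U' -> (X <= \sum_j (X :&: U j (m j)))%VS ->
  (forall j i v, (i <= m j)%N -> v \in X -> v \in U j i -> q v \in U' j i) ->
  exists2 p : 'Hom(V, W), (forall v, v \in X -> p v = q v) & preserves U U' p.
Proof.
move=> mU mU' XU qX; have [U0 Uinc sU dU] := mU; have [_ U'inc _ _] := mU'.
have /fin_all_exists[p pP] : forall j, exists p : 'Hom(V, W),
    (forall v, v \in X -> p v = q v) /\
    forall i, (i <= m j)%N -> (p @: U j i <= U' j i)%VS.
  by move=> j; apply: filtered_extension (U0 j) (Uinc j) (U'inc j) (qX j).
have [pi [piU pisum piid]] := directv_projections dU sU.
exists (\sum_j (p j \o pi j))%VF => [v vX|j i le_im].
  have /memv_sumP[w wP ->] := subvP XU _ vX.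
  rewrite sum_lfunE [RHS]linear_sum; apply: eq_bigr => j _.
  have /memv_capP[wX wj] := wP j isT.
  transitivity (p j (w j)); last exact: (pP j).1.
  rewrite comp_lfunE linear_sum (bigD1 j) //= big1 => [|k ne_kj].
    by rewrite (piid _ _ _ wj) eqxx addr0.
  by have /memv_capP[_ wk] := wP k isT; rewrite (piid _ _ _ wk) eq_sym (negPf ne_kj).
apply/subvP=> _ /memv_imgP[v vU ->]; have vj : v \in U j (m j).
  by apply: subvP vU; apply: chain_mono.
rewrite sum_lfunE (bigD1 j) //= big1 => [|k ne_kj].
  by rewrite comp_lfunE (piid _ _ _ vj) eqxx addr0 (subvP ((pP j).2 _ le_im)) // memv_img.
by rewrite comp_lfunE (piid _ _ _ vj) (negPf ne_kj) linear0.
Qed.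

End MultiChain.

Lemma big_I4 (R : Type) (idx : R) (op : Monoid.law idx) (F : 'I_4 -> R) :
  \big[op/idx]_j F j = op (op (op (F armA) (F armB)) (F armC)) (F armD).
Proof.
rewrite !big_ord_recr big_ord0 Monoid.mul1m /=.
by do ![congr (op _ _)]; congr F; apply: val_inj.
Qed.

(** * Configurations *)

Section Preservers.
Variables (K : fieldType) (J : finType) (m : J -> nat).
Implicit Types V W : vectType K.

(** Written as the kernel of a linear map so as to be a [{vspace}] with a dimension; the projections
    chosen for A and B do not affect it, see [transporterP]. *)
Definition transporter V W (A : {vspace V}) (B : {vspace W}) : {vspace 'Hom(V, W)} :=
  lker (linfun (fun f : 'Hom(V, W) => ((\1 - projv B) \o f \o projv A)%VF)).

Lemma transporterP V W (A : {vspace V}) (B : {vspace W}) f :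
  (f \in transporter A B) = (f @: A <= B)%VS.
Proof.
rewrite memv_ker linfun_linear; last first.
  move: (\1 - projv B)%VF (projv A) => a b c g h; apply/lfunP=> v.
  by rewrite add_lfunE scale_lfunE !comp_lfunE add_lfunE scale_lfunE linearP.
apply/eqP/idP => [/lfunP f0|/subvP fAB].
  apply/subvP=> _ /memv_imgP[v vA ->]; have := f0 v.
  rewrite !comp_lfunE projv_id // add_lfunE opp_lfunE id_lfunE zero_lfunE => /eqP.
  by rewrite subr_eq0 => /eqP->; apply: memv_proj.
apply/lfunP=> v; rewrite !comp_lfunE add_lfunE opp_lfunE id_lfunE zero_lfunE.
by rewrite (@projv_id _ _ B) ?subrr //; apply/fAB/memv_img/memv_proj.
Qed.

Definition preserver V W (U : J -> nat -> {vspace V}) (U' : J -> nat -> {vspace W}) :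
    {vspace 'Hom(V, W)} :=
  (\bigcap_j \bigcap_(i < (m j).+1) transporter (U j i) (U' j i))%VS.

Lemma preserverP V W (U : J -> nat -> {vspace V}) (U' : J -> nat -> {vspace W}) f :
  reflect (preserves m U U' f) (f \in preserver U U').
Proof.
apply: (iffP subv_bigcapP) => [fU j i le_im|fU j _].
  have /subv_bigcapP/(_ (Ordinal (le_im : (i < (m j).+1)%N)) isT) := fU j isT.
  by rewrite -memvE transporterP.
by apply/subv_bigcapP => i _; rewrite -memvE transporterP fU // -ltnS.
Qed.

Lemma preserves_mem V W (U : J -> nat -> {vspace V}) (U' : J -> nat -> {vspace W}) f :
  preserves m U U' f <-> forall j i v, (i <= m j)%N -> v \in U j i -> f v \in U' j i.
Proof.
split=> fU j i; first by move=> v le_im vU; apply: (subvP (fU j i le_im)); apply: memv_img.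
by move=> le_im; apply/subvP=> _ /memv_imgP[v vU ->]; apply: fU.
Qed.

Lemma preserves_id V (U : J -> nat -> {vspace V}) : preserves m U U \1%VF.
Proof. by move=> j i _; rewrite lim1g. Qed.

Lemma preserves_comp V1 V2 V3 (U1 : J -> nat -> {vspace V1}) (U2 : J -> nat -> {vspace V2})
    (U3 : J -> nat -> {vspace V3}) (f : 'Hom(V2, V3)) (g : 'Hom(V1, V2)) :
  preserves m U2 U3 f -> preserves m U1 U2 g -> preserves m U1 U3 (f \o g)%VF.
Proof.
move=> fU gU j i le_im; rewrite limg_comp.
by apply: subv_trans (fU j i le_im); apply/limgS/gU.
Qed.

End Preservers.

(** * Configurations, subobjects and strict embeddings *)

Section Objects.
Variables (K : fieldType) (l : 'I_4 -> nat).
Hypothesis l_gt0 : forall j, (0 < l j)%N.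
Implicit Types V W : vectType K.

(* The endomorphisms of a configuration U are those preserving both the multichain of the
   flags in V1, V2, V3 (lengths [lenC]) and the flag in V (lengths [lenD]); the length 0 on the
   remaining arms allows sums over all four arms. *)
Definition lenC (j : 'I_4) : nat := if j == armD then 0%N else (l j).-1.
Definition lenD (j : 'I_4) : nat := if j == armD then l j else 0%N.

(** The last two clauses say that V is the direct sum of the ends of arms A, B, C: the term of arm D
    is [U armD 0], which vanishes. *)
Definition object V (U : config V) : Prop :=
  [/\ forall j, U j 0%N = 0%VS,
      forall j i, (i < l j)%N -> (U j i <= U j i.+1)%VS,
      forall j, U j (l j) = fullv,
      (\sum_j U j (lenC j))%VS = fullv &
      directv (\sum_j U j (lenC j))].

Definition mor V W (U : config V) (U' : config W) :=
  preserves l U U'.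

Definition dimq V (U : config V) : quad l :=
  [ffun x : {j : 'I_4 & 'I_(l j)} =>
     (\dim (U (tag x) (tagged x).+1) - \dim (U (tag x) (tagged x)))%N].

Lemma lenC_le j : (lenC j <= l j)%N.
Proof. by rewrite /lenC; case: eqP => // _; rewrite leq_pred. Qed.

Lemma lenD_le j : (lenD j <= l j)%N.
Proof. by rewrite /lenD; case: eqP. Qed.

Lemma lenC_lt j : (lenC j < l j)%N.
Proof. by rewrite /lenC; case: eqP => // _; rewrite prednK. Qed.

Lemma sum_lenD V (U : config V) : (forall j, U j 0%N = 0%VS) ->
  (\sum_j U j (lenD j))%VS = U armD (l armD).
Proof. by move=> U0; rewrite big_I4 /lenD /= !U0 !add0v. Qed.

Lemma multichainC V (U : config V) : object U -> multichain lenC U.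
Proof.
case=> U0 Uinc Ul sU dU; split=> // j i lt_i; apply: Uinc.
exact: (leq_trans lt_i (lenC_le j)).
Qed.

Lemma multichainD V (U : config V) : object U -> multichain lenD U.
Proof.
case=> U0 Uinc Ul sU dU; split=> [//|j i lt_i||].
- by apply: Uinc; apply: (leq_trans lt_i (lenD_le j)).
- by rewrite sum_lenD.
by rewrite directvEgeq /= sum_lenD // big_I4 /lenD /= !U0 !dimv0.
Qed.

(** The only levels covered by neither length function are the tops of arms A, B, C, where every map
    preserves the whole space. *)
Lemma morE V W (U : config V) (U' : config W) f :
  object U -> object U' ->
  mor U U' f <-> preserves lenC U U' f /\ preserves lenD U U' f.
Proof.
move=> [_ _ Ul _ _] [_ _ U'l _ _]; split=> [fU|[fC fD] j i].
  by split=> j i le_i; apply: fU; apply: (leq_trans le_i); rewrite ?lenC_le ?lenD_le.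
have := fD j i; rewrite /lenD; case: eqP => [->|/eqP ne_jD _]; first by move=> H /H.
rewrite leq_eqVlt => /predU1P[->|lt_il]; first by rewrite Ul U'l subvf.
by apply: fC; rewrite /lenC (negPf ne_jD) -ltnS prednK.
Qed.

Lemma object_decomp V (U : config V) v : object U ->
  exists2 w : 'I_4 -> V, v = \sum_j w j & forall j, w j \in U j (lenC j).
Proof.
move=> [_ _ _ sU _]; have : v \in (\sum_j U j (lenC j))%VS by rewrite sU memvf.
by move=> /memv_sumP[w wU ->]; exists w => // j; apply: wU.
Qed.

Lemma object_independent V (U : config V) (w : 'I_4 -> V) : object U ->
  (forall j, w j \in U j (lenC j)) -> \sum_j w j = 0 -> forall j, w j = 0.
Proof.
move=> [_ _ _ _ /directv_sum_independent dU] wU w0 j.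
by apply: (dU w) => // k _; apply: wU.
Qed.

Definition induced V (U : config V) (X : {vspace V}) j i :
    {vspace subvs_of X} :=
  (linfun vsval @^-1: U j i)%VS.

Lemma mem_induced V (U : config V) (X : {vspace V}) j i w :
  (w \in induced U X j i) = (vsval w \in U j i).
Proof. by rewrite -memv_preim lfunE. Qed.

(** The condition for [X] to carry a subobject: it splits along the decomposition of V. Kernels of
    morphisms and images of endomorphisms satisfy it ([good_ker], [good_idem]). *)
Definition good V (U : config V) (X : {vspace V}) :=
  (X <= \sum_j (X :&: U j (lenC j)))%VS.

Lemma induced_object V (U : config V) (X : {vspace V}) :
  object U -> good U X -> object (induced U X).
Proof.
move=> oU gX; have [U0 Uinc Ul sU dU] := oU; split.
- move=> j; apply/vspaceP => w; rewrite mem_induced U0 !memv0.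
  by rewrite -[0 in LHS](linear0 (vsval : subvs_of X -> V)) (inj_eq (@subvs_inj _ _ X)).
- by move=> j i /Uinc/subvP UU; apply/subvP => w; rewrite !mem_induced => /UU.
- by move=> j; apply/vspaceP => w; rewrite mem_induced Ul !memvf.
- apply/vspaceP=> w; rewrite memvf; apply/memv_sumP.
  have /memv_sumP[v vP wE] := subvP gX _ (subvsP w).
  exists (fun j => vsproj X (v j)) => [j _|].
    by have /memv_capP[vX vU] := vP j isT; rewrite mem_induced vsprojK.
  apply: subvs_inj; rewrite wE linear_sum; apply: eq_bigr => j _.
  by have /memv_capP[vX vU] := vP j isT; rewrite /= vsprojK.
apply/directv_sum_independent => us usU us0 j _; apply: subvs_inj; rewrite linear0.
apply: (@object_independent _ U (fun j => vsval (us j))) => // [k|].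
  by rewrite -mem_induced usU.
by rewrite -linear_sum us0 linear0.
Qed.

(** Embeddings for which the flags of the source are induced from the target; an injective morphism
    may have smaller flags in its source. *)
Definition strict V W (U' : config W) (U : config V)
    (f : 'Hom(W, V)) : Prop :=
  lker f = 0%VS /\ forall j i w, (i <= l j)%N -> (f w \in U j i) = (w \in U' j i).

Lemma strict_mor V W (U' : config W) (U : config V) f :
  strict U' U f -> mor U' U f.
Proof. by move=> [_ sf]; apply/preserves_mem => j i w le_i; rewrite sf. Qed.

Lemma strict_comp V1 V2 V3 (U1 : config V1) (U2 : config V2)
    (U3 : config V3) (f : 'Hom(V2, V3)) (g : 'Hom(V1, V2)) :
  strict U2 U3 f -> strict U1 U2 g -> strict U1 U3 (f \o g)%VF.
Proof.
move=> [/eqP/lker0P f0 fU] [/eqP/lker0P g0 gU]; split=> [|j i w le_i].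
  by apply/eqP/lker0P => x y; rewrite !comp_lfunE => /f0/g0.
by rewrite comp_lfunE fU // gU.
Qed.

Lemma strict_vsval V (U : config V) (X : {vspace V}) :
  strict (induced U X) U (linfun vsval).
Proof.
split=> [|j i w _]; last by rewrite mem_induced lfunE.
by apply/eqP/lker0P => x y; rewrite !lfunE /= => /subvs_inj.
Qed.

End Objects.

Arguments dimq {K} l {V} U.

(** * Dimension vectors *)

Section Quads.
Variable l : 'I_4 -> nat.
Hypothesis l_gt0 : forall j, (0 < l j)%N.
Implicit Types lam mu nu : quad l.

(** Plain numeric indices avoid the dependent type ['I_(l j)]; out of range the value is 0. *)
Definition ent lam j i := nth 0%N (part lam j) i.

Lemma size_part lam j : size (part lam j) = l j.
Proof. by rewrite size_map size_enum_ord. Qed.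

Lemma ent_tag lam j (i : 'I_(l j)) : ent lam j i = lam (Tagged (fun j => 'I_(l j)) i).
Proof. by rewrite /ent (nth_map i) ?size_enum_ord // nth_ord_enum. Qed.

Lemma entE lam (x : {j : 'I_4 & 'I_(l j)}) : lam x = ent lam (tag x) (tagged x).
Proof. by case: x => j i; rewrite ent_tag. Qed.

Lemma eq_quad mu nu : (forall j i, (i < l j)%N -> ent mu j i = ent nu j i) -> mu = nu.
Proof. by move=> eq_ent; apply/ffunP => x; rewrite !entE eq_ent. Qed.

Lemma quad0E (x : {j : 'I_4 & 'I_(l j)}) : (0 : quad l) x = 0%N.
Proof. by rewrite ffunE. Qed.

Lemma quadDE mu nu (x : {j : 'I_4 & 'I_(l j)}) : (mu + nu) x = (mu x + nu x)%N.
Proof. by rewrite ffunE. Qed.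

Lemma entD mu nu j i : ent (mu + nu) j i = (ent mu j i + ent nu j i)%N.
Proof.
have [lt_il|le_li] := ltnP i (l j); last by rewrite /ent !nth_default ?size_part.
by rewrite !(ent_tag _ (Ordinal lt_il)) quadDE.
Qed.

Lemma ent0 j i : ent 0 j i = 0%N.
Proof.
have [lt_il|le_li] := ltnP i (l j); last by rewrite /ent !nth_default ?size_part.
by rewrite !(ent_tag _ (Ordinal lt_il)) quad0E.
Qed.

Lemma sumn_take (s : seq nat) k : (k <= size s)%N ->
  sumn (take k s) = (\sum_(i < k) nth 0 s i)%N.
Proof.
move=> le_ks; rewrite sumnE (big_nth 0%N) size_takel // big_mkord.
by apply: eq_bigr => i _; rewrite nth_take.
Qed.

Lemma sumn_part lam j : sumn (part lam j) = (\sum_(i < l j) ent lam j i)%N.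
Proof. by rewrite -[part lam j]take_size sumn_take // size_part. Qed.

Lemma sumn_chop lam j : sumn (chop (part lam j)) = (\sum_(i < (l j).-1) ent lam j i)%N.
Proof. by rewrite /chop sumn_take ?leq_pred // size_part. Qed.

(** Lambda together with 0, with |lam| = n made explicit. In this form the defining equations pass
    to sums and to differences. *)
Definition balanced lam n : Prop :=
  (forall j, \sum_(i < l j) ent lam j i = n)%N /\
  (\sum_j \sum_(i < lenC l j) ent lam j i = n)%N.

Lemma sum_lenC (F : 'I_4 -> nat -> nat) :
  (\sum_j \sum_(i < lenC l j) F j i)%N =
    (\sum_(i < (l armA).-1) F armA i + \sum_(i < (l armB).-1) F armB i
       + \sum_(i < (l armC).-1) F armC i)%N.
Proof. by rewrite big_I4 /lenC /= big_ord0 addn0. Qed.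

Lemma in_LambdaE lam : in_Lambda lam <-> lam != 0 /\ balanced lam (total lam).
Proof.
split=> [[lam0 sums chops]|[lam0 [sums chops]]].
  split=> //; split=> [j|]; first by rewrite -sumn_part sums.
  by rewrite sum_lenC -!sumn_chop.
by split=> // [j|]; [rewrite sumn_part sums | rewrite !sumn_chop -sum_lenC].
Qed.

Lemma balanced_total lam n : balanced lam n -> total lam = n.
Proof. by move=> [sums _]; rewrite /total sumn_part. Qed.

Lemma balanced0 : balanced 0 0.
Proof.
by split=> [j|]; do ?[rewrite big1 // => ? _]; apply: ent0.
Qed.

Lemma balancedD mu nu m n :
  balanced mu m -> balanced nu n -> balanced (mu + nu) (m + n)%N.
Proof.
move=> [muP muC] [nuP nuC]; split=> [j|]; rewrite -?(muP j) -?(nuP j) -?muC -?nuC -big_split /=.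
  by apply: eq_bigr => i _; rewrite entD.
by apply: eq_bigr => j _; rewrite -big_split; apply: eq_bigr => i _; rewrite entD.
Qed.

Lemma balancedB mu nu m n :
  balanced mu m -> balanced (mu + nu) n -> balanced nu (n - m)%N.
Proof.
move=> [muP muC] [nuP nuC]; split=> [j|]; rewrite -?(muP j) -?(nuP j) -?muC -?nuC.
  by under [in RHS]eq_bigr => i _ do rewrite entD; rewrite big_split addKn.
under [in RHS]eq_bigr => j _ do [under eq_bigr => i _ do rewrite entD; rewrite big_split /=].
by rewrite big_split addKn.
Qed.

Lemma balanced_eq0 lam : balanced lam 0 -> lam = 0.
Proof.
move=> [sums _]; apply: eq_quad => j i lt_il; rewrite ent0; apply/eqP.
have /eqP := sums j; rewrite sum_nat_eq0 => /forallP/(_ (Ordinal lt_il)).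
by [].
Qed.

Lemma balanced_Lambda lam n : balanced lam n -> (0 < n)%N -> in_Lambda lam.
Proof.
move=> bal n_gt0; apply/in_LambdaE; rewrite (balanced_total bal); split=> //.
apply: contraTneq n_gt0 => lam0; rewrite lam0 in bal.
by rewrite -(balanced_total bal) (balanced_total balanced0).
Qed.

Lemma balanced_or0 lam n : balanced lam n -> in_Lambda lam \/ lam = 0.
Proof.
case: n => [|n] bal; first by right; apply: balanced_eq0.
by left; apply: balanced_Lambda bal _.
Qed.

Lemma Lambda_balanced lam : in_Lambda lam -> balanced lam (total lam).
Proof. by case/in_LambdaE. Qed.

Lemma Lambda_total_gt0 lam : in_Lambda lam -> (0 < total lam)%N.
Proof.
move=> /in_LambdaE[lam0 bal]; rewrite lt0n; apply: contra lam0 => /eqP tot0.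
by rewrite tot0 in bal; rewrite (balanced_eq0 bal).
Qed.

Lemma summand_refl lam : summand lam lam.
Proof. by exists 0; split; [right | rewrite addr0]. Qed.

Lemma summand_trans lam mu nu : summand lam mu -> summand mu nu -> summand lam nu.
Proof.
move=> [p [pL ->]] [q [qL ->]]; exists (p + q); split; last by rewrite addrA.
have bal r : in_Lambda r \/ r = 0 -> balanced r (total r).
  by case=> [/Lambda_balanced //|->]; rewrite (balanced_total balanced0); apply: balanced0.
exact: (balanced_or0 (balancedD (bal _ pL) (bal _ qL))).
Qed.

Lemma finiteness_summand mu lam :
  summand mu lam -> finiteness_condition lam -> finiteness_condition mu.
Proof. by move=> sml fin nu nuL snm; apply: fin => //; apply: summand_trans sml. Qed.

End Quads.

(** * Dimension vectors and Tits form of a configuration *)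

Section DimensionVectors.
Variables (K : fieldType) (l : 'I_4 -> nat).
Hypothesis l_gt0 : forall j, (0 < l j)%N.
Implicit Types V W : vectType K.

Lemma ent_dimq V (U : config V) j i : (i < l j)%N ->
  ent (dimq l U) j i = (\dim (U j i.+1) - \dim (U j i))%N.
Proof. by move=> lt_il; rewrite (ent_tag _ (Ordinal lt_il)) ffunE. Qed.

Lemma sum_ent_dimq V (U : config V) j i : object l U -> (i <= l j)%N ->
  (\sum_(k < i) ent (dimq l U) j k)%N = \dim (U j i).
Proof.
move=> [U0 Uinc _ _ _]; elim: i => [|i IHi] le_il; first by rewrite big_ord0 U0 dimv0.
rewrite big_ord_recr /= (IHi (ltnW le_il)) ent_dimq // subnKC //.
by apply: dimvS; apply: Uinc.
Qed.

Lemma dimq_balanced V (U : config V) :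
  object l U -> balanced (dimq l U) (\dim {: V}).
Proof.
move=> oU; have [_ _ Ul sU dU] := oU; split=> [j|]; first by rewrite sum_ent_dimq // Ul.
rewrite -sU (directvP dU) /=; apply: eq_bigr => j _.
by rewrite sum_ent_dimq ?lenC_le.
Qed.

Lemma total_dimq V (U : config V) :
  object l U -> total (dimq l U) = \dim {: V}.
Proof. by move/dimq_balanced/balanced_total. Qed.

Lemma eq_dimq V W (U : config V) (U' : config W) j i :
  object l U -> object l U' -> dimq l U = dimq l U' -> (i <= l j)%N ->
  \dim (U j i) = \dim (U' j i).
Proof. by move=> oU oU' eqUU' le_il; rewrite -!sum_ent_dimq // eqUU'. Qed.

Lemma object_Lambda V (U : config V) :
  object l U -> (0 < \dim {: V})%N -> in_Lambda (dimq l U).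
Proof. by move=> /dimq_balanced/balanced_Lambda; apply. Qed.

(** If wa, wb, wc are the dimensions of V1, V2, V3, the last entries on arms A, B, C are wb + wc, wa
    + wc, wa + wb, and the sum of their squares is wa^2 + wb^2 + wc^2 + (wa + wb + wc)^2. These four
    squares are the full-square terms of [dim_preserves] for the flags in V1, V2, V3 and V. *)
Lemma sum_squares_dimq V (U : config V) : object l U ->
  (\sum_x (dimq l U x) ^ 2 = 2 * (\dim (preserver (lenC l) U U) + \dim (preserver (lenD l) U U)))%N.
Proof.
move=> oU; have [U0 _ Ul sU dU] := oU.
have dimS m : multichain m U -> (2 * \dim (preserver m U U) = \sum_j (\dim (U j (m j)) ^ 2
        + \sum_(i < m j) (\dim (U j i.+1) - \dim (U j i)) ^ 2))%N.
  move=> /dim_preserves[S SP <-]; congr (2 * \dim _)%N; apply/vspaceP => f.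
  by apply/preserverP/idP => /SP.
rewrite mulnDr (dimS _ (multichainC oU)) (dimS _ (multichainD oU)) !big_I4 /lenC /lenD /=.
rewrite !U0 dimv0 !big_ord0 Ul.
have -> : (\sum_x dimq l U x ^ 2 =
    \sum_j \sum_(i < l j) (\dim (U j i.+1) - \dim (U j i)) ^ 2)%N.
  by rewrite sig_big_dep /=; apply: eq_bigr => x _; rewrite ffunE.
have sumU : (\dim (U armA (l armA).-1) + \dim (U armB (l armB).-1)
    + \dim (U armC (l armC).-1) = \dim {: V})%N.
  by rewrite -sU (directvP dU) /= big_I4 /lenC /= U0 dimv0 addn0.
have last j : (\sum_(i < l j) (\dim (U j i.+1) - \dim (U j i)) ^ 2 =
    \sum_(i < (l j).-1) (\dim (U j i.+1) - \dim (U j i)) ^ 2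
      + (\dim {: V} - \dim (U j (l j).-1)) ^ 2)%N.
  by rewrite -[in LHS](prednK (l_gt0 j)) big_ord_recr /= prednK // Ul.
rewrite big_I4 (last armA) (last armB) (last armC) -sumU.
move: (\sum_(i < _) _)%N (\sum_(i < _) _)%N (\sum_(i < _) _)%N (\sum_(i < _) _)%N => sa sb sc sd.
move: (\dim (U armA _)) (\dim (U armB _)) (\dim (U armC _)) => wa wb wc.
rewrite -[(wa + wb + wc - wa)%N](_ : wb + wc = _)%N; last by lia.
rewrite -[(wa + wb + wc - wb)%N](_ : wa + wc = _)%N; last by lia.
rewrite -[(wa + wb + wc - wc)%N](_ : wa + wb = _)%N; last by lia.
rewrite /= -!mulnn; move: wa wb wc => /= wa wb wc; nia.
Qed.

Lemma tits_dimq V (U : config V) : object l U ->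
  tits (dimq l U) = (\dim (preserver (lenC l) U U))%:R + (\dim (preserver (lenD l) U U))%:R
    - ((\dim {: V}) ^ 2)%:R.
Proof.
move=> oU; rewrite /tits total_dimq //.
under eq_bigr => x _ do rewrite -natrX.
rewrite -natr_sum sum_squares_dimq // natrM natrD natrX; field; rewrite ?pnatr_eq0 //.
Qed.

(** With X the image of [f], the quotient of X :&: U_(i+1) by X :&: U_i embeds into U_(i+1) / U_i,
    so subtracting entrywise stays in the natural numbers; the difference of balanced vectors is
    balanced. *)
Lemma summand_strict V W (U : config V) (U' : config W) f :
  object l U -> object l U' -> strict l U' U f -> summand (dimq l U') (dimq l U).
Proof.
move=> oU oU' [f0 sf].
have le_ent j i : (i < l j)%N -> (ent (dimq l U') j i <= ent (dimq l U) j i)%N.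
  move=> lt_il; rewrite !ent_dimq //.
  have dimf k : (k <= l j)%N -> \dim (U' j k) = \dim (limg f :&: U j k).
    move=> le_kl; rewrite -(limg_dim_eq (f := f)) ?f0 ?capv0 //.
    congr (\dim _); apply/vspaceP => v; apply/memv_imgP/memv_capP.
      by move=> [w wU' ->]; rewrite sf // memv_img ?memvf.
    by move=> [/memv_imgP[w _ ->]]; rewrite sf // => wU'; exists w.
  rewrite !dimf //; last exact: ltnW.
  have [_ Uinc _ _ _] := oU; have UU := Uinc j i lt_il.
  have := dimv_sum_cap (limg f :&: U j i.+1) (U j i).
  rewrite -capvA (capv_idPr UU).
  have : (\dim (limg f :&: U j i.+1 + U j i) <= \dim (U j i.+1))%N.
    by rewrite dimvS // subv_add capvSr.
  by lia.
pose nu : quad l := [ffun x => (dimq l U x - dimq l U' x)%N].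
have lamE : dimq l U = dimq l U' + nu.
  apply/ffunP => x; rewrite quadDE [X in (_ + X)%N]ffunE subnKC //.
  by rewrite (entE (dimq l U')) (entE (dimq l U)) le_ent.
exists nu; split=> //; apply: (@balanced_or0 _ _ (\dim {: V} - \dim {: W})).
by apply: balancedB (dimq_balanced oU') _; rewrite -lamE; apply: dimq_balanced.
Qed.

End DimensionVectors.

Lemma ex_least (P : nat -> Prop) : (exists n, P n) ->
  exists2 n, P n & forall k, P k -> (n <= k)%N.
Proof.
move=> [n Pn]; apply: NNPP => noleast.
suffices notP k : forall i, (i <= k)%N -> ~ P i by exact: (notP n n).
elim: k => [|k IHk] i le_ik Pi; apply: noleast; exists i => // j Pj.
  by move: le_ik; rewrite leqn0 => /eqP->.
by rewrite leqNgt; apply/negP => lt_ji; apply: (IHk j _ Pj); rewrite -ltnS (leq_trans lt_ji).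
Qed.

(** * Morphisms, idempotents, bricks and rigidity *)

Section Morphisms.
Variables (K : fieldType) (l : 'I_4 -> nat).
Hypothesis l_gt0 : forall j, (0 < l j)%N.
Implicit Types V W : vectType K.

Lemma v2r_lfun V W (f : 'Hom(V, W)) v :
  VectorInternalTheory.v2r (f v) =
    VectorInternalTheory.v2r v *m VectorInternalTheory.f2mx f.
Proof. by rewrite unlock /= VectorInternalTheory.r2vK. Qed.

Lemma id_lfun_neq0 V : (0 < \dim {: V})%N -> \1%VF != 0 :> 'End(V).
Proof.
move=> V_gt0; apply/eqP => id0; move: V_gt0.
suff -> : fullv = 0%VS :> {vspace V} by rewrite dimv0.
by apply/eqP; rewrite -subv0; apply/subvP => v _; rewrite memv0 -[v]id_lfunE id0 zero_lfunE.
Qed.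

Lemma mor_mem V W (U : config V) (U' : config W) f j i v :
  mor l U U' f -> (i <= l j)%N -> v \in U j i -> f v \in U' j i.
Proof. by move=> /preserves_mem fU; apply: fU. Qed.

Lemma mor_id V (U : config V) : mor l U U \1%VF.
Proof. exact: preserves_id. Qed.

Lemma mor_comp V1 V2 V3 (U1 : config V1) (U2 : config V2)
    (U3 : config V3) (f : 'Hom(V2, V3)) (g : 'Hom(V1, V2)) :
  mor l U2 U3 f -> mor l U1 U2 g -> mor l U1 U3 (f \o g)%VF.
Proof. exact: preserves_comp. Qed.

Lemma mor_lin V W (U : config V) (U' : config W) c f g :
  mor l U U' f -> mor l U U' g -> mor l U U' (c *: f + g).
Proof.
by move=> /preserverP fU /preserverP gU; apply/preserverP; rewrite memvD ?memvZ.
Qed.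

Lemma mor_sub V W (U : config V) (U' : config W) f g :
  mor l U U' f -> mor l U U' g -> mor l U U' (f - g).
Proof. by move=> /preserverP fU /preserverP gU; apply/preserverP; rewrite memvB. Qed.

Lemma mor_scale V W (U : config V) (U' : config W) c f :
  mor l U U' f -> mor l U U' (c *: f).
Proof. by move=> /preserverP fU; apply/preserverP; rewrite memvZ. Qed.

Lemma mor_sum V W (U : config V) (U' : config W)
    (I : Type) (r : seq I) (P : pred I) (F : I -> 'Hom(V, W)) :
  (forall i, P i -> mor l U U' (F i)) -> mor l U U' (\sum_(i <- r | P i) F i).
Proof.
by move=> FU; apply/preserverP; rewrite memv_suml // => i /FU/preserverP.
Qed.

Lemma good_ker V W (U : config V) (U' : config W) f :
  object l U -> object l U' -> mor l U U' f -> good l U (lker f).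
Proof.
move=> oU oU' fU; apply/subvP => v; rewrite memv_ker => /eqP fv0.
have [w vE wU] := object_decomp v oU; rewrite vE; apply: memv_sumr => j _.
rewrite memv_cap wU andbT memv_ker; apply/eqP.
apply: (@object_independent _ l _ U' (fun j => f (w j))) => // [k|].
  by apply: mor_mem fU _ (wU k); apply: lenC_le.
by rewrite -linear_sum -vE.
Qed.

Lemma good_idem V (U : config V) e :
  object l U -> mor l U U e -> good l U (limg e).
Proof.
move=> oU eU; apply/subvP => _ /memv_imgP[v _ ->].
have [w vE wU] := object_decomp v oU; rewrite vE linear_sum; apply: memv_sumr => j _.
by rewrite memv_cap memv_img ?memvf // (mor_mem eU) ?lenC_le.
Qed.

Definition corestr V (e : 'End(V)) : 'Hom(V, subvs_of (limg e)) :=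
  (linfun (vsproj (limg e)) \o e)%VF.

Lemma vsval_corestr V (e : 'End(V)) v : vsval (corestr e v) = e v.
Proof. by rewrite comp_lfunE lfunE /= vsprojK // memv_img ?memvf. Qed.

Lemma corestr_mor V (U : config V) e :
  mor l U U e -> mor l U (induced U (limg e)) (corestr e).
Proof.
move=> eU; apply/preserves_mem => j i v le_il vU.
by rewrite mem_induced vsval_corestr (mor_mem eU).
Qed.

Lemma idem_img V (e : 'End(V)) v : (e \o e)%VF = e -> v \in limg e -> e v = v.
Proof. by move=> ee /memv_imgP[w _ ->]; rewrite -comp_lfunE ee. Qed.

Lemma corestrK V (e : 'End(V)) (w : subvs_of (limg e)) :
  (e \o e)%VF = e -> corestr e (vsval w) = w.
Proof. by move=> ee; apply: subvs_inj; rewrite vsval_corestr idem_img ?subvsP. Qed.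

Lemma idem_compl V (e : 'End(V)) : (e \o e = e)%VF ->
  ((\1 - e) \o (\1 - e) = \1 - e)%VF.
Proof.
move=> ee; apply/lfunP=> v.
rewrite comp_lfunE !add_lfunE !opp_lfunE !id_lfunE linearB /=.
by rewrite -(comp_lfunE e e) ee subrr subr0.
Qed.

Lemma split_idem V (U : config V) e :
  object l U -> mor l U U e -> (e \o e)%VF = e ->
  exists (i : 'Hom(subvs_of (limg e), V)) (c : 'Hom(V, subvs_of (limg e))),
    [/\ strict l (induced U (limg e)) U i, mor l U (induced U (limg e)) c,
        (c \o i)%VF = \1%VF & (i \o c)%VF = e].
Proof.
move=> oU eU ee; exists (linfun vsval), (corestr e); split.
- exact: strict_vsval.
- exact: corestr_mor.
- apply/lfunP=> w; rewrite (comp_lfunE (corestr e)) id_lfunE -[RHS](corestrK w ee).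
  by congr (corestr e _); rewrite lfunE.
by apply/lfunP=> v; rewrite (comp_lfunE _ (corestr e)) lfunE /= vsval_corestr.
Qed.

Definition indec V (U : config V) : Prop :=
  (0 < \dim {: V})%N /\
  forall e : 'End(V), mor l U U e -> (e \o e)%VF = e -> e = 0 \/ e = \1%VF.

Definition brick V (U : config V) : Prop :=
  forall f : 'End(V), mor l U U f -> exists c, f = c *: \1%VF.

(* Ext^1(U, U) is the quotient of End(V) by the sum of the two preservers. *)
Definition rigid V (U : config V) : Prop :=
  (preserver (lenC l) U U + preserver (lenD l) U U)%VS = fullv.

Lemma mor_preserver V W (U : config V) (U' : config W) :
  object l U -> object l U' ->
  preserver l U U' = (preserver (lenC l) U U' :&: preserver (lenD l) U U')%VS.
Proof.
move=> oU oU'; apply/vspaceP => f; rewrite memv_cap.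
apply/preserverP/andP => [/(morE l_gt0 _ oU oU')[/preserverP fC /preserverP fD] //|].
by move=> [/preserverP fC /preserverP fD]; apply/(morE l_gt0 _ oU oU').
Qed.

Lemma brick_rigid V (U : config V) :
  object l U -> (0 < \dim {: V})%N -> brick U -> 1 <= tits (dimq l U) ->
  rigid U /\ tits (dimq l U) = 1.
Proof.
move=> oU V_gt0 bU; rewrite tits_dimq //.
have dim_cap : \dim (preserver (lenC l) U U :&: preserver (lenD l) U U) = 1%N.
  rewrite -mor_preserver //.
  have -> : preserver l U U = <[\1%VF]>%VS.
    apply/vspaceP => f; apply/preserverP/vlineP => [/bU //|[c ->]].
    exact/mor_scale/mor_id.
  by rewrite dim_vline id_lfun_neq0.
have := dimv_sum_cap (preserver (lenC l) U U) (preserver (lenD l) U U).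
rewrite dim_cap => dimE.
rewrite -natrD -dimE natrD addrAC lerDr subr_ge0 ler_nat => le_dim.
have rU : rigid U.
  by apply/eqP; rewrite eqEdim subvf dim_hom mulnn.
by split=> //; rewrite rU dim_hom mulnn subrr add0r.
Qed.

Lemma ker_factor V W1 W2 (f : 'Hom(V, W1)) (g : 'Hom(V, W2)) :
  (lker f <= lker g)%VS -> (g \o f^-1 \o f)%VF = g.
Proof.
move=> /subvP kfg; apply/lfunP => v; rewrite !comp_lfunE.
apply/eqP; rewrite -subr_eq0 -linearB -memv_ker kfg // memv_ker linearB /=.
by rewrite limg_lfunVK ?subrr // memv_img ?memvf.
Qed.

(** Fitting's lemma: when the rank does not drop from f to f^2, the image and the kernel of f are
    complementary, and the projection onto the image along the kernel is an endomorphism of U.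
    Indecomposability makes this projection 0 or 1. *)
Lemma square_zero_or_split V (U : config V) (f : 'End(V)) :
  object l U -> indec U -> mor l U U f -> lker f != 0%VS ->
  (\dim (limg f) <= \dim (limg (f \o f)))%N -> f = 0.
Proof.
move=> oU [V_gt0 idU] fU kf rk_ff; pose X := limg f.
have fX : (f @: X)%VS = X.
  apply/eqP; rewrite eqEdim -limg_comp rk_ff andbT limg_comp.
  by apply: limgS; apply: subvf.
have Xk : (X :&: lker f = 0)%VS.
  apply/eqP; rewrite -dimv_eq0; have := limg_ker_dim f X.
  by rewrite fX => /eqP; rewrite -[X in _ == X]add0n eqn_add2r.
pose e := daddv_pi X (lker f).
have eX v : v \in X -> e v = v by apply: daddv_pi_id.
have ek v : v \in lker f -> e v = 0.
  move=> vk; have vXk : v \in (X + lker f)%VS by rewrite (subvP (addvSr _ _)).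
  have := daddv_pi_add Xk vXk; rewrite -/e (daddv_pi_id _ vk) ?(capvC (lker f)) //.
  by move/(canRL (addrK _)); rewrite subrr.
have eU : mor l U U e.
  apply/preserves_mem => j i v le_il vU.
  pose A := (f @: U j i)%VS.
  have AU : (A <= U j i)%VS by apply: fU.
  have AX : (A <= X)%VS by apply/limgS/subvf.
  (* f is injective on A, which lies in X, so it permutes A. Hence f v = f w for some w in A, v - w
     is in the kernel, and e v = w stays in [U j i]. *)
  have fA : (f @: A)%VS = A.
    apply/eqP; rewrite eqEdim; apply/andP; split; first exact/limgS.
    rewrite limg_dim_eq //; apply/eqP; rewrite -subv0 -Xk.
    by apply: capvS.
  have /memv_imgP[w wA fvw] : f v \in (f @: A)%VS by rewrite fA memv_img.
  have -> : v = w + (v - w) by rewrite addrC subrK.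
  rewrite linearD /= (ek (v - w)) ?addr0; last by rewrite memv_ker linearB /= fvw subrr.
  by rewrite eX ?(subvP AX) // (subvP AU).
have ee : (e \o e)%VF = e.
  by apply/lfunP => v; rewrite comp_lfunE eX // memv_pi.
have [e0|e1] := idU e eU ee.
  apply/lfunP=> v; rewrite zero_lfunE -(eX (f v)) ?e0 ?zero_lfunE //.
  by rewrite memv_img ?memvf.
case/eqP: kf; apply/eqP; rewrite -subv0; apply/subvP => v /ek.
by rewrite e1 id_lfunE memv0 => ->.
Qed.

(** Take an idempotent e of least rank among those not annihilating f. If its image split, f would
    still have a nonzero component in one of the two parts, of smaller rank. *)
Lemma exists_indec_factor V W (U : config V) (f : 'Hom(W, V)) :
  object l U -> f != 0 ->
  exists e : 'End(V), [/\ mor l U U e, (e \o e)%VF = e, (e \o f)%VF != 0 &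
                          indec (induced U (limg e))].
Proof.
move=> oU f0.
pose P r := exists e : 'End(V), [/\ mor l U U e, (e \o e)%VF = e, (e \o f)%VF != 0 &
   \dim (limg e) = r].
have [|r [e [eU ee ef0 rk_e]] rmin] := @ex_least P.
  exists (\dim {: V}), \1%VF; rewrite !comp_lfun1l lim1g; split=> //.
  exact: mor_id.
exists e; split=> //; split=> [|g gU gg].
  rewrite dim_subvs lt0n dimv_eq0; apply: contra ef0 => /eqP limg0.
  apply/eqP/lfunP => v; apply/eqP; rewrite comp_lfunE zero_lfunE -memv0 -limg0.
  by rewrite memv_img ?memvf.
have [i [c [si cU ciK icE]]] := split_idem oU eU ee.
have cK w : c (i w) = w by rewrite -comp_lfunE ciK id_lfunE.
have iU := strict_mor si.
have lift (h : 'End(subvs_of (limg e))) : mor l (induced U (limg e)) (induced U (limg e)) h ->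
    (h \o h)%VF = h -> (h \o c \o f)%VF != 0 -> h = \1%VF.
  move=> hU hh hf0; have rk_h : (r <= \dim (limg h))%N.
    apply: leq_trans (rmin (\dim (limg (i \o h \o c)%VF)) _) _.
      exists (i \o h \o c)%VF; split=> //.
      - by apply: mor_comp cU; apply: mor_comp hU.
      - by apply/lfunP => v; rewrite !comp_lfunE cK -(comp_lfunE h h) hh.
      apply: contra hf0 => /eqP/lfunP ihc0; apply/eqP/lfunP => v.
      have := ihc0 v; rewrite !comp_lfunE !zero_lfunE => /(congr1 c).
      by rewrite cK linear0.
    rewrite -comp_lfunA limg_comp -(limg_dim_eq (f := i) (U := limg h)).
      by rewrite dimvS ?limgS // limg_comp limgS ?subvf.
    by rewrite si.1 capv0.
  have fh : limg h = fullv by apply/eqP; rewrite eqEdim subvf dim_subvs rk_e.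
  by apply/lfunP => v; rewrite id_lfunE idem_img ?fh ?memvf.
(* One of g and 1 - g does not annihilate the component of f in the image of e; by minimality that
   one is the identity. *)
have [g0|gf] := eqVneq (g \o c \o f)%VF 0; last by right; apply: lift.
left; have : (\1 - g)%VF = \1%VF.
  apply: lift; [by apply: mor_sub => //; apply: mor_id | exact: idem_compl |].
  apply: contra ef0 => /eqP/lfunP g1; apply/eqP/lfunP => v; have := g1 v.
  have /lfunP/(_ v) := g0; rewrite !comp_lfunE add_lfunE opp_lfunE id_lfunE => ->.
  by rewrite !zero_lfunE subr0 => cfv0; rewrite -icE comp_lfunE cfv0 linear0.
by move=> g1; rewrite -[g](subKr \1%VF) g1 subrr.
Qed.

End Morphisms.

(** * Indecomposable configurations *)

Section Ringel.
Import VectorInternalTheory.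
Variables (K : closedFieldType) (l : 'I_4 -> nat).
Hypothesis l_gt0 : forall j, (0 < l j)%N.
Implicit Types V W : vectType K.

Lemma exists_eigenvector V (f : 'End(V)) : (0 < \dim {: V})%N ->
  exists c, lker (f - c *: \1%VF) != 0%VS.
Proof.
rewrite dimvf => V_gt0.
have /closed_rootP[c] : size (char_poly (f2mx f)) != 1%N.
  by rewrite size_char_poly eqSS -lt0n.
rewrite -eigenvalue_root_char => /eigenvalueP[v vf v0]; exists c.
apply: contra v0 => /eqP k0; rewrite -[v]r2vK.
suff -> : r2v v = 0 by rewrite linear0.
apply/eqP; rewrite -memv0 -k0 memv_ker add_lfunE opp_lfunE scale_lfunE id_lfunE subr_eq0.
apply/eqP/v2r_inj.
by rewrite v2r_lfun linearZ /= r2vK.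
Qed.

(* Ringel's argument: an endomorphism of minimal rank of an indecomposable configuration
   which is not a brick has square zero, and an indecomposable summand N of its kernel
   which it reaches satisfies Ext(N, N) <> 0, for otherwise N would split off. *)
Lemma indec_brick_bounded n V (U : config V) :
  (\dim {: V} <= n)%N -> object l U -> indec l U -> finiteness_condition (dimq l U) ->
  [/\ brick l U, rigid l U & tits (dimq l U) = 1].
Proof.
elim: n V U => [|n IHn] V U le_Vn oU iU finU; have [V_gt0 idU] := iU.
  by rewrite leqNgt V_gt0 in le_Vn.
suff bU : brick l U.
  have tits_ge1 := finU _ (object_Lambda oU V_gt0) (summand_refl _).
  by have [] := brick_rigid l_gt0 oU V_gt0 bU tits_ge1.
move=> f0 f0U; apply: NNPP => nscal.
pose P r := exists f : 'End(V), [/\ mor l U U f, f != 0, lker f != 0%VS & \dim (limg f) = r].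
(* A candidate exists: a non-scalar endomorphism minus one of its eigenvalues is nonzero and not
   injective. *)
have [|r [f [fU f_neq0 kf rk_f]] rmin] := @ex_least P.
  have [c kc] := exists_eigenvector f0 V_gt0.
  exists (\dim (limg (f0 - c *: \1%VF))), (f0 - c *: \1%VF); split=> //.
    by apply: mor_sub => //; apply/mor_scale/mor_id.
  by apply/eqP => /subr0_eq f0c; apply: nscal; exists c.
(* Otherwise f^2 would be another candidate, of rank at least r, and [square_zero_or_split] would
   give f = 0. *)
have ff0 : (f \o f)%VF = 0.
  apply/eqP; apply: contraTT (f_neq0) => ff_neq0; rewrite negbK.
  apply/eqP; apply: (square_zero_or_split oU iU fU kf).
  rewrite rk_f; apply: rmin; exists (f \o f)%VF; split=> //.
    exact: (mor_comp fU fU).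
  apply: contra kf => /eqP kff; rewrite -subv0 -kff.
  by apply/subvP => v; rewrite !memv_ker comp_lfunE => /eqP->; rewrite linear0.
pose X := lker f; pose UX := induced U X.
have gX : good l U X by apply: good_ker fU.
have oX : object l UX by apply: induced_object.
have [i1 i1E] : exists i1 : 'Hom(subvs_of X, V), i1 =1 vsval.
  by exists (linfun vsval) => w; rewrite lfunE.
have [p1 p1E] : exists p1 : 'Hom(V, subvs_of X), p1 =1 vsproj X.
  by exists (linfun (vsproj X)) => v; rewrite lfunE.
have si1 : strict l UX U i1.
  have [s0 sU] := strict_vsval l U X.
  have -> // : i1 = linfun vsval by apply/lfunP => w; rewrite i1E lfunE.
have fX v : f v \in X by rewrite memv_ker -comp_lfunE ff0 zero_lfunE.
have i1p1 v : v \in X -> i1 (p1 v) = v by move=> vX; rewrite i1E p1E vsprojK.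
have p1f_neq0 : (p1 \o f)%VF != 0.
  apply: contra f_neq0 => /eqP/lfunP pf0; apply/eqP/lfunP => v.
  by rewrite zero_lfunE -(i1p1 _ (fX v)) -comp_lfunE pf0 zero_lfunE linear0.
have [e [eU ee ef_neq0 iN]] := exists_indec_factor oX p1f_neq0.
have [N [UN [i2 [p2 [[iN0 oN] [si2 p2U p2i2 i2p2]]]]]] :
    exists (N : vectType K) (UN : config N) (i2 : 'Hom(N, subvs_of X))
           (p2 : 'Hom(subvs_of X, N)), (indec l UN /\ object l UN) /\
      [/\ strict l UN UX i2, mor l UX UN p2, (p2 \o i2)%VF = \1%VF & (i2 \o p2)%VF = e].
  have [i2 [p2 sip]] := split_idem oX eU ee; exists _, (induced UX (limg e)), i2, p2; split=> //.
  by split=> //; apply: induced_object (good_idem oX eU).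
have si : strict l UN U (i1 \o i2)%VF by apply: strict_comp si1 si2.
have dimNX : (\dim {: N} <= \dim X)%N.
  rewrite -(dim_subvs X); have := limg_ker_dim i2 fullv.
  by rewrite si2.1 capv0 dimv0 add0n => <-; apply/dimvS/subvf.
have dimXV : (\dim X < \dim {: V})%N.
  rewrite ltn_neqAle dimvS ?subvf // andbT; apply: contra f_neq0 => dimX.
  have /eqP Xf : X == fullv by rewrite eqEdim subvf (eqP dimX) leqnn.
  apply/eqP/lfunP => v; rewrite zero_lfunE; apply/eqP.
  by rewrite -memv_ker -/X Xf memvf.
have [_ rN _] : [/\ brick l UN, rigid l UN & tits (dimq l UN) = 1].
  apply: IHn => //.
    by rewrite -ltnS; apply: leq_trans le_Vn; apply: leq_ltn_trans dimXV.
  by apply: finiteness_summand finU; apply: summand_strict si.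
(* q0 extends the retraction of X onto N linearly to V. It is compatible with the flags on X only;
   since f takes values in X, the composite a = q0 f is nevertheless a morphism. *)
have [q0 q0v] : exists q0 : 'Hom(V, N), forall v, q0 v = p2 (p1 v).
  by exists (p2 \o p1)%VF => v; rewrite comp_lfunE.
have q0E v j i : (i <= l j)%N -> v \in X -> v \in U j i -> q0 v \in UN j i.
  move=> le_il vX vU; rewrite q0v; apply: (mor_mem p2U) => //.
  by rewrite mem_induced -i1E i1p1.
have [a av] : exists a : 'Hom(V, N), forall v, a v = q0 (f v).
  by exists (q0 \o f)%VF => v; rewrite comp_lfunE.
have aU : mor l U UN a.
  apply/preserves_mem => j i v le_il vU; rewrite av q0E //.
  exact: (mor_mem fU).
(* Followed by the inclusion of N, a becomes a nonzero non-injective endomorphism, of rank at least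
   r. Its kernel contains X, which has codimension r, and so equals X. *)
have aker : (lker a <= X)%VS.
  have ka : (lker a <= lker (i1 \o i2 \o a))%VS.
    by apply/subvP => v; rewrite !memv_ker comp_lfunE => /eqP->; rewrite linear0.
  have kf' : (X <= lker (i1 \o i2 \o a))%VS.
    by apply/subvP => v; rewrite !memv_ker !comp_lfunE av => /eqP->; rewrite !linear0.
  suff /eqP -> : X == lker (i1 \o i2 \o a) by [].
  rewrite eqEdim kf' /=.
  have := limg_ker_dim f fullv; have := limg_ker_dim (i1 \o i2 \o a)%VF fullv.
  rewrite !capfv -/X rk_f => <-; have : (r <= \dim (limg (i1 \o i2 \o a)%VF))%N.
    apply: rmin; exists (i1 \o i2 \o a)%VF; split=> //.
    - exact: mor_comp (strict_mor si) aU.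
    - apply: contra ef_neq0 => /eqP/lfunP iia0; apply/eqP/lfunP => v; have := iia0 v.
      rewrite -i2p2 !comp_lfunE !zero_lfunE av q0v => iia0v.
      by have /eqP/lker0P inj := si1.1; apply: inj; rewrite iia0v linear0.
    apply: contra kf => /eqP k0; rewrite -subv0 -k0.
    exact: kf'.
  by move: (\dim _) (\dim _) (\dim _) => /= x y z; lia.
(* The retraction X -> N is extended twice, by c preserving the flags in V1, V2, V3 and by p
   preserving the flag in V. As c - p vanishes on X, which contains the kernel of a, it factors
   through a. *)
have [c cq cU] : exists2 c : 'Hom(V, N), (forall v, v \in X -> c v = q0 v) &
    preserves (lenC l) U UN c.
  apply: preserving_extension (multichainC oU) (multichainC oN) gX _ => j i v le_i vX vU.
  by apply: q0E => //; apply: leq_trans le_i (lenC_le _ _).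
have [p pq pU] : exists2 p : 'Hom(V, N), (forall v, v \in X -> p v = q0 v) &
    preserves (lenD l) U UN p.
  apply: preserving_extension (multichainD oU) (multichainD oN) _ _ => [|j i v le_i vX vU].
    apply: (sumv_sup armD) => //; have [_ _ Ul _ _] := oU.
    by rewrite /lenD eqxx Ul capvf.
  by apply: q0E => //; apply: leq_trans le_i (lenD_le _ _).
have ga : ((c - p) \o a^-1 \o a)%VF = c - p.
  apply: ker_factor; apply/subvP => v /(subvP aker) vX.
  by rewrite memv_ker add_lfunE opp_lfunE cq // pq // subrr.
(* Rigidity of N splits the factor of c - p through a as c' + p'. Then c - c' a = p + p' a lies in
   both preservers and still agrees with q0 on X, because a vanishes on N. *)
have /memv_addP[c' /preserverP c'U [p' /preserverP p'U gE]] :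
    ((c - p) \o a^-1)%VF \in (preserver (lenC l) UN UN + preserver (lenD l) UN UN)%VS.
  by rewrite rN memvf.
have rE : c - (c' \o a)%VF = p + (p' \o a)%VF.
  apply/eqP; rewrite subr_eq -addrA [X in p + X]addrC -comp_lfunDl -gE ga.
  by rewrite addrC subrK.
have [aC aD] := (morE l_gt0 a oU oN).1 aU.
have rU : mor l U UN (c - (c' \o a)%VF).
  apply/(morE l_gt0 _ oU oN); split; last rewrite rE; apply/preserverP.
    by rewrite memvB //; apply/preserverP => //; apply: preserves_comp aC.
  by rewrite memvD //; apply/preserverP => //; apply: preserves_comp aD.
pose rr := c - (c' \o a)%VF.
have i12X w : i1 (i2 w) \in X by rewrite i1E subvsP.
have ri w : rr (i1 (i2 w)) = w.
  rewrite add_lfunE opp_lfunE cq // comp_lfunE av !q0v.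
  have /eqP -> : f (i1 (i2 w)) == 0 by rewrite -memv_ker.
  rewrite (linear0 p1) (linear0 p2) (linear0 c') subr0 -[RHS](id_lfunE w).
  rewrite -p2i2 comp_lfunE; congr (p2 _).
  by rewrite i1E p1E vsvalK.
have [N_gt0 _] := iN0.
have mE : mor l U U (i1 \o i2 \o rr)%VF.
  by apply: mor_comp; [apply: strict_mor si | apply: rU].
(* N now splits off U. If the idempotent is 0 then N = 0; if it is 1 then V lies in X, the kernel of
   f. Both are excluded. *)
have [|e0|e1] := idU (i1 \o i2 \o rr)%VF mE.
- by apply/lfunP => v; rewrite !comp_lfunE ri.
- case/eqP: (id_lfun_neq0 N_gt0); apply/lfunP => w.
  have /lfunP/(_ (i1 (i2 w))) := e0; rewrite !comp_lfunE ri zero_lfunE.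
  by move=> /(congr1 rr); rewrite ri linear0 id_lfunE zero_lfunE.
case/eqP: f_neq0; apply/lfunP => v; rewrite zero_lfunE; apply/eqP.
by rewrite -memv_ker -[v]id_lfunE -e1 !comp_lfunE.
Qed.

Lemma indec_brick V (U : config V) :
  object l U -> indec l U -> finiteness_condition (dimq l U) ->
  [/\ brick l U, rigid l U & tits (dimq l U) = 1].
Proof. exact: indec_brick_bounded (leqnn _). Qed.

End Ringel.

(** * Krull-Schmidt decompositions *)

Section Decompositions.
Variables (K : fieldType) (l : 'I_4 -> nat).
Hypothesis l_gt0 : forall j, (0 < l j)%N.
Implicit Types V W : vectType K.

(** A decomposition into indecomposables is encoded by orthogonal idempotent endomorphisms. An
    arbitrary sum [e0] in place of 1 serves the recursion on complements and the transport to a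
    larger space. *)
Record decomp V (U : config V) (e0 : 'End(V)) (es : seq 'End(V)) : Prop :=
  Decomp {
    decomp_uniq : uniq es;
    decomp_sum : \sum_(e <- es) e = e0;
    decomp_mor : forall e, e \in es -> mor l U U e;
    decomp_idem : forall e, e \in es -> (e \o e)%VF = e;
    decomp_orth : forall e f, e \in es -> f \in es -> e != f -> (e \o f)%VF = 0;
    decomp_indec : forall e, e \in es -> indec l (induced U (limg e)) }.

Definition summand_dim V (U : config V) (e : 'End(V)) : quad l :=
  dimq l (induced U (limg e)).

Lemma sub_idem_eq V (e f : 'End(V)) : (f \o f)%VF = f -> (f \o e)%VF = f ->
  (limg e <= limg f)%VS -> f = e.
Proof.
move=> ff fe /subvP ef; rewrite -fe; apply/lfunP => v.
by rewrite comp_lfunE idem_img // ef // memv_img ?memvf.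
Qed.

Lemma idem_sum_img V (e : 'End(V)) : (e \o e)%VF = e -> e != 0 -> (0 < \dim (limg e))%N.
Proof.
move=> ee; rewrite lt0n dimv_eq0; apply: contra => /eqP e0; apply/eqP/lfunP => v.
by rewrite zero_lfunE; apply/eqP; rewrite -memv0 -e0 memv_img ?memvf.
Qed.

(** An idempotent g of the image of e lifts to the idempotent i g c of U lying under e; by
    minimality it is 0 or has the rank of e, and then equals e. *)
Lemma minimal_idem_indec V (U : config V) e :
  object l U -> mor l U U e -> (e \o e)%VF = e -> e != 0 ->
  (forall f, mor l U U f -> (f \o f)%VF = f -> (e \o f)%VF = f -> (f \o e)%VF = f ->
     f != 0 -> (\dim (limg e) <= \dim (limg f))%N) ->
  indec l (induced U (limg e)).
Proof.
move=> oU eU ee e_neq0 emin; split; first by rewrite dim_subvs idem_sum_img.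
have [i [c [si cU ciK icE]]] := split_idem oU eU ee.
move=> g gU gg; have [->|g_neq0] := eqVneq g 0; first by left.
right; pose f := (i \o g \o c)%VF.
have cK w : c (i w) = w by rewrite -comp_lfunE ciK id_lfunE.
have ef : (e \o f)%VF = f.
  by apply/lfunP => v; rewrite -icE !comp_lfunE cK.
have fe : (f \o e)%VF = f.
  by apply/lfunP => v; rewrite -icE !comp_lfunE cK.
have ff : (f \o f)%VF = f.
  by apply/lfunP => v; rewrite !comp_lfunE cK -(comp_lfunE g g) gg.
have g_cfi : g = (c \o f \o i)%VF by apply/lfunP => w; rewrite !comp_lfunE !cK.
have f_neq0 : f != 0.
  by apply: contra g_neq0 => /eqP f0; rewrite g_cfi f0 comp_lfun0r comp_lfun0l.
have fU : mor l U U f.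
  by apply: mor_comp cU; apply: mor_comp gU; apply: strict_mor si.
have le_ef := emin f fU ff ef fe f_neq0.
have ffe : f = e.
  apply: sub_idem_eq => //; have fle : (limg f <= limg e)%VS.
    by rewrite -[in X in (X <= _)%VS]ef limg_comp limgS ?subvf.
  suff /eqP -> : limg f == limg e by [].
  by rewrite eqEdim fle.
have icv v : i (c v) = e v by have /lfunP/(_ v) := icE; rewrite comp_lfunE.
by rewrite g_cfi ffe; apply/lfunP => w; rewrite !comp_lfunE -icv !cK id_lfunE.
Qed.

(** Split off a nonzero idempotent f of least rank under e and recurse on e - f. The second
    conclusion, that all terms lie under the idempotent decomposed, is what makes them orthogonal to
    f. *)
Lemma exists_decomp_bounded n V (U : config V) e :
  object l U -> mor l U U e -> (e \o e)%VF = e -> (\dim (limg e) <= n)%N ->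
  exists2 es, decomp U e es & forall f, f \in es -> (e \o f)%VF = f /\ (f \o e)%VF = f.
Proof.
move=> oU; elim: n e => [|n IHn] e eU ee le_n.
  exists [::]; last by [].
  split=> //; rewrite big_nil; apply/esym/eqP; apply: contraTT le_n => /(idem_sum_img ee).
  by rewrite -ltnNge.
have [e0|e_neq0] := eqVneq e 0.
  by exists [::] => //; split=> //; rewrite big_nil.
pose P r := exists f : 'End(V), [/\ mor l U U f, (f \o f)%VF = f,
   (e \o f)%VF = f /\ (f \o e)%VF = f, f != 0 & \dim (limg f) = r].
have [|r [f [fU ff [ef fe] f_neq0 rk_f]] rmin] := @ex_least P.
  by exists (\dim (limg e)), e.
pose e' := e - f.
have e'U : mor l U U e' by apply: mor_sub.
have e'e' : (e' \o e')%VF = e'.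
  rewrite /e' comp_lfunDl !comp_lfunDr !comp_lfunNl !comp_lfunNr.
  by rewrite ee ef fe ff opprK addrA subrK.
have e'f : (e' \o f)%VF = 0 by rewrite /e' comp_lfunDl comp_lfunNl ef ff subrr.
have fe' : (f \o e')%VF = 0 by rewrite /e' comp_lfunDr comp_lfunNr fe ff subrr.
have ee' : (e \o e')%VF = e' by rewrite /e' comp_lfunDr comp_lfunNr ee ef.
have e'e : (e' \o e)%VF = e' by rewrite /e' comp_lfunDl comp_lfunNl ee fe.
have [|es [uniq_es sum_es mor_es idem_es orth_es indec_es] es_e'] := IHn e' e'U e'e'.
  rewrite -ltnS (leq_trans _ le_n) // ltn_neqAle.
  have le_e'e : (limg e' <= limg e)%VS.
    by rewrite -[in X in (X <= _)%VS]ee' limg_comp limgS ?subvf.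
  rewrite (dimvS le_e'e) andbT (dimv_leqif_eq le_e'e).
  apply: contra f_neq0 => /eqP e'lim; suff -> : f = 0 by [].
  have e'eq : e' = e by apply: sub_idem_eq; rewrite // e'lim.
  by move: fe'; rewrite e'eq fe.
have es_f g : g \in es -> (f \o g = 0)%VF /\ (g \o f = 0)%VF.
  move=> /es_e'[e'g ge']; split; first by rewrite -e'g comp_lfunA fe' comp_lfun0l.
  by rewrite -ge' -comp_lfunA e'f comp_lfun0r.
have f_notin : f \notin es.
  by apply: contra f_neq0 => /es_f[]; rewrite ff => ->.
exists (f :: es); last first.
  move=> g; rewrite inE => /predU1P[-> //|/es_e'[e'g ge']]; split.
    by rewrite -[in RHS]e'g -ee' -comp_lfunA e'g.
  by rewrite -[in RHS]ge' -e'e comp_lfunA ge'.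
split=> /=.
- by rewrite f_notin.
- by rewrite big_cons sum_es addrC subrK.
- by move=> g; rewrite inE => /predU1P[-> //|/mor_es].
- by move=> g; rewrite inE => /predU1P[-> //|/idem_es].
- move=> g h; rewrite !inE => /predU1P[->|ges] /predU1P[->|hes]; first by rewrite eqxx.
  + by have [] := es_f _ hes.
  + by have [] := es_f _ ges.
  exact: orth_es.
move=> g; rewrite inE => /predU1P[->|/indec_es //].
apply: minimal_idem_indec => // h hU hh fh hf h_neq0; rewrite rk_f; apply: rmin.
exists h; split=> //; split; first by rewrite -[in LHS]fh comp_lfunA ef.
by rewrite -[in LHS]hf -comp_lfunA fe.
Qed.

Lemma exists_decomp V (U : config V) :
  object l U -> exists es, decomp U \1%VF es.
Proof.
move=> oU; have id_idem := comp_lfun1l (\1%VF : 'End(V)).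
have [es dU _] := exists_decomp_bounded oU (mor_id (l := l) U) id_idem (leqnn _).
by exists es.
Qed.

Lemma decomp_perm V (U : config V) e0 es es' :
  perm_eq es es' -> decomp U e0 es -> decomp U e0 es'.
Proof.
move=> pes [uniq_es sum_es mor_es idem_es orth_es indec_es]; split.
- by rewrite -(perm_uniq pes).
- by rewrite -(perm_big _ pes).
- by move=> e; rewrite -(perm_mem pes); apply: mor_es.
- by move=> e; rewrite -(perm_mem pes); apply: idem_es.
- by move=> e f; rewrite -!(perm_mem pes); apply: orth_es.
by move=> e; rewrite -(perm_mem pes); apply: indec_es.
Qed.

Lemma dim_induced V (U : config V) X j i :
  \dim (induced U X j i) = \dim (X :&: U j i).
Proof.
pose i0 : 'Hom(subvs_of X, V) := linfun vsval.
have [i00 iU] := strict_vsval (fun => i.+1) U X.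
rewrite -(limg_dim_eq (f := i0)) ?i00 ?capv0 //; congr (\dim _).
apply/vspaceP => v; apply/memv_imgP/memv_capP.
  by move=> [w]; rewrite mem_induced lfunE /= => wU ->; rewrite subvsP.
by move=> [vX vU]; exists (vsproj X v); rewrite ?mem_induced ?lfunE /= vsprojK.
Qed.

Lemma idem_cap V (e : 'End(V)) (A : {vspace V}) :
  (e \o e)%VF = e -> (e @: A <= A)%VS -> (limg e :&: A)%VS = (e @: A)%VS.
Proof.
move=> ee /subvP eA; apply/vspaceP => v; apply/memv_capP/memv_imgP => [[ve vA]|[w wA ->]].
  by exists v => //; rewrite idem_img.
by rewrite memv_img ?memvf // eA // memv_img.
Qed.

Lemma ent_summand_dim V (U : config V) e j i : mor l U U e ->
  (e \o e)%VF = e -> (i < l j)%N ->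
  ent (summand_dim U e) j i = (\dim (e @: U j i.+1) - \dim (e @: U j i))%N.
Proof.
move=> eU ee lt_il; rewrite ent_dimq // !dim_induced !idem_cap //; last exact: eU.
by apply: eU; apply: ltnW.
Qed.

(** By induction on the list: e maps (e + s) A onto e A, with kernel s A. *)
Lemma dim_orth_sum V (es : seq 'End(V)) (A : {vspace V}) :
  (forall e, e \in es -> (e @: A <= A)%VS) -> uniq es -> (forall e, e \in es -> (e \o e)%VF = e) ->
  (forall e f, e \in es -> f \in es -> e != f -> (e \o f)%VF = 0) ->
  (\dim ((\sum_(e <- es) e) @: A) = \sum_(e <- es) \dim (e @: A))%N.
Proof.
elim: es => [|e es IHes] /=; first by rewrite !big_nil lim0g dimv0.
move=> stab /andP[e_notin uniq_es] idem orth; rewrite !big_cons.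
have eA : (e @: A <= A)%VS by apply: stab; rewrite mem_head.
have stab_es f : f \in es -> (f @: A <= A)%VS by move=> fes; apply: stab; rewrite inE fes orbT.
have idem_es f : f \in es -> (f \o f)%VF = f by move=> fes; apply: idem; rewrite inE fes orbT.
have orth_es f g : f \in es -> g \in es -> f != g -> (f \o g)%VF = 0.
  by move=> fes ges; apply: orth; rewrite inE ?fes ?ges orbT.
rewrite -IHes //; set s := \sum_(f <- es) f.
have neq f : f \in es -> e != f by move=> fes; apply: contraNneq e_notin => ->.
have comp_sumr (g : 'End(V)) : (g \o s)%VF = \sum_(f <- es) (g \o f)%VF.
  apply/lfunP => v; rewrite comp_lfunE sum_lfunE /s sum_lfunE linear_sum.
  by apply: eq_bigr => f _; rewrite comp_lfunE.
have comp_suml (g : 'End(V)) : (s \o g)%VF = \sum_(f <- es) (f \o g)%VF.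
  apply/lfunP => v; rewrite comp_lfunE sum_lfunE /s sum_lfunE.
  by apply: eq_bigr => f _; rewrite comp_lfunE.
have ee : (e \o e)%VF = e by apply: idem; rewrite mem_head.
have es0 : (e \o s)%VF = 0.
  rewrite comp_sumr big_seq big1 // => f fes.
  by apply: orth; rewrite ?mem_head ?inE ?fes ?orbT ?neq.
have se0 : (s \o e)%VF = 0.
  rewrite comp_suml big_seq big1 // => f fes.
  by apply: orth; rewrite ?mem_head ?inE ?fes ?orbT // eq_sym neq.
have := limg_ker_dim e ((e + s) @: A); rewrite -limg_comp comp_lfunDr ee es0 addr0 addnC => <-.
congr (_ + \dim _)%N; apply/vspaceP => v; rewrite memv_cap memv_ker.
apply/andP/memv_imgP => [[/memv_imgP[w wA ->]]|[w wA ->]].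
  rewrite -comp_lfunE comp_lfunDr ee es0 addr0 => /eqP ew0.
  by exists w => //; rewrite add_lfunE ew0 add0r.
rewrite -comp_lfunE es0 zero_lfunE eqxx; split=> //.
(* (e + s) sends w - e w to s w. *)
apply/memv_imgP; exists (w - e w); first by rewrite memvB // (subvP eA) // memv_img.
rewrite linearB /= !add_lfunE -!(comp_lfunE _ e) ee se0 zero_lfunE addr0 addrAC.
by rewrite subrr add0r.
Qed.

Lemma ent_sum (I : Type) (r : seq I) (q : I -> quad l) j i :
  ent (\sum_(k <- r) q k) j i = (\sum_(k <- r) ent (q k) j i)%N.
Proof.
elim: r => [|k r IHr]; first by rewrite !big_nil ent0.
by rewrite !big_cons entD IHr.
Qed.

Lemma sum_summand_dim V (U : config V) es :
  object l U -> decomp U \1%VF es -> \sum_(e <- es) summand_dim U e = dimq l U.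
Proof.
move=> oU [uniq_es sum_es mor_es idem_es orth_es _]; apply: eq_quad => j i lt_il.
rewrite ent_sum ent_dimq // big_seq.
under eq_bigr => e ees do rewrite (ent_summand_dim (mor_es e ees) (idem_es e ees) lt_il).
have [_ Uinc _ _ _] := oU.
have dimS k : (k <= l j)%N -> (\sum_(e <- es) \dim (e @: U j k) = \dim (U j k))%N.
  by move=> le_kl; rewrite -dim_orth_sum ?sum_es ?lim1g // => e /mor_es; apply.
rewrite sumnB => [|e _]; last by apply/dimvS/limgS/Uinc.
by rewrite -!big_seq !dimS // ltnW.
Qed.

End Decompositions.

(** * Uniqueness of decompositions into bricks *)

Section KrullSchmidt.
Variables (K : fieldType) (l : 'I_4 -> nat).
Hypothesis charK0 : [pchar K] =i pred0.
Hypothesis l_gt0 : forall j, (0 < l j)%N.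
Implicit Types V W : vectType K.

(** e f e comes from an endomorphism of the image of e, which is scalar. *)
Lemma brick_corner V (U : config V) e f :
  object l U -> mor l U U e -> (e \o e)%VF = e -> brick l (induced U (limg e)) ->
  mor l U U f -> exists t, (e \o f \o e)%VF = t *: e.
Proof.
move=> oU eU ee bE fU; have [i [c [si cU ciK icE]]] := split_idem oU eU ee.
have [t tE] : exists t, (c \o f \o i)%VF = t *: \1%VF.
  by apply: bE; apply: mor_comp (strict_mor si); apply: mor_comp cU fU.
have icv v : i (c v) = e v by have /lfunP/(_ v) := icE; rewrite comp_lfunE.
exists t; apply/lfunP => v; rewrite scale_lfunE !comp_lfunE -!icv.
have /lfunP/(_ (c v)) := tE; rewrite !comp_lfunE scale_lfunE id_lfunE => ->.
by rewrite linearZ.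
Qed.

(** The identity e f e = t e makes f injective on e A. *)
Lemma le_dim_corner V (A : {vspace V}) (e f : 'End(V)) t : t != 0 -> (e @: A <= A)%VS ->
  (e \o f \o e)%VF = t *: e -> (\dim (e @: A) <= \dim (f @: A))%N.
Proof.
move=> t0 eA efe; apply: (@leq_trans (\dim (f @: (e @: A)))); last by apply/dimvS/limgS.
rewrite (limg_dim_eq (f := f)) //; apply/eqP; rewrite -subv0; apply/subvP => v.
rewrite memv_cap memv_ker => /andP[/memv_imgP[w _ ->] /eqP few0].
have /lfunP/(_ w) := efe; rewrite !comp_lfunE few0 linear0 scale_lfunE => /esym/eqP.
by rewrite scaler_eq0 (negPf t0) memv0.
Qed.

(** Compute e f e f e in two ways: it is t^2 e and also t t' e. *)
Lemma corner_square V (e f : 'End(V)) t t' : e != 0 ->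
  (e \o f \o e)%VF = t *: e -> (f \o e \o f)%VF = t' *: f -> t * (t - t') = 0.
Proof.
move=> e0 efe fef; apply/eqP; rewrite mulrBr subr_eq0.
suff /eqP : (t * t) *: e - (t * t') *: e = 0.
  by rewrite -scalerBl scaler_eq0 (negPf e0) orbF subr_eq0.
have E1 : (e \o f \o e \o (f \o e))%VF = (t * t) *: e.
  by rewrite efe -comp_lfunZl comp_lfunA efe scalerA.
have E2 : (e \o f \o e \o (f \o e))%VF = (t * t') *: e.
  have -> : (e \o f \o e \o (f \o e))%VF = (e \o (f \o e \o f) \o e)%VF.
    by rewrite !comp_lfunA.
  by rewrite fef -comp_lfunZr -comp_lfunZl efe scalerA mulrC.
by rewrite -E1 -E2 subrr.
Qed.

(* Comparing two decompositions by the scalars t with e f e = t e and f e f = t f: they are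
   zero unless e and f have the same dimension vector, and sum to 1 along rows and columns. *)
Lemma krull_schmidt V (U : config V) es fs :
  object l U -> decomp l U \1%VF es -> decomp l U \1%VF fs ->
  (forall e, e \in es -> brick l (induced U (limg e))) ->
  (forall f, f \in fs -> brick l (induced U (limg f))) ->
  perm_eq (map (summand_dim l U) es) (map (summand_dim l U) fs).
Proof.
move=> oU [ues ses mes ies oes indes] [ufs sfs mfs ifs ofs indfs] bes bfs.
have neq0 e : (e \o e)%VF = e -> indec l (induced U (limg e)) -> e != 0.
  move=> ee [+ _]; rewrite dim_subvs => rk; apply: contraTneq rk => ->.
  by rewrite lim0g dimv0.
have /fin_all_exists[t tP] : forall p : 'I_(size es) * 'I_(size fs), exists t : K,
    let e := nth 0 es p.1 in let f := nth 0 fs p.2 in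
    [/\ (e \o f \o e)%VF = t *: e, (f \o e \o f)%VF = t *: f &
        t != 0 -> summand_dim l U e = summand_dim l U f].
  move=> [i j] /=; set e := nth 0 es i; set f := nth 0 fs j.
  have ees : e \in es by apply: mem_nth.
  have ffs : f \in fs by apply: mem_nth.
  have [eU ee] := (mes e ees, ies e ees); have [fU ff] := (mfs f ffs, ifs f ffs).
  have [t tE] := brick_corner oU eU ee (bes e ees) fU.
  have [t' t'E] := brick_corner oU fU ff (bfs f ffs) eU.
  have e0 := neq0 e ee (indes e ees); have f0 := neq0 f ff (indfs f ffs).
  (* The two corner identities add up to (t - t')^2 = 0. *)
  have tt' : t = t'.
    have := corner_square e0 tE t'E; have := corner_square f0 t'E tE.
    move=> H1 H2; apply/eqP; rewrite -subr_eq0 -sqrf_eq0.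
    have -> : (t - t') ^+ 2 = t * (t - t') + t' * (t' - t) by ring.
    by rewrite H1 H2 addr0.
  rewrite -tt' in t'E; exists t; split=> // t0.
  apply: eq_quad => k m lt_ml; rewrite !ent_summand_dim //.
  have dim_eq q : (q <= l k)%N -> \dim (e @: U k q) = \dim (f @: U k q).
    move=> le_ql; apply/eqP; rewrite eqn_leq.
    rewrite (le_dim_corner t0 (eU k q le_ql) tE).
    by rewrite (le_dim_corner t0 (fU k q le_ql) t'E).
  by rewrite !dim_eq // ltnW.
have comp_suml (r : seq 'End(V)) (g h : 'End(V)) :
    (g \o (\sum_(e <- r) e) \o h)%VF = \sum_(e <- r) (g \o e \o h)%VF.
  apply/lfunP => v; rewrite !comp_lfunE !sum_lfunE linear_sum.
  by apply: eq_bigr => e _; rewrite !comp_lfunE.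
have row_sum i : \sum_j t (i, j) = 1.
  pose e := nth 0 es i; have ees : e \in es by apply: mem_nth.
  have e0 := neq0 e (ies e ees) (indes e ees).
  apply/eqP; rewrite -subr_eq0.
  suff /eqP : (\sum_j t (i, j)) *: e - 1 *: e = 0.
    by rewrite -scalerBl scaler_eq0 (negPf e0) orbF.
  apply/eqP; rewrite subr_eq0 scale1r scaler_suml; apply/eqP.
  transitivity (e \o \1 \o e)%VF; last by rewrite comp_lfun1r ies.
  rewrite -sfs comp_suml (big_nth 0) big_mkord; apply: eq_bigr => j _.
  by have [] := tP (i, j).
have col_sum j : \sum_i t (i, j) = 1.
  pose f := nth 0 fs j; have ffs : f \in fs by apply: mem_nth.
  have f0 := neq0 f (ifs f ffs) (indfs f ffs).
  apply/eqP; rewrite -subr_eq0.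
  suff /eqP : (\sum_i t (i, j)) *: f - 1 *: f = 0.
    by rewrite -scalerBl scaler_eq0 (negPf f0) orbF.
  apply/eqP; rewrite subr_eq0 scale1r scaler_suml; apply/eqP.
  transitivity (f \o \1 \o f)%VF; last by rewrite comp_lfun1r ifs.
  rewrite -ses comp_suml (big_nth 0) big_mkord; apply: eq_bigr => i _.
  by have [] := tP (i, j).
have count_sum (r : seq 'End(V)) (a : pred (quad l)) :
    ((count a (map (summand_dim l U) r))%:R : K) =
      \sum_(i < size r | a (summand_dim l U (nth 0 r i))) 1.
  rewrite count_map -sum1_count (big_nth 0) big_mkord natr_sum.
  by apply: eq_bigr.
apply/permP => a.
(* Both counts equal the sum of t over all pairs whose dimension vectors satisfy [a]; whether the
   condition is put on the first or the second index is indifferent, since nonzero t forces equal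
   vectors. Characteristic zero brings the equality back from K to the natural numbers. *)
have eqK : ((count a (map (summand_dim l U) es))%:R : K) =
           (count a (map (summand_dim l U) fs))%:R.
  rewrite !count_sum.
  under eq_bigr => i _ do rewrite -(row_sum i).
  under [RHS]eq_bigr => j _ do rewrite -(col_sum j).
  rewrite [RHS]exchange_big /= big_mkcond; apply: eq_bigr => i _.
  rewrite [RHS]big_mkcond; case: ifP => ai; last first.
    rewrite big1 // => j _; case: ifP => // aj.
    have [_ _ H] := tP (i, j); apply/eqP; apply: contraFT ai => /H /= ->.
    exact: aj.
  apply: eq_bigr => j _; case: ifP => // aj.
  have [_ _ H] := tP (i, j); apply/eqP; apply: contraFT aj => /H /= <-.
  exact: ai.
move: (count _ _) (count _ _) eqK => m n.
wlog le_mn : m n / (m <= n)%N => [H|eqK].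
  by case/orP: (leq_total m n) => le; [apply: H | move/esym => E; apply/esym/H].
apply/eqP; rewrite eqn_leq le_mn -subn_eq0 -((pcharf0P K).1 charK0).
by rewrite natrB // eqK subrr eqxx.
Qed.

End KrullSchmidt.

(** * Polynomial maps between vector spaces *)

Section PolynomialFunctions.
Variable K : fieldType.
Implicit Types W X Y : vectType K.

(** The coordinates used in [zariski_open_in]. *)
Definition crd W (x : W) : 'I_(\dim {: W}) -> K := fun i => coord (vbasis {: W}) i x.

Definition polyfun W (phi : W -> K) : Prop :=
  exists p : {mpoly K[\dim {: W}]}, forall x, phi x = p.@[crd x].

Definition polymap W X (F : W -> X) : Prop := forall i, polyfun (fun x => crd (F x) i).

Lemma crdE W (x : W) : x = \sum_i crd x i *: (vbasis {: W})`_i.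
Proof. exact: coord_vbasis (memvf x). Qed.

Lemma polyfun_ext W (phi psi : W -> K) : phi =1 psi -> polyfun phi -> polyfun psi.
Proof. by move=> eq_phi [p pE]; exists p => x; rewrite -eq_phi. Qed.

Lemma polyfun_const W c : polyfun (fun _ : W => c).
Proof. by exists c%:MP => x; rewrite mevalC. Qed.

Lemma polyfun_crd W i : polyfun (fun x : W => crd x i).
Proof. by exists 'X_i => x; rewrite mevalXU. Qed.

Lemma polyfunD W (phi psi : W -> K) :
  polyfun phi -> polyfun psi -> polyfun (fun x => phi x + psi x).
Proof. by move=> [p pE] [q qE]; exists (p + q) => x; rewrite mevalD pE qE. Qed.

Lemma polyfunM W (phi psi : W -> K) :
  polyfun phi -> polyfun psi -> polyfun (fun x => phi x * psi x).
Proof. by move=> [p pE] [q qE]; exists (p * q) => x; rewrite mevalM pE qE. Qed.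

Lemma polyfun_sum W (I : Type) (r : seq I) (P : pred I) (F : I -> W -> K) :
  (forall i, polyfun (F i)) -> polyfun (fun x => \sum_(i <- r | P i) F i x).
Proof.
move=> FP; elim: r => [|i r IHr].
  by apply: (polyfun_ext _ (polyfun_const W 0)) => x; rewrite big_nil.
have [Pi|nPi] := boolP (P i).
  by apply: (polyfun_ext _ (polyfunD (FP i) IHr)) => x; rewrite big_cons Pi.
by apply: (polyfun_ext _ IHr) => x; rewrite big_cons (negPf nPi).
Qed.

Lemma polyfun_prod W (I : Type) (r : seq I) (P : pred I) (F : I -> W -> K) :
  (forall i, polyfun (F i)) -> polyfun (fun x => \prod_(i <- r | P i) F i x).
Proof.
move=> FP; elim: r => [|i r IHr].
  by apply: (polyfun_ext _ (polyfun_const W 1)) => x; rewrite big_nil.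
have [Pi|nPi] := boolP (P i).
  by apply: (polyfun_ext _ (polyfunM (FP i) IHr)) => x; rewrite big_cons Pi.
by apply: (polyfun_ext _ IHr) => x; rewrite big_cons (negPf nPi).
Qed.

Lemma polyfunX W (phi : W -> K) n : polyfun phi -> polyfun (fun x => phi x ^+ n).
Proof.
move=> phiP; apply: (polyfun_ext _ (polyfun_prod (index_enum 'I_n) xpredT (fun _ => phiP))) => x.
by rewrite prodr_const card_ord.
Qed.

Lemma polyfun_linear W X (F : W -> X) (phi : X -> K) :
  polymap F -> scalar phi -> polyfun (fun x => phi (F x)).
Proof.
move=> FP phi_lin.
have sumE := polyfun_sum (index_enum 'I_(\dim {: X})) xpredT
  (fun i => polyfunM (FP i) (polyfun_const W (phi (vbasis {: X})`_i))).
apply: (polyfun_ext _ sumE) => x.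
pose flM := GRing.isLinear.Build _ _ _ _ phi phi_lin.
pose fL : {scalar X} := HB.pack phi flM.
rewrite -[phi (F x)]/(fL (F x)) [in RHS](crdE (F x)) linear_sum.
by apply: eq_bigr => i _; rewrite linearZ.
Qed.

Lemma polyfun_comp W X (F : W -> X) (phi : X -> K) :
  polymap F -> polyfun phi -> polyfun (fun x => phi (F x)).
Proof.
move=> FP [p pE].
have sumE := polyfun_sum (msupp p) xpredT (fun m =>
   polyfunM (polyfun_const W p@_m) (polyfun_prod (index_enum 'I_(\dim {: X})) xpredT
     (fun i => polyfunX (m i) (FP i)))).
by apply: (polyfun_ext _ sumE) => x; rewrite pE mevalE.
Qed.

Lemma crd_scalar W i : scalar (fun x : W => crd x i).
Proof. by move=> c x y; rewrite /crd linearP. Qed.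

Lemma polymap_ext W X (F G : W -> X) : F =1 G -> polymap F -> polymap G.
Proof. by move=> FG FP i; apply: (polyfun_ext _ (FP i)) => x; rewrite FG. Qed.

Lemma polymap_const W X (y : X) : polymap (fun _ : W => y).
Proof. by move=> i; apply: polyfun_const. Qed.

Lemma polymap_id W : polymap (@id W).
Proof. by move=> i; apply: polyfun_crd. Qed.

Lemma polymap_linear W X Y (F : W -> X) (L : X -> Y) :
  polymap F -> linear L -> polymap (fun x => L (F x)).
Proof.
move=> FP L_lin i; apply: (@polyfun_linear _ _ F (fun y => crd (L y) i)) => // c x y.
by rewrite L_lin crd_scalar.
Qed.

Lemma polymapD W X (F G : W -> X) : polymap F -> polymap G -> polymap (fun x => F x + G x).
Proof.
move=> FP GP i; apply: (polyfun_ext _ (polyfunD (FP i) (GP i))) => x.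
by rewrite /crd linearD.
Qed.

Lemma polymapZ W X (phi : W -> K) (F : W -> X) :
  polyfun phi -> polymap F -> polymap (fun x => phi x *: F x).
Proof.
move=> phiP FP i; apply: (polyfun_ext _ (polyfunM phiP (FP i))) => x.
by rewrite /crd linearZ.
Qed.

Lemma polymap_sum W X (I : Type) (r : seq I) (F : I -> W -> X) :
  (forall i, polymap (F i)) -> polymap (fun x => \sum_(i <- r) F i x).
Proof.
move=> FP k; apply: (polyfun_ext _ (polyfun_sum r xpredT (fun i => FP i k))) => x.
by rewrite /crd linear_sum.
Qed.

Lemma polymap_pair W X Y (F : W -> X) (G : W -> Y) :
  polymap F -> polymap G -> polymap (fun x => (F x, G x)).
Proof.
move=> FP GP; have in1 : linear (fun x : X => (x, 0 : Y)).
  by move=> c x y; congr (_, _); rewrite /= scaler0 addr0.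
have in2 : linear (fun y : Y => (0 : X, y)).
  by move=> c x y; congr (_, _); rewrite /= scaler0 addr0.
apply: (polymap_ext _ (polymapD (polymap_linear FP in1) (polymap_linear GP in2))) => x.
by congr (_, _); rewrite /= ?addr0 ?add0r.
Qed.

Lemma polymap_bilinear W X1 X2 Y (B : X1 -> X2 -> Y) (F : W -> X1) (G : W -> X2) :
  (forall x, linear (B x)) -> (forall y, linear (B^~ y)) ->
  polymap F -> polymap G -> polymap (fun x => B (F x) (G x)).
Proof.
move=> Br Bl FP GP.
have BP i : polymap (fun x => crd (F x) i *: B (vbasis {: X1})`_i (G x)).
  by apply: polymapZ (FP i) _; apply: polymap_linear.
apply: (polymap_ext _ (polymap_sum (index_enum _) BP)) => x.
pose flM := GRing.isLinear.Build _ _ _ _ (B^~ (G x)) (Bl (G x)).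
pose fL : {linear X1 -> Y} := HB.pack (B^~ (G x)) flM.
rewrite -[B (F x) (G x)]/(fL (F x)) [in RHS](crdE (F x)) linear_sum.
by apply: eq_bigr => i _; rewrite linearZ.
Qed.

Lemma comp_lfun_linr (X1 X2 X3 : vectType K) (f : 'Hom(X2, X3)) :
  linear (fun g : 'Hom(X1, X2) => (f \o g)%VF).
Proof. by move=> c g h; rewrite comp_lfunDr -comp_lfunZr. Qed.

Lemma comp_lfun_linl (X1 X2 X3 : vectType K) (g : 'Hom(X1, X2)) :
  linear (fun f : 'Hom(X2, X3) => (f \o g)%VF).
Proof. by move=> c f h; rewrite comp_lfunDl -comp_lfunZl. Qed.

Lemma polymap_comp_lfun W (X1 X2 X3 : vectType K) (F : W -> 'Hom(X2, X3))
    (G : W -> 'Hom(X1, X2)) :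
  polymap F -> polymap G -> polymap (fun x => (F x \o G x)%VF).
Proof.
exact: polymap_bilinear (@comp_lfun_linr X1 X2 X3) (@comp_lfun_linl X1 X2 X3).
Qed.

Definition polymx W m n (M : W -> 'M[K]_(m, n)) : Prop :=
  forall i j, polyfun (fun x => M x i j).

Lemma polymx_mul W m n p (M : W -> 'M[K]_(m, n)) (N : W -> 'M[K]_(n, p)) :
  polymx M -> polymx N -> polymx (fun x => M x *m N x).
Proof.
move=> MP NP i k.
apply: (polyfun_ext _ (polyfun_sum (index_enum _) xpredT (fun j => polyfunM (MP i j) (NP j k)))).
by move=> x; rewrite mxE.
Qed.

Lemma polyfun_det W n (M : W -> 'M[K]_n) : polymx M -> polyfun (fun x => \det (M x)).
Proof.
move=> MP; apply: polyfun_sum => s; apply: polyfunM; first exact: polyfun_const.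
by apply: polyfun_prod => i; apply: MP.
Qed.

Lemma polymx_adj W n (M : W -> 'M[K]_n) : polymx M -> polymx (fun x => \adj (M x)).
Proof.
move=> MP i j; have cofP : polyfun (fun x => cofactor (M x) j i).
  apply: polyfunM; first exact: polyfun_const.
  apply: polyfun_det => i' j'.
  by apply: (polyfun_ext _ (MP (lift j i') (lift i j'))) => x; rewrite !mxE.
by apply: (polyfun_ext _ cofP) => x; rewrite mxE.
Qed.

(** Restriction to a line reduces non-vanishing in several variables to avoiding the roots of a
    one-variable polynomial. *)
Lemma polyfun_line W (phi : W -> K) x0 x1 : polyfun phi ->
  exists q : {poly K}, forall t, phi (x0 + t *: x1) = q.[t].
Proof.
move=> [p pE]; exists (\sum_(m <- msupp p) p@_m *:
  \prod_i ((crd x0 i)%:P + (crd x1 i) *: 'X) ^+ m i) => t.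
rewrite pE mevalE horner_sum; apply: eq_bigr => m _.
rewrite hornerZ horner_prod; congr (_ * _); apply: eq_bigr => i _.
by rewrite horner_exp hornerD hornerC hornerZ hornerX /crd linearD linearZ /= mulrC.
Qed.

End PolynomialFunctions.

Section Determinants.
Variable K : fieldType.
Implicit Types V W : vectType K.
Import VectorInternalTheory.

Definition dete V (f : 'End(V)) : K := \det (f2mx f).

Lemma f2mx_entry V (f : 'End(V)) i j : f2mx f i j = v2r (f (r2v (delta_mx 0 i))) 0 j.
Proof. by rewrite v2r_lfun r2vK -rowE mxE. Qed.

Lemma polyfun_dete V : polyfun (@dete V).
Proof.
apply: polyfun_det => i j.
apply: (@polyfun_linear _ _ _ id (fun f : 'End(V) => f2mx f i j)); first exact: polymap_id.
by move=> c f g; rewrite !f2mx_entry add_lfunE scale_lfunE linearP /= !mxE.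
Qed.

Lemma dete_neq0 V (f : 'End(V)) : (dete f != 0) = (lker f == 0%VS).
Proof.
apply/idP/idP => [f_unit|/lker0P f_inj].
  have {}f_unit : f2mx f \in unitmx by rewrite unitmxE unitfE.
  rewrite -subv0; apply/subvP => v; rewrite memv_ker memv0 => /eqP fv0.
  apply/eqP/v2r_inj; rewrite linear0 -[LHS](mulmxK f_unit) -v2r_lfun fv0 linear0.
  by rewrite mul0mx.
apply/negP => /det0P[v v_neq0 vf0]; case/negP: v_neq0.
have : f (r2v v) = f 0 by apply: v2r_inj; rewrite v2r_lfun r2vK vf0 !linear0.
by move=> /f_inj/(congr1 v2r); rewrite r2vK linear0 => ->.
Qed.

Lemma dete1 V : dete (\1%VF : 'End(V)) != 0.
Proof. by rewrite dete_neq0; apply/lker0P => x y; rewrite !id_lfunE. Qed.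

End Determinants.

(** * Irreducibility of affine space *)

Section Irreducibility.
Variable K : closedFieldType.

(** On the line through x0 and x1 each function is a nonzero one-variable polynomial, and a nonzero
    polynomial over an algebraically closed field, here their product, has a non-root. [List.In] is
    used because functions W -> K have no decidable equality. *)
Lemma polyfun_line_common (W : vectType K) (phis : seq (W -> K)) x0 x1 :
  (forall phi, List.In phi phis -> polyfun phi /\ (phi x0 != 0 \/ phi x1 != 0)) ->
  exists t, forall phi, List.In phi phis -> phi ((1 - t) *: x0 + t *: x1) != 0.
Proof.
move=> phisP.
have lineE t : (1 - t) *: x0 + t *: x1 = x0 + t *: (x1 - x0).
  by rewrite scalerBl scale1r scalerBr addrA addrAC.
suff [q q_neq0 qP] : exists2 q : {poly K}, q != 0 & forall t, q.[t] != 0 ->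
    forall phi, List.In phi phis -> phi ((1 - t) *: x0 + t *: x1) != 0.
  have /closed_nonrootP[t qt] := q_neq0; exists t; exact: qP.
elim: phis phisP => [|phi phis IHphis] phisP.
  by exists 1 => //; rewrite oner_eq0.
have [|q q_neq0 qP] := IHphis; first by move=> psi psiP; apply: phisP; right.
have [phiP phi_neq0] := phisP phi (or_introl (erefl _)).
have [r rE] := polyfun_line x0 (x1 - x0) phiP.
have r_neq0 : r != 0.
  apply/eqP => r0; case: phi_neq0 => /eqP; apply.
    by have := rE 0; rewrite scale0r addr0 r0 horner0.
  by have := rE 1; rewrite scale1r addrC subrK r0 horner0.
exists (r * q); first by rewrite mulf_neq0.
move=> t; rewrite hornerM mulf_eq0 negb_or => /andP[rt qt] psi [<-|psiP].
  by rewrite lineE rE.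
exact: qP.
Qed.

Lemma polyfun_common (W : vectType K) (phi psi : W -> K) x y :
  polyfun phi -> polyfun psi -> phi x != 0 -> psi y != 0 ->
  exists z, phi z != 0 /\ psi z != 0.
Proof.
move=> phiP psiP phix psiy.
have [|t tP] := @polyfun_line_common W [:: phi; psi] x y.
  by move=> _ [<-|[<-|[]]]; split=> //; [left | right].
by exists ((1 - t) *: x + t *: y); split; apply: tP; [left | right; left].
Qed.

End Irreducibility.

(** * Rigid configurations *)

Section Isomorphisms.
Variables (K : fieldType) (l : 'I_4 -> nat).
Hypothesis l_gt0 : forall j, (0 < l j)%N.
Implicit Types V W : vectType K.

Definition isomorphism V W (U : config V) (U' : config W)
    (h : 'Hom(V, W)) : Prop :=
  [/\ lker h = 0%VS, limg h = fullv &
      forall j i, (i <= l j)%N -> (h @: U j i)%VS = U' j i].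

Definition isom V W (U : config V) (U' : config W) :=
  exists h, isomorphism U U' h.

Lemma isomorphism_of_inverses V W (U : config V)
    (U' : config W) (h : 'Hom(V, W)) (g : 'Hom(W, V)) :
  mor l U U' h -> mor l U' U g -> (g \o h)%VF = \1%VF -> (h \o g)%VF = \1%VF ->
  isomorphism U U' h.
Proof.
move=> hU gU gh hg; split=> [||j i le_il].
- apply/eqP; rewrite -subv0; apply/subvP => v; rewrite memv_ker memv0 => /eqP hv0.
  by rewrite -[v]id_lfunE -gh comp_lfunE hv0 linear0.
- apply/vspaceP => w; rewrite memvf; apply/memv_imgP; exists (g w); rewrite ?memvf //.
  by rewrite -comp_lfunE hg id_lfunE.
apply/eqP; rewrite eqEsubv hU //=; apply/subvP => w wU.
by rewrite -[w]id_lfunE -hg comp_lfunE memv_img // (mor_mem gU).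
Qed.

Lemma isomorphism_inv V W (U : config V)
    (U' : config W) (h : 'Hom(V, W)) : isomorphism U U' h ->
  [/\ mor l U U' h, mor l U' U (h^-1)%VF, (h^-1 \o h)%VF = \1%VF & (h \o h^-1)%VF = \1%VF].
Proof.
move=> [h0 hf hU]; have hK : (h^-1 \o h)%VF = \1%VF by apply: lker0_compVf; apply/eqP.
split=> //.
- by move=> j i le_il; rewrite hU.
- by move=> j i le_il; rewrite -hU // -limg_comp hK lim1g.
by apply/lfunP => w; rewrite comp_lfunE id_lfunE limg_lfunVK // hf memvf.
Qed.

Lemma isom_refl V (U : config V) : isom U U.
Proof.
exists \1%VF; apply: (@isomorphism_of_inverses _ _ _ _ _ \1%VF).
- exact: mor_id.
- exact: mor_id.
- exact: comp_lfun1l.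
exact: comp_lfun1l.
Qed.

Lemma isom_sym V W (U : config V) (U' : config W) :
  isom U U' -> isom U' U.
Proof.
move=> [h /isomorphism_inv[hU gU gh hg]]; exists (h^-1)%VF.
exact: isomorphism_of_inverses gU hU hg gh.
Qed.

Lemma isom_trans V1 V2 V3 (U1 : config V1) (U2 : config V2)
    (U3 : config V3) : isom U1 U2 -> isom U2 U3 -> isom U1 U3.
Proof.
move=> [h /isomorphism_inv[hU gU gh hg]] [h' /isomorphism_inv[h'U g'U g'h' h'g']].
exists (h' \o h)%VF; apply: (@isomorphism_of_inverses _ _ _ _ _ (h^-1 \o h'^-1)%VF).
- by apply: mor_comp hU.
- by apply: mor_comp g'U.
- by rewrite comp_lfunA -(comp_lfunA _ h'^-1%VF) g'h' comp_lfun1r.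
by rewrite comp_lfunA -(comp_lfunA _ h) hg comp_lfun1r.
Qed.

Lemma isom_dimq V W (U : config V) (U' : config W) :
  isom U U' -> dimq l U = dimq l U'.
Proof.
move=> [h [h0 hf hU]]; have dimU j i : (i <= l j)%N -> \dim (U' j i) = \dim (U j i).
  by move=> le_il; rewrite -hU // limg_dim_eq // h0 capv0.
by apply: eq_quad => j i lt_il; rewrite !ent_dimq // !dimU // ltnW.
Qed.

Lemma isom_object V W (U : config V) (U' : config W) :
  isom U U' -> object l U -> object l U'.
Proof.
move=> [h [h0 hf hU]] [U0 Uinc Ul sU dU].
have hC j : (h @: U j (lenC l j))%VS = U' j (lenC l j) by rewrite hU ?lenC_le.
have dimh A : \dim (h @: A) = \dim A by rewrite limg_dim_eq // h0 capv0.
have sU' : (\sum_j U' j (lenC l j))%VS = fullv.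
  by under eq_bigr => j _ do rewrite -hC; rewrite -limg_sum sU.
split=> //.
- by move=> j; rewrite -hU // U0 limg0.
- by move=> j i lt_il; rewrite -!hU ?(ltnW lt_il) // limgS // Uinc.
- by move=> j; rewrite -hU // Ul.
rewrite directvEgeq /= sU' -hf dimh -sU (directvP dU) /=.
by apply: leq_sum => j _; rewrite -hC dimh.
Qed.

(** Together h and g reach every configuration on V with the dimension vector of U, up to irrelevant
    values ([act2_transitive]); the diagonal pairs give isomorphic ones. *)
Definition act2 V (h g : 'End(V)) (U : config V) j i : {vspace V} :=
  ((if j == armD then g else h) @: U j i)%VS.

Lemma lker0_full V (f : 'End(V)) : lker f = 0%VS -> limg f = fullv.
Proof. by move=> f0; apply: lker0_limgf; apply/eqP. Qed.

Lemma lker0_comp V (f g : 'End(V)) : lker f = 0%VS -> lker g = 0%VS -> lker (f \o g)%VF = 0%VS.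
Proof.
move=> /eqP/lker0P f0 /eqP/lker0P g0; apply/eqP/lker0P => x y.
by rewrite !comp_lfunE => /f0/g0.
Qed.

Lemma act2_object V (h g : 'End(V)) (U : config V) :
  lker h = 0%VS -> lker g = 0%VS -> object l U -> object l (act2 h g U).
Proof.
move=> h0 g0 [U0 Uinc Ul sU dU].
have dimh A : \dim (h @: A) = \dim A by rewrite limg_dim_eq // h0 capv0.
have hC j : act2 h g U j (lenC l j) = (h @: U j (lenC l j))%VS.
  by rewrite /act2 /lenC; case: eqP => // ->; rewrite U0 !limg0.
have sU' : (\sum_j act2 h g U j (lenC l j))%VS = fullv.
  by under eq_bigr => j _ do rewrite hC; rewrite -limg_sum sU lker0_full.
split=> //.
- by move=> j; rewrite /act2 U0 limg0.
- by move=> j i lt_il; rewrite /act2 limgS // Uinc.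
- by move=> j; rewrite /act2 Ul; case: ifP => _; rewrite lker0_full.
rewrite directvEgeq /= sU' -(lker0_full h0) dimh -sU (directvP dU) /=.
by apply: leq_sum => j _; rewrite hC dimh.
Qed.

Lemma act2_dimq V (h g : 'End(V)) (U : config V) :
  lker h = 0%VS -> lker g = 0%VS -> dimq l (act2 h g U) = dimq l U.
Proof.
move=> h0 g0; apply: eq_quad => j i lt_il; rewrite !ent_dimq // /act2.
by case: ifP => _; rewrite !limg_dim_eq // ?h0 ?g0 capv0.
Qed.

Lemma act2_comp V (h g h' g' : 'End(V)) (U : config V) j i :
  act2 h g (act2 h' g' U) j i = act2 (h \o h')%VF (g \o g')%VF U j i.
Proof. by rewrite /act2; case: ifP; rewrite limg_comp. Qed.

(** The map k = h c = g p does both jobs: written h c it moves arms A, B, C as h does, written g p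
    it moves arm D as g does. *)
Lemma act2_isom_of V (h g c p : 'End(V)) (U : config V) :
  object l U -> lker h = 0%VS -> lker g = 0%VS -> lker c = 0%VS -> lker p = 0%VS ->
  preserves (lenC l) U U c -> preserves (lenD l) U U p -> (h \o c)%VF = (g \o p)%VF ->
  isomorphism U (act2 h g U) (h \o c)%VF.
Proof.
move=> oU h0 g0 c0 p0 cU pU hc; have [_ _ Ul _ _] := oU.
have inv_pres m (f : 'End(V)) j i : lker f = 0%VS -> preserves m U U f -> (i <= m j)%N ->
    (f @: U j i)%VS = U j i.
  by move=> f0 fU le_im; apply/eqP; rewrite eqEdim fU //= limg_dim_eq // f0 capv0.
split=> [||j i le_il]; first exact: lker0_comp.
  by apply/lker0_full/lker0_comp.
rewrite /act2; case: eqP => [jD|/eqP ne_jD].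
  by rewrite hc limg_comp (inv_pres (lenD l)) // /lenD jD eqxx -jD.
move: le_il; rewrite leq_eqVlt => /predU1P[->|lt_il].
  by rewrite Ul !lker0_full //; apply: lker0_comp.
rewrite limg_comp (inv_pres (lenC l)) // /lenC (negPf ne_jD).
by rewrite -ltnS prednK.
Qed.

(** Converse of [act2_isom_of], with c = h^-1 k and p = g^-1 k. *)
Lemma act2_isom_exists V (h g k : 'End(V)) (U : config V) :
  object l U -> lker h = 0%VS -> lker g = 0%VS -> isomorphism U (act2 h g U) k ->
  exists c p : 'End(V), [/\ preserves (lenC l) U U c, preserves (lenD l) U U p,
     lker c = 0%VS /\ lker p = 0%VS, (h \o c)%VF = k & (g \o p)%VF = k].
Proof.
move=> oU h0 g0 [k0 kf kU]; have [/eqP h0' /eqP g0'] := (h0, g0).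
exists (h^-1 \o k)%VF, (g^-1 \o k)%VF; split.
- move=> j i le_i; have [jD|ne_jD] := eqVneq j armD.
    move: le_i; rewrite /lenC jD leqn0 => /eqP->.
    by have [U0 _ _ _ _] := oU; rewrite U0 limg0 sub0v.
  have le_il : (i <= l j)%N by apply: leq_trans le_i (lenC_le _ _).
  by rewrite limg_comp kU // /act2 (negPf ne_jD) -limg_comp lker0_compVf // lim1g.
- move=> j i le_i; have [jD|ne_jD] := eqVneq j armD; last first.
    move: le_i; rewrite /lenD (negPf ne_jD) leqn0 => /eqP->.
    by have [U0 _ _ _ _] := oU; rewrite U0 limg0 sub0v.
  have le_il : (i <= l j)%N by apply: leq_trans le_i (lenD_le _ _).
  by rewrite limg_comp kU // /act2 jD eqxx -limg_comp lker0_compVf // lim1g.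
- have inj (f : 'End(V)) : lker f == 0%VS -> lker (f^-1 \o k)%VF = 0%VS.
    move=> f0; apply/eqP; rewrite -subv0; apply/subvP => v.
    rewrite memv_ker comp_lfunE memv0 => /eqP/(congr1 f).
    by rewrite lker0_lfunVK // linear0 => /eqP; rewrite -memv_ker k0 memv0.
  by split; apply: inj.
- by rewrite lker0_compVKf.
by rewrite lker0_compVKf.
Qed.

Lemma act2_transitive V W (U : config V) (U' : config W) :
  object l U -> object l U' -> dimq l U = dimq l U' ->
  exists h g : 'Hom(V, W),
    [/\ lker h = 0%VS, lker g = 0%VS, limg h = fullv, limg g = fullv &
        forall j i, (i <= l j)%N -> ((if j == armD then g else h) @: U j i)%VS = U' j i].
Proof.
move=> oU oU' eqUU'.
have [h [h0 hf hU]] : exists h : 'Hom(V, W), [/\ lker h = 0%VS, limg h = fullv &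
    forall j i, (i <= lenC l j)%N -> (h @: U j i)%VS = U' j i].
  apply: multichain_transport (multichainC oU) (multichainC oU') _ => j i le_i.
  by apply: (eq_dimq oU oU' eqUU'); apply: leq_trans le_i (lenC_le _ _).
have [g [g0 gf gU]] : exists h : 'Hom(V, W), [/\ lker h = 0%VS, limg h = fullv &
    forall j i, (i <= lenD l j)%N -> (h @: U j i)%VS = U' j i].
  apply: multichain_transport (multichainD oU) (multichainD oU') _ => j i le_i.
  by apply: (eq_dimq oU oU' eqUU'); apply: leq_trans le_i (lenD_le _ _).
exists h, g; split=> // j i le_il; case: eqP => [jD|/eqP ne_jD].
  by apply: gU; rewrite /lenD jD eqxx -jD.
move: le_il; rewrite leq_eqVlt => /predU1P[->|lt_il].
  by have [_ _ -> _ _] := oU; have [_ _ -> _ _] := oU'.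
by apply: hU; rewrite /lenC (negPf ne_jD) -ltnS prednK.
Qed.

End Isomorphisms.

(** * Polynomial deformation of a rigid configuration *)

Section Deformation.
Variables (K : fieldType) (l : 'I_4 -> nat).
Hypothesis l_gt0 : forall j, (0 < l j)%N.

(* The linear map (c, p) |-> x c - y p is onto for (x, y) = (1, 1); composing it with a
   right inverse at (1, 1) and taking the adjugate matrix, the vector (1, 1) of its kernel
   extends to a polynomial family of kernel vectors. *)
Lemma rigid_deformation (V : vectType K) (U : config V) : rigid l U ->
  exists phi : 'End(V) * 'End(V) -> K,
    [/\ polyfun phi, phi (\1%VF, \1%VF) != 0 &
        forall x y, phi (x, y) != 0 -> exists c p : 'End(V),
          [/\ preserves (lenC l) U U c, preserves (lenD l) U U p,
              lker c = 0%VS, lker p = 0%VS & (x \o c)%VF = (y \o p)%VF]].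
Proof.
move=> rU; pose E : vectType K := 'End(V); pose W : vectType K := (E * E)%type.
set C := preserver (lenC l) U U; set P := preserver (lenD l) U U.
(* Rigidity: each basis vector of End(V) is a difference s1 i - s2 i with terms in the two
   preservers. This is the right inverse at (1, 1). *)
have [s1 [s2 [s1C s2P s12]]] : exists (s1 s2 : 'I_(\dim {: E}) -> E),
    [/\ forall i, s1 i \in C, forall i, s2 i \in P &
        forall i, s1 i - s2 i = (vbasis {: E})`_i].
  have /fin_all_exists[s sP] : forall i : 'I_(\dim {: E}), exists cp : E * E,
      [/\ cp.1 \in C, cp.2 \in P & cp.1 - cp.2 = (vbasis {: E})`_i].
    move=> i; have : (vbasis {: E})`_i \in (C + P)%VS by rewrite [(C + P)%VS]rU memvf.
    by move=> /memv_addP[c cC [p pP ->]]; exists (c, - p); split; rewrite ?memvN ?opprK.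
  by exists (fun i => (s i).1), (fun i => (s i).2); split=> i; have [] := sP i.
pose del (w : W) i : E := (w.1 \o s1 i)%VF - (w.2 \o s2 i)%VF.
pose M (w : W) := \matrix_(i, j) crd (del w i) j.
pose rho (w : W) := \row_j crd (w.1 - w.2) j.
(* The system sum_i z_i (x s1_i - y s2_i) = x - y has matrix M and right-hand side rho. The adjugate
   solves it up to the factor det M, which keeps z polynomial; [fc] and [fp] then satisfy x fc = y
   fp identically. *)
pose z (w : W) := rho w *m \adj (M w).
pose fc (w : W) : E := \det (M w) *: \1%VF - \sum_i z w 0 i *: s1 i.
pose fp (w : W) : E := \det (M w) *: \1%VF - \sum_i z w 0 i *: s2 i.
have fst_poly : polymap (fun w : W => w.1).
  by apply: polymap_linear (@polymap_id _ W) _ => c x y.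
have snd_poly : polymap (fun w : W => w.2).
  by apply: polymap_linear (@polymap_id _ W) _ => c x y.
have opp_lin (X : vectType K) : linear (fun x : X => - x).
  by move=> c x y; rewrite opprD scalerN.
have polymapB (X : vectType K) (F G : W -> X) :
    polymap F -> polymap G -> polymap (fun x => F x - G x).
  by move=> FP GP; apply: polymapD => //; apply: polymap_linear GP (opp_lin X).
have M_poly : polymx M.
  move=> i j; have del_poly : polymap (fun w => del w i).
    by apply: polymapB; apply: polymap_comp_lfun => //; apply: polymap_const.
  by apply: (polyfun_ext _ (del_poly j)) => w; rewrite mxE.
have rho_poly : polymx rho.
  move=> i j; apply: (polyfun_ext _ (polymapB _ _ _ fst_poly snd_poly j)) => w.
  by rewrite mxE.
have z_poly : polymx z by apply: polymx_mul => //; apply: polymx_adj.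
have f_poly (s : 'I_(\dim {: E}) -> E) :
    polymap (fun w : W => \det (M w) *: (\1%VF : E) - \sum_i z w 0 i *: s i).
  apply: polymapB.
    by apply: polymapZ; [apply: polyfun_det | apply: polymap_const].
  by apply: polymap_sum => i; apply: polymapZ; [apply: z_poly | apply: polymap_const].
(* Non-vanishing means that both kernel components are invertible. At (1, 1) one has M = 1 and z =
   0, so both are the identity. *)
exists (fun w => dete (fc w) * dete (fp w)); split.
- by apply: polyfunM; apply: polyfun_comp (@polyfun_dete _ _); apply: f_poly.
- have rho0 : rho (\1%VF, \1%VF) = 0.
    by apply/rowP => j; rewrite !mxE subrr /crd linear0.
  have M1 : M (\1%VF, \1%VF) = 1%:M.
    apply/matrixP => i j; rewrite !mxE /del /= !comp_lfun1l s12 /crd.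
    by rewrite coord_free ?(basis_free (vbasisP _)).
  have z0 i : z (\1%VF, \1%VF) 0 i = 0 by rewrite /z rho0 mul0mx mxE.
  rewrite /fc /fp M1 det1 scale1r !big1 ?subr0 => [|i _|i _]; rewrite ?z0 ?scale0r //.
  by rewrite mulf_neq0 // dete1.
move=> x y; rewrite mulf_eq0 negb_or !dete_neq0 => /andP[/eqP c0 /eqP p0].
exists (fc (x, y)), (fp (x, y)); split=> //.
- apply/preserverP; rewrite memvB ?memvZ //.
    by apply/preserverP; apply: preserves_id.
  by rewrite memv_suml // => i _; rewrite memvZ // s1C.
- apply/preserverP; rewrite memvB ?memvZ //.
    by apply/preserverP; apply: preserves_id.
  by rewrite memv_suml // => i _; rewrite memvZ // s2P.
set w : W := (x, y).
apply/eqP; rewrite -subr_eq0; apply/eqP.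
have compE (f : E) a (c : 'I_(\dim {: E}) -> K) (s : 'I_(\dim {: E}) -> E) :
    (f \o (a *: \1%VF - \sum_i c i *: s i))%VF = a *: f - \sum_i c i *: (f \o s i)%VF.
  rewrite comp_lfunDr comp_lfunNr -comp_lfunZr comp_lfun1r; congr (_ - _).
  apply/lfunP => v; rewrite comp_lfunE !sum_lfunE linear_sum.
  by apply: eq_bigr => i _; rewrite !scale_lfunE linearZ comp_lfunE.
have -> : (x \o fc w)%VF - (y \o fp w)%VF =
    \det (M w) *: (x - y) - \sum_i z w 0 i *: del w i.
  have -> : \sum_i z w 0 i *: del w i =
      \sum_i z w 0 i *: (x \o s1 i)%VF - \sum_i z w 0 i *: (y \o s2 i)%VF.
    by rewrite -sumrB; apply: eq_bigr => i _; rewrite -scalerBr.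
  by rewrite !compE scalerBr !opprD !opprK addrACA.
have zM : z w *m M w = \det (M w) *: rho w.
  by rewrite -mulmxA mul_adj_mx mul_mx_scalar.
apply/eqP; rewrite subr_eq0; apply/eqP.
rewrite (crdE (x - y)) scaler_sumr; symmetry.
under eq_bigr => i _ do rewrite (crdE (del w i)) scaler_sumr.
rewrite exchange_big; apply: eq_bigr => j _ /=.
have /rowP/(_ j) := zM; rewrite mxE.
have -> : (\det (M w) *: rho w) 0 j = \det (M w) * crd (x - y) j by rewrite !mxE.
move=> zMj; rewrite scalerA -zMj scaler_suml; apply: eq_bigr => i _.
by rewrite scalerA; congr (_ * _ *: _); rewrite mxE.
Qed.

End Deformation.

(** * Gluing isomorphisms, and comparing endomorphism algebras of extensions *)

Section Assembly.
Variables (K : fieldType) (l : 'I_4 -> nat).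
Hypothesis l_gt0 : forall j, (0 < l j)%N.
Implicit Types V W : vectType K.

Lemma isom_ext V (U U' : config V) :
  (forall j i, (i <= l j)%N -> U j i = U' j i) -> isom l U U'.
Proof.
move=> UU'; have [h [h0 hf hU]] := isom_refl l U; exists h; split=> // j i le_il.
by rewrite hU // UU'.
Qed.

Lemma preserves_conj m V W (U : config V) (U' : config W)
    (h : 'Hom(V, W)) (g : 'Hom(W, V)) (f : 'End(V)) : (forall j, (m j <= l j)%N) ->
  mor l U U' h -> mor l U' U g -> preserves m U U f -> preserves m U' U' (h \o f \o g)%VF.
Proof.
move=> le_ml hU gU fU.
have sub (A B : vectType K) X Y (k : 'Hom(A, B)) : mor l X Y k -> preserves m X Y k.
  by move=> kXY j i le_i; apply: kXY; apply: leq_trans le_i (le_ml j).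
exact: (preserves_comp (preserves_comp (sub _ _ _ _ _ hU) fU) (sub _ _ _ _ _ gU)).
Qed.

Lemma rigid_isom V W (U : config V) (U' : config W) :
  isom l U U' -> rigid l U -> rigid l U'.
Proof.
move=> [h /isomorphism_inv[hU gU gh hg]] rU; apply/vspaceP => f; rewrite memvf.
have : (h^-1 \o f \o h)%VF \in (preserver (lenC l) U U + preserver (lenD l) U U)%VS.
  by rewrite rU memvf.
move=> /memv_addP[c /preserverP cU [p /preserverP pU fE]].
have -> : f = (h \o c \o h^-1)%VF + (h \o p \o h^-1)%VF.
  rewrite -comp_lfunDl -comp_lfunDr -fE -!comp_lfunA hg comp_lfun1r.
  by rewrite comp_lfunA hg comp_lfun1l.
apply: memv_add; apply/preserverP.
  by apply: preserves_conj hU gU cU; apply: lenC_le.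
by apply: preserves_conj hU gU pU; apply: lenD_le.
Qed.

(** The sum of the maps i' h c over matched pairs of summands is an isomorphism, its inverse being
    the sum of the maps i h^-1 c'; orthogonality removes the mixed terms. *)
Lemma isom_of_decomp V W (U : config V) (U' : config W) es fs :
  object l U -> object l U' -> decomp l U \1%VF es -> decomp l U' \1%VF fs ->
  size es = size fs ->
  (forall k, (k < size es)%N ->
     isom l (induced U (limg (nth 0 es k))) (induced U' (limg (nth 0 fs k)))) ->
  isom l U U'.
Proof.
move=> oU oU' [ues ses mes ies oes _] [ufs sfs mfs ifs ofs _] eq_size isos.
have /fin_all_exists[ab abP] : forall k : 'I_(size es), exists ab : 'Hom(V, W) * 'Hom(W, V),
    let e := nth 0 es k in let f := nth 0 fs k in
    [/\ mor l U U' ab.1 /\ mor l U' U ab.2, (ab.2 \o ab.1)%VF = e, (ab.1 \o ab.2)%VF = f,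
        (f \o ab.1)%VF = ab.1 /\ (ab.2 \o f)%VF = ab.2 &
        (e \o ab.2)%VF = ab.2 /\ (ab.1 \o e)%VF = ab.1].
  move=> k; set e := nth 0 es k; set f := nth 0 fs k.
  have ees : e \in es by apply: mem_nth.
  have ffs : f \in fs by apply: mem_nth; rewrite -eq_size.
  have [i [c [si cU ciK icE]]] := split_idem oU (mes e ees) (ies e ees).
  have [i' [c' [si' c'U ci'K ic'E]]] := split_idem oU' (mfs f ffs) (ifs f ffs).
  have [h /isomorphism_inv[hU gU gh hg]] := isos k (ltn_ord k).
  exists ((i' \o h \o c)%VF, (i \o h^-1 \o c')%VF) => /=.
  have cK w : c (i w) = w by rewrite -comp_lfunE ciK id_lfunE.
  have c'K w : c' (i' w) = w by rewrite -comp_lfunE ci'K id_lfunE.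
  have icv v : i (c v) = e v by have /lfunP/(_ v) := icE; rewrite comp_lfunE.
  have icv' v : i' (c' v) = f v by have /lfunP/(_ v) := ic'E; rewrite comp_lfunE.
  have ghv v : (h^-1)%VF (h v) = v by rewrite -comp_lfunE gh id_lfunE.
  have hgv v : h ((h^-1)%VF v) = v by rewrite -comp_lfunE hg id_lfunE.
  split.
  - split; first by apply: mor_comp cU; apply: mor_comp hU; apply: strict_mor si'.
    by apply: mor_comp c'U; apply: mor_comp gU; apply: strict_mor si.
  - by apply/lfunP => v; rewrite !comp_lfunE c'K ghv icv.
  - by apply/lfunP => v; rewrite !comp_lfunE cK hgv icv'.
  - by split; apply/lfunP => v; rewrite !comp_lfunE -icv' c'K.
  by split; apply/lfunP => v; rewrite !comp_lfunE -icv cK.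
have neq_f (j k : 'I_(size es)) : j != k -> (nth 0 fs j \o nth 0 fs k)%VF = 0.
  have [ltj ltk] : (j < size fs)%N /\ (k < size fs)%N by rewrite -eq_size.
  by move=> ne_jk; apply: ofs; rewrite ?mem_nth // nth_uniq.
have neq_e (j k : 'I_(size es)) : j != k -> (nth 0 es j \o nth 0 es k)%VF = 0.
  by move=> ne_jk; apply: oes; rewrite ?mem_nth // nth_uniq.
exists (\sum_k (ab k).1).
have sum_comp (A B D : vectType K) (F : 'I_(size es) -> 'Hom(B, D))
    (G : 'I_(size es) -> 'Hom(A, B)) :
    (forall j k, j != k -> (F j \o G k)%VF = 0) ->
    ((\sum_k F k) \o (\sum_k G k))%VF = \sum_k (F k \o G k)%VF.
  move=> FG0; apply/lfunP => v; rewrite comp_lfunE !sum_lfunE.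
  apply: eq_bigr => j _; rewrite linear_sum (bigD1 j) //= big1 ?addr0 => [|k ne_kj].
    by rewrite comp_lfunE.
  by rewrite -comp_lfunE FG0 ?zero_lfunE // eq_sym.
apply: (@isomorphism_of_inverses _ _ _ _ _ _ _ (\sum_k (ab k).2)).
- by apply: mor_sum => k _; have [[]] := abP k.
- by apply: mor_sum => k _; have [[]] := abP k.
- rewrite sum_comp => [|j k ne_jk].
    by rewrite -ses (big_nth 0) big_mkord; apply: eq_bigr => k _; have [] := abP k.
  have [_ _ _ [_ <-] _] := abP j; have [_ _ _ [<- _] _] := abP k.
  by rewrite -comp_lfunA (comp_lfunA (nth 0 fs j)) neq_f // comp_lfun0l comp_lfun0r.
rewrite sum_comp => [|j k ne_jk].
  rewrite -sfs (big_nth 0) big_mkord -eq_size.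
  by apply: eq_bigr => k _; have [] := abP k.
have [_ _ _ _ [_ <-]] := abP j; have [_ _ _ _ [<- _]] := abP k.
by rewrite -comp_lfunA (comp_lfunA (nth 0 es j)) neq_e // comp_lfun0l comp_lfun0r.
Qed.

(* Block triangular computation with respect to e and d = 1 - e; the identity of the
   block e shows that the inclusion of the diagonal parts is proper. *)
Lemma corner_dim V (C P E' : {vspace 'End(V)}) (e u : 'End(V)) :
  (forall x y, x \in C -> y \in C -> (x \o y)%VF \in C) ->
  (forall x y, x \in P -> y \in P -> (x \o y)%VF \in P) ->
  \1%VF \in C -> \1%VF \in P -> e \in C -> e \in P -> (e \o e)%VF = e ->
  (u \o e)%VF = u -> (e \o u)%VF = 0 -> u \notin (C + P)%VS ->
  (forall x, x \in E' -> x \in C /\ ((\1 - u) \o x \o (\1 + u))%VF \in P) ->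
  (\dim E' < \dim (C :&: P))%N.
Proof.
move=> CM PM C1 P1 eC eP ee ue eu uCP E'P.
have [d dE] : exists d : 'End(V), d = \1%VF - e by exists (\1%VF - e).
have dC : d \in C by rewrite dE memvB.
have dP : d \in P by rewrite dE memvB.
have ed : (e \o d)%VF = 0 by rewrite dE comp_lfunDr comp_lfunNr comp_lfun1r ee subrr.
have de : (d \o e)%VF = 0 by rewrite dE comp_lfunDl comp_lfunNl comp_lfun1l ee subrr.
have dd : (d \o d)%VF = d by rewrite {2}dE comp_lfunDr comp_lfunNr comp_lfun1r de subr0.
have ud : (u \o d)%VF = 0 by rewrite dE comp_lfunDr comp_lfunNr comp_lfun1r ue subrr.
have du : (d \o u)%VF = u by rewrite dE comp_lfunDl comp_lfunNl comp_lfun1l eu subr0.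
pose phi (x : 'End(V)) := (e \o x \o d)%VF.
pose psi (x : 'End(V)) := ((e \o x \o e) + (d \o x \o d))%VF.
have phi_lin : linear phi.
  by move=> a x y; rewrite /phi comp_lfunDr comp_lfunDl -comp_lfunZr -comp_lfunZl.
have psi_lin : linear psi.
  move=> a x y; rewrite /psi !comp_lfunDr !comp_lfunDl -!comp_lfunZr -!comp_lfunZl.
  by rewrite scalerDr addrACA.
have [Phi PhiE] : exists Phi : 'Hom('End(V), 'End(V)), Phi =1 phi.
  by exists (linfun phi); apply: linfun_linear.
have [Psi PsiE] : exists Psi : 'Hom('End(V), 'End(V)), Psi =1 psi.
  by exists (linfun psi); apply: linfun_linear.
have memE x : (x \in C) -> (x \in P) -> x \in (C :&: P)%VS by move=> xC xP; rewrite memv_cap xC.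
(* Since e u = 0 and u d = 0, conjugation by 1 + u does not change the corner e x d. *)
have le_phi : (Phi @: E' <= Phi @: (C :&: P))%VS.
  apply/subvP => _ /memv_imgP[x xE' ->]; have [xC yP] := E'P x xE'.
  apply/memv_imgP; exists (phi x); last first.
    by rewrite !PhiE /phi !comp_lfunA ee -!comp_lfunA dd.
  apply: memE; first by rewrite !CM.
  suff -> : phi x = (e \o ((\1 - u) \o x \o (\1 + u)) \o d)%VF by exact: (PM _ _ (PM _ _ eP yP) dP).
  rewrite /phi !comp_lfunA (comp_lfunDr e) comp_lfunNr comp_lfun1r eu subr0.
  by rewrite -!comp_lfunA comp_lfunDl comp_lfun1l ud addr0.
pose E1 := (C :&: P :&: lker Phi)%VS; pose E1' := (E' :&: lker Phi)%VS.
have exd x : x \in lker Phi -> (e \o x \o d)%VF = 0 by rewrite memv_ker PhiE => /eqP.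
have mid (x : 'End(V)) : ((\1 - u) \o x \o (\1 + u))%VF =
    x + (x \o u)%VF - ((u \o x)%VF + (u \o x \o u)%VF).
  rewrite comp_lfunDr comp_lfun1r !comp_lfunDl !comp_lfunNl !comp_lfun1l.
  by rewrite addrACA opprD.
have exu x : x \in lker Phi -> (e \o x \o u)%VF = 0.
  by move=> /exd xk; rewrite -du !comp_lfunA xk comp_lfun0l.
have uxd x : x \in lker Phi -> (u \o x \o d)%VF = 0.
  by move=> /exd xk; rewrite -ue -!comp_lfunA (comp_lfunA e) xk comp_lfun0r.
have uxu x : x \in lker Phi -> (u \o x \o u)%VF = 0.
  by move=> /uxd xk; rewrite -[X in (_ \o X)%VF]du !comp_lfunA xk comp_lfun0l.
(* Once e x d = 0, conjugation by 1 + u leaves both diagonal blocks unchanged as well. *)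
have psiP x : x \in E1' -> psi x \in E1.
  move=> /memv_capP[xE' xk]; have [xC yP] := E'P x xE'; rewrite memv_cap; apply/andP; split.
    apply: memE; first by rewrite memvD // !CM.
    apply: memvD.
      suff -> : (e \o x \o e)%VF = (e \o ((\1 - u) \o x \o (\1 + u)) \o e)%VF
        by exact: (PM _ _ (PM _ _ eP yP) eP).
      rewrite mid !comp_lfunDr !comp_lfunDl !comp_lfunNr !comp_lfunNl !comp_lfunDr !comp_lfunDl.
      by rewrite !comp_lfunA eu !comp_lfun0l exu // comp_lfun0l !addr0 subr0.
    suff -> : (d \o x \o d)%VF = (d \o ((\1 - u) \o x \o (\1 + u)) \o d)%VF
      by exact: (PM _ _ (PM _ _ dP yP) dP).
    rewrite mid !comp_lfunDr !comp_lfunDl !comp_lfunNr !comp_lfunNl !comp_lfunDr !comp_lfunDl.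
    rewrite !comp_lfunA du -!comp_lfunA ud !comp_lfun0r !(comp_lfunA u) uxd //.
    by rewrite !addr0 subr0.
  rewrite memv_ker PhiE /phi /psi comp_lfunDr comp_lfunDl !comp_lfunA ed !comp_lfun0l addr0.
  by rewrite -!comp_lfunA ed !comp_lfun0r.
have psi_id x : psi (psi x) = psi x.
  rewrite /psi !comp_lfunDr !comp_lfunDl !comp_lfunA ee dd de ed !comp_lfun0l addr0 add0r.
  by rewrite -!comp_lfunA ee dd.
have le_psi : (Psi @: E1' <= Psi @: E1)%VS.
  apply/subvP => _ /memv_imgP[x xE ->]; rewrite PsiE -psi_id -PsiE memv_img //.
  exact: psiP.
have eE1 : e \in (Psi @: E1)%VS.
  have psie : psi e = e by rewrite /psi ee ee de comp_lfun0l addr0.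
  rewrite -[in X in X \in _]psie -PsiE memv_img // memv_cap memE //=.
  by rewrite memv_ker PhiE /phi ee ed.
(* If x in E1' has diagonal part e, with conjugate y in P, then d y e = d x e - u; so u = d x e - d
   y e would lie in C + P. *)
have eE1' : e \notin (Psi @: E1')%VS.
  apply: contra uCP => /memv_imgP[x /[dup] xE1' /memv_capP[xE' xk]].
  rewrite PsiE => psix; have [xC yP] := E'P x xE'.
  have exe : (e \o x \o e)%VF = e.
    have := congr1 (fun z => e \o z \o e)%VF psix.
    rewrite /psi comp_lfunDr comp_lfunDl !comp_lfunA ed !comp_lfun0l addr0 ee ee.
    by rewrite -!comp_lfunA ee.
  have dxd : (d \o x \o d)%VF = 0.
    have := congr1 (fun z => d \o z \o d)%VF psix.
    rewrite /psi comp_lfunDr comp_lfunDl !comp_lfunA de !comp_lfun0l add0r dd.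
    by rewrite -!comp_lfunA dd !comp_lfunA.
  have dye : (d \o ((\1 - u) \o x \o (\1 + u)) \o e)%VF = (d \o x \o e)%VF - u.
    rewrite mid !comp_lfunDr !comp_lfunDl !comp_lfunNr !comp_lfunNl !comp_lfunDr !comp_lfunDl.
    rewrite !comp_lfunA du uxu // !comp_lfun0l addr0; congr (_ - _).
      have -> : (d \o x \o u)%VF = 0 by rewrite -du !comp_lfunA dxd comp_lfun0l.
      by rewrite comp_lfun0l addr0.
    by rewrite -ue -!comp_lfunA (comp_lfunA e) exe -ue -!comp_lfunA ee.
  have -> : u = (d \o x \o e)%VF - (d \o ((\1 - u) \o x \o (\1 + u)) \o e)%VF.
    by rewrite dye subKr.
  by apply: memv_add; [rewrite !CM | rewrite memvN; exact: (PM _ _ (PM _ _ dP yP) eP)].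
have lt_psi : (\dim (Psi @: E1') < \dim (Psi @: E1))%N.
  rewrite ltn_neqAle dimvS // andbT (dimv_leqif_eq le_psi).
  by apply: contra eE1' => /eqP->.
(* If the diagonal blocks vanish too, then x = d x e, which is fixed by the conjugation and hence
   lies in P. *)
have le_ker : (E1' :&: lker Psi <= E1 :&: lker Psi)%VS.
  apply/subvP => x /memv_capP[/[dup] xE1' /memv_capP[xE' xk] xkk].
  have [xC yP] := E'P x xE'; rewrite memv_cap xkk andbT memv_cap xk andbT memE //.
  have psi0 : psi x = 0 by move: xkk; rewrite memv_ker PsiE => /eqP.
  have exe : (e \o x \o e)%VF = 0.
    have := congr1 (fun z => e \o z \o e)%VF psi0.
    rewrite /psi comp_lfunDr comp_lfunDl !comp_lfunA ed !comp_lfun0l addr0 ee.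
    rewrite comp_lfun0r comp_lfun0l.
    by rewrite -!comp_lfunA ee.
  have dxd : (d \o x \o d)%VF = 0.
    have := congr1 (fun z => d \o z \o d)%VF psi0.
    rewrite /psi comp_lfunDr comp_lfunDl !comp_lfunA de !comp_lfun0l add0r dd.
    rewrite comp_lfun0r comp_lfun0l.
    by rewrite -!comp_lfunA dd !comp_lfunA.
  have xE : x = (d \o x \o e)%VF.
    have one : \1%VF = e + d by rewrite dE addrC subrK.
    rewrite -[in LHS](comp_lfun1l x) -[in LHS](comp_lfun1r (\1 \o x)%VF) one.
    by rewrite !comp_lfunDl !comp_lfunDr exe dxd exd // !addr0 add0r.
  have xu : (x \o u)%VF = 0 by rewrite xE -(comp_lfunA _ e u) eu comp_lfun0r.
  have ux : (u \o x)%VF = 0 by rewrite xE !comp_lfunA ud !comp_lfun0l.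
  by move: yP; rewrite mid xu ux comp_lfun0l !addr0 subr0.
(* Rank-nullity for Phi and then for Psi compares the two algebras corner by corner; the diagonal
   contributes the strict inequality. *)
rewrite -(limg_ker_dim Phi E') -(limg_ker_dim Phi (C :&: P)) -/E1 -/E1'.
rewrite -(limg_ker_dim Psi E1') -(limg_ker_dim Psi E1) -addSn -addnS.
exact: leq_add (leq_add (dimvS le_ker) lt_psi) (dimvS le_phi).
Qed.

End Assembly.

(** * Uniqueness and existence of rigid configurations *)

Section RigidConfigurations.
Variables (K : closedFieldType) (l : 'I_4 -> nat).
Hypothesis l_gt0 : forall j, (0 < l j)%N.
Implicit Types V W : vectType K.

Lemma lker_id V : lker (\1%VF : 'End(V)) = 0%VS.
Proof. by apply/eqP/lker0P => x y; rewrite !id_lfunE. Qed.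

(** U' can be replaced by U'' = act2 1 k U on the same space. The configuration act2 1 y U is
    isomorphic to U for y outside a hypersurface missing 1, and to U'' for y outside one missing k;
    a point of the line through 1 and k avoids both. *)
Lemma rigid_unique V W (U : config V) (U' : config W) :
  object l U -> object l U' -> dimq l U = dimq l U' -> rigid l U -> rigid l U' -> isom l U U'.
Proof.
move=> oU oU' eqUU' rU rU'.
have [h [g [h0 g0 hf gf hgU]]] := act2_transitive l_gt0 oU oU' eqUU'.
pose k : 'End(V) := (h^-1 \o g)%VF.
have hhV w : h ((h^-1)%VF w) = w by rewrite limg_lfunVK // hf memvf.
have k0 : lker k = 0%VS.
  apply/eqP; rewrite -subv0; apply/subvP => v; rewrite memv_ker comp_lfunE memv0 => /eqP kv0.
  by rewrite -memv0 -g0 memv_ker -[g v]hhV kv0 linear0.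
have [/eqP k0' /eqP h0'] := (k0, h0).
pose U'' := act2 \1%VF k U.
have isoU'' : isom l U'' U'.
  exists h; split=> // j i le_il; rewrite -hgU // /U'' /act2.
  case: ifP => _; rewrite ?lim1g // -limg_comp; congr (_ @: _)%VS.
  by apply/lfunP => v; rewrite !comp_lfunE hhV.
have rU'' : rigid l U'' by apply: rigid_isom rU'; apply: isom_sym.
have oU'' : object l U'' by apply: act2_object => //; apply: lker_id.
have [phi [phiP phi1 phiU]] := rigid_deformation rU.
have [psi [psiP psi1 psiU]] := rigid_deformation rU''.
have [|t tP] := @polyfun_line_common K 'End(V) [:: fun y => phi (\1%VF, y);
    fun y => psi (\1%VF, (y \o k^-1)%VF); @dete K V] \1%VF k.
  move=> _ [<-|[<-|[<-|[]]]]; split.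
  - apply: (polyfun_comp (F := fun y : 'End(V) => (\1%VF : 'End(V), y))) phiP.
    exact: polymap_pair (polymap_const _ _) (@polymap_id _ _).
  - by left.
  - apply: (polyfun_comp (F := fun y : 'End(V) => (\1%VF : 'End(V), (y \o k^-1)%VF))) psiP.
    apply: polymap_pair (polymap_const _ _) _.
    exact: polymap_comp_lfun (@polymap_id _ _) (polymap_const _ _).
  - by right; rewrite lker0_compfV.
  - exact: polyfun_dete.
  by left; apply: dete1.
move: (((1 - t) *: \1%VF + t *: k) : 'End(V)) tP => y tP.
have phi_y := tP _ (or_introl (erefl _)).
have psi_y := tP _ (or_intror (or_introl (erefl _))).
have /= := tP _ (or_intror (or_intror (or_introl (erefl _)))).
rewrite dete_neq0 => /eqP y0.
have [c [p [cU pU c0 p0 cp]]] := phiU _ _ phi_y.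
have [c' [p' [c'U p'U c'0 p'0 cp']]] := psiU _ _ psi_y.
have isoU : isom l U (act2 \1%VF y U).
  exists (\1 \o c)%VF; apply: act2_isom_of cp => //; exact: lker_id.
have yk0 : lker (y \o k^-1)%VF = 0%VS.
  apply: lker0_comp => //; apply/eqP/lker0P => v w /(congr1 k).
  by rewrite !lker0_lfunVK.
have iso2 : isom l U'' (act2 \1%VF (y \o k^-1)%VF U'').
  exists (\1 \o c')%VF; apply: act2_isom_of cp' => //; exact: lker_id.
apply: (isom_trans _ isoU'').
apply: (isom_trans isoU); apply: (isom_trans _ (isom_sym iso2)).
apply: isom_ext => j i le_il; rewrite act2_comp comp_lfun1l.
by rewrite -comp_lfunA lker0_compVf // comp_lfun1r.
Qed.

(** Endomorphisms of a rigid summand have no obstruction class in U either: conjugate their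
    decomposition by the inclusion and the projection. *)
Lemma rigid_corner V (U : config V) (e f : 'End(V)) :
  object l U -> mor l U U e -> (e \o e)%VF = e -> rigid l (induced U (limg e)) ->
  (e \o f \o e)%VF \in (preserver (lenC l) U U + preserver (lenD l) U U)%VS.
Proof.
move=> oU eU ee rE; have [i [c [si cU ciK icE]]] := split_idem oU eU ee.
have := memvf (c \o f \o i)%VF; rewrite -rE => /memv_addP[x /preserverP xU [y /preserverP yU xy]].
have icv v : i (c v) = e v by have /lfunP/(_ v) := icE; rewrite comp_lfunE.
have -> : (e \o f \o e)%VF = (i \o x \o c)%VF + (i \o y \o c)%VF.
  rewrite -comp_lfunDl -comp_lfunDr -xy; apply/lfunP => v.
  by rewrite !comp_lfunE !icv.
apply: memv_add; apply/preserverP.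
  by apply: preserves_conj (strict_mor si) cU xU; apply: lenC_le.
by apply: preserves_conj (strict_mor si) cU yU; apply: lenD_le.
Qed.

Lemma summand_of_idem V (U : config V) (e : 'End(V)) :
  object l U -> mor l U U e -> (e \o e)%VF = e -> summand (summand_dim l U e) (dimq l U).
Proof.
move=> oU eU ee; have oE := induced_object oU (good_idem oU eU).
exact: (summand_strict oU oE (strict_vsval l U (limg e))).
Qed.

Lemma decomp_bricks V (U : config V) es :
  object l U -> finiteness_condition (dimq l U) -> decomp l U \1%VF es ->
  forall e, e \in es -> [/\ object l (induced U (limg e)), brick l (induced U (limg e)),
    rigid l (induced U (limg e)), tits (summand_dim l U e) = 1 & in_Lambda (summand_dim l U e)].
Proof.
move=> oU finU [_ _ mes ies _ indes] e ees.
have oE := induced_object oU (good_idem oU (mes e ees)).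
have sE := summand_of_idem oU (mes e ees) (ies e ees).
have [bE rE tE] := indec_brick l_gt0 oE (indes e ees) (finiteness_summand sE finU).
by split=> //; apply: object_Lambda oE _; have [] := indes e ees.
Qed.

(* Among the configurations with the given dimension vector, one with the smallest
   endomorphism algebra is rigid: a class in Ext between two of its summands would give
   a non-split extension with fewer endomorphisms. *)
Lemma exists_rigid V (U0 : config V) :
  object l U0 -> finiteness_condition (dimq l U0) -> tits (dimq l U0) = 1 ->
  exists U : config V,
    [/\ object l U, dimq l U = dimq l U0, rigid l U & brick l U].
Proof.
move=> oU0 fin0 tits1.
pose P n := exists U : config V, [/\ object l U, dimq l U = dimq l U0 &
  \dim (preserver l U U) = n].
have [|n [U [oU dU dimE]] nmin] := @ex_least P; first by exists (\dim (preserver l U0 U0)), U0.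
have finU : finiteness_condition (dimq l U) by rewrite dU.
have rU : rigid l U.
  apply/eqP; rewrite eqEsubv subvf /=; apply/negPn/negP => /subvPn[u0 _ u0CP].
  have [es des] := exists_decomp oU; have [ues ses mes ies oes indes] := des.
  have : exists e f, [/\ e \in es, f \in es & (f \o u0 \o e)%VF \notin
      (preserver (lenC l) U U + preserver (lenD l) U U)%VS].
    apply: NNPP => allCP; case/negP: u0CP.
    have -> : u0 = \sum_(f <- es) \sum_(e <- es) (f \o u0 \o e)%VF.
      rewrite -[LHS]comp_lfun1l -[LHS]comp_lfun1r -[in LHS]ses.
      apply/lfunP => v; rewrite comp_lfunE !sum_lfunE linear_sum.
      under [RHS]eq_bigr => f _ do rewrite sum_lfunE.
      rewrite exchange_big; apply: eq_bigr => e _ /=.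
      by rewrite comp_lfunE sum_lfunE; apply: eq_bigr => f _; rewrite !comp_lfunE.
    rewrite big_seq memv_suml // => f ffs; rewrite big_seq memv_suml // => e ees.
    by apply/negPn/negP => fu0e; apply: allCP; exists e, f.
  move=> [e [f [ees ffs fu0e]]].
  (* The summands are bricks, hence rigid, and contribute nothing on the diagonal. *)
  have ne_ef : e != f.
    apply: contra fu0e => /eqP <-; have [oE _ rE _ _] := decomp_bricks oU finU des ees.
    exact: (rigid_corner _ oU (mes e ees) (ies e ees) rE).
  pose u := (f \o u0 \o e)%VF.
  have ue : (u \o e)%VF = u by rewrite /u -comp_lfunA ies.
  have eu : (e \o u)%VF = 0 by rewrite /u !comp_lfunA oes // !comp_lfun0l.
  (* Being square zero, u gives the automorphism 1 + u with inverse 1 - u. Moving only the flag in V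
     by it yields the extension of class u. *)
  have uu : (u \o u)%VF = 0 by rewrite -[in X in (X \o _)%VF]ue -comp_lfunA eu comp_lfun0r.
  pose g := (\1 + u)%VF; pose gV := (\1 - u)%VF.
  have gVg : (gV \o g)%VF = \1%VF.
    by rewrite comp_lfunDl comp_lfunNl !comp_lfunDr !comp_lfun1r !comp_lfun1l uu addr0 addrK.
  have g0 : lker g = 0%VS.
    apply/eqP/lker0P => x y /(congr1 gV); rewrite -!comp_lfunE gVg.
    by rewrite !id_lfunE.
  pose U' := act2 \1%VF g U.
  have oU' : object l U' by apply: act2_object => //; apply: lker_id.
  have dU' : dimq l U' = dimq l U0 by rewrite act2_dimq // lker_id.
  have le_n := nmin _ (ex_intro _ U' (And3 oU' dU' (erefl _))).
  move: le_n; rewrite leqNgt => /negP[]; rewrite -dimE (mor_preserver l_gt0 oU oU).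
  apply: (@corner_dim _ _ _ _ _ e u) => //.
  - by move=> x y /preserverP xC /preserverP yC; apply/preserverP; apply: preserves_comp xC yC.
  - by move=> x y /preserverP xC /preserverP yC; apply/preserverP; apply: preserves_comp xC yC.
  - by apply/preserverP; apply: preserves_id.
  - by apply/preserverP; apply: preserves_id.
  - by apply/preserverP; have [] := (morE l_gt0 _ oU oU).1 (mes e ees).
  - by apply/preserverP; have [] := (morE l_gt0 _ oU oU).1 (mes e ees).
  - exact: ies.
  move=> x; rewrite (mor_preserver l_gt0 oU' oU') => /memv_capP[/preserverP xC /preserverP xD].
  split; apply/preserverP => j i le_i.
    have := xC j i le_i; rewrite /U' /act2; case: eqP => [jD|_]; last by rewrite lim1g.
    move: le_i; rewrite /lenC jD leqn0 => /eqP-> _.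
    by have [-> _ _ _ _] := oU; rewrite limg0.
  have [jD|ne_jD] := eqVneq j armD; last first.
    move: le_i; rewrite /lenD (negPf ne_jD) leqn0 => /eqP->.
    by have [-> _ _ _ _] := oU; rewrite limg0.
  have := xD j i le_i; rewrite /U' /act2 jD eqxx -limg_comp => /(limgS gV).
  by rewrite -!limg_comp gVg lim1g comp_lfunA.
exists U; split=> // f fU.
have V_gt0 : (0 < \dim {: V})%N.
  rewrite lt0n; apply/eqP => V0; move: tits1.
  rewrite -dU tits_dimq // V0 natrX expr0n subr0.
  have dim0 (S : {vspace 'End(V)}) : \dim S = 0%N.
    by apply/eqP; rewrite -leqn0; apply: leq_trans (dimvS (subvf S)) _; rewrite dim_hom V0.
  by rewrite !dim0 addr0 => /eqP; rewrite eq_sym oner_eq0.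
(* As Ext^1 vanishes, the form is the dimension of the endomorphism algebra; the value 1 leaves only
   the scalars. *)
have dim1 : \dim (preserver l U U) = 1%N.
  rewrite mor_preserver //; have := dimv_sum_cap (preserver (lenC l) U U) (preserver (lenD l) U U).
  rewrite rU dim_hom mulnn => dimE'.
  have := tits1; rewrite -dU tits_dimq // -natrD -dimE' natrD addrAC subrr add0r.
  by move=> /eqP; rewrite pnatr_eq1 => /eqP.
have /eqP E : <[\1%VF]>%VS == preserver l U U.
  rewrite eqEdim dim1 dim_vline id_lfun_neq0 // andbT.
  by apply/preserverP; apply: mor_id.
by move/preserverP: fU; rewrite -E => /vlineP.
Qed.

End RigidConfigurations.

(** * Dimension count for finitely many orbits *)

Section AlgebraicDependence.

Lemma digits_lt D n (a : nat -> nat) : (forall i, (i < n)%N -> (a i < D)%N) ->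
  (\sum_(i < n) a i * D ^ i < D ^ n)%N.
Proof.
elim: n => [|n IHn] aD; first by rewrite big_ord0 expn0.
rewrite big_ord_recr /= expnS.
have lt1 := IHn (fun i lt_in => aD i (leqW lt_in)); have lt2 := aD n (ltnSn n).
by move: (D ^ n)%N (\sum_(i < n) _)%N lt1 => x s lt1; nia.
Qed.

Lemma digits_inj D n (a b : nat -> nat) :
  (forall i, (i < n)%N -> (a i < D)%N) -> (forall i, (i < n)%N -> (b i < D)%N) ->
  (\sum_(i < n) a i * D ^ i = \sum_(i < n) b i * D ^ i)%N ->
  forall i, (i < n)%N -> a i = b i.
Proof.
elim: n => [//|n IHn] aD bD; rewrite !big_ord_recr /=.
have {}IHn := IHn (fun i lt_in => aD i (leqW lt_in)) (fun i lt_in => bD i (leqW lt_in)).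
have lta := digits_lt (fun i lt_in => aD i (leqW lt_in)).
have ltb := digits_lt (fun i lt_in => bD i (leqW lt_in)).
move=> eq_ab i; rewrite ltnS leq_eqVlt.
have D_gt0 := leq_ltn_trans (leq0n _) lta.
have eq_n : a n = b n.
  have := congr1 (divn^~ (D ^ n)%N) eq_ab.
  by rewrite !(addnC (\sum_(i < n) _)%N) !divnMDl // !divn_small // !addn0.
case/predU1P=> [-> //|lt_in]; apply: IHn => //.
by move: eq_ab; rewrite eq_n => /addIn.
Qed.

(** Kronecker substitution X_i = t^(D^i): since D exceeds every exponent of p, distinct monomials
    have distinct base-D expansions and nothing cancels, leaving a nonzero polynomial in t. *)
Lemma mpoly_nonvanishing (K : closedFieldType) n (p : {mpoly K[n]}) :
  p != 0 -> exists v, p.@[v] != 0.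
Proof.
move=> p_neq0; pose D := msize p.
pose k (m : 'X_{1..n}) := (\sum_(i < n) m i * D ^ i)%N.
have lt_mD m i : m \in msupp p -> (m i < D)%N.
  by move=> /msize_mdeg_lt; apply: leq_ltn_trans; rewrite mdegE (bigD1 i) //= leq_addr.
have k_inj m m' : m \in msupp p -> m' \in msupp p -> k m = k m' -> m = m'.
  move=> mp m'p; pose ext (q : 'X_{1..n}) i := if insub i is Some j then q j else 0%N.
  have extE q (i : 'I_n) : ext q i = q i by rewrite /ext valK.
  have ext_lt q i : q \in msupp p -> (i < n)%N -> (ext q i < D)%N.
    by move=> qp lt_in; rewrite (extE q (Ordinal lt_in)) lt_mD.
  rewrite /k; under eq_bigr => i _ do rewrite -extE.
  under [RHS]eq_bigr => i _ do rewrite -extE.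
  move=> /(digits_inj (fun i => ext_lt m i mp) (fun i => ext_lt m' i m'p)) eq_ext.
  by apply/mnmP => i; rewrite -!extE eq_ext.
pose q : {poly K} := \sum_(m <- msupp p) p@_m *: 'X^(k m).
have q_neq0 : q != 0.
  have [m mp] : exists m, m \in msupp p.
    by case E: (msupp p) p_neq0 => [|m s]; [rewrite -msupp_eq0 E | exists m; rewrite mem_head].
  apply/eqP => /polyP/(_ (k m)); rewrite coef0 coef_sum (bigD1_seq m) ?msupp_uniq //=.
  rewrite coefZ coefXn eqxx mulr1 big_seq_cond big1 ?addr0 => [/eqP|m' /andP[m'p ne]].
    by rewrite mcoeff_eq0 mp.
  rewrite coefZ coefXn; case: eqP => [/esym/k_inj E|_]; last by rewrite mulr0.
  by rewrite E ?eqxx // in ne.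
have /closed_nonrootP[t qt] := q_neq0; exists (fun i : 'I_n => t ^+ (D ^ i)).
suff -> : p.@[fun i : 'I_n => t ^+ (D ^ i)] = q.[t] by [].
rewrite mevalE horner_sum; apply: eq_bigr => m _; rewrite hornerZ hornerXn; congr (_ * _).
rewrite /k expr_sum; apply: eq_bigr => i _.
by rewrite -exprM mulnC.
Qed.

Lemma msize_prod (K : fieldType) n q (F : 'I_q -> {mpoly K[n]}) e :
  (forall i, (msize (F i) <= e)%N) -> (msize (\prod_i F i) <= q * e.+1 + 1)%N.
Proof.
elim: q F => [|q IHq] F Fe; first by rewrite big_ord0 msize1.
rewrite big_ord_recl; apply: leq_trans (msizeM_le _ _) _; rewrite mulSn.
by rewrite -addSn -addnA leq_add ?ltnS // IHq.
Qed.

Lemma card_bmultinom m N : (#|{: 'X_{1..m < N}}| <= N ^ m)%N.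
Proof.
rewrite -[X in (_ <= _ ^ X)%N](card_ord m) -[X in (_ <= X ^ _)%N](card_ord N) -card_ffun.
have lt_N (b : 'X_{1..m < N}) i : (b i < N)%N.
  by apply: leq_ltn_trans (bmdeg b); rewrite mdegE (bigD1 i) //= leq_addr.
pose f (b : 'X_{1..m < N}) : {ffun 'I_m -> 'I_N} := [ffun i => Ordinal (lt_N b i)].
apply: (@leq_card _ _ f) => b b' /ffunP eq_bb'; apply/val_inj/mnmP => i.
by have := eq_bb' i; rewrite !ffunE => /(congr1 val).
Qed.

(* Counting: the D^r monomials of degree < D in each of the y_k lie in a space of
   polynomials in m variables whose dimension is O(D^m). *)
Lemma algebraic_dependence (K : fieldType) m r (y : 'I_r -> {mpoly K[m]}) : (m < r)%N ->
  exists2 P : {mpoly K[r]}, P != 0 & forall v, P.@[fun k => (y k).@[v]] = 0.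
Proof.
move=> lt_mr; pose e := \max_k msize (y k).
(* N bounds the size of a product of powers y_k^(a_k) with a_k < D, and N <= G D. The choice of D
   gives (G D)^m = G^m D^m < D^(m+1) <= D^r: more products than monomials. *)
pose G := (r * (e + 3) + 1)%N; pose D := (G ^ m).+1.
pose N := (r * (D * e.+1 + 2) + 1)%N.
pose A := {ffun 'I_r -> 'I_D}.
pose pa (a : A) := \prod_k y k ^+ a k.
have pa_size a : (msize (pa a) <= N)%N.
  apply: leq_trans (msize_prod (e := (D * e.+1 + 1)%N) _) _ => [k|].
    rewrite -[X in _ ^+ X]card_ord -prodr_const.
    apply: leq_trans (msize_prod (e := e) _) _ => [_|]; first exact: leq_bigmax.
    by rewrite leq_add2r leq_mul2r ltnW ?orbT.
  by rewrite /N leq_add2r leq_mul2l addn1 addn2 leqnn orbT.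
have card_lt : (#|{: 'X_{1..m < N}}| < #|{: A}|)%N.
  rewrite card_ffun !card_ord; apply: leq_ltn_trans (card_bmultinom m N) _.
  have NGD : (N <= G * D)%N by rewrite /N /G; have : (0 < D)%N by []; move: (D) => d; nia.
  have [->|m_gt0] := posnP m.
    by rewrite expn0 /D; have : (0 < r)%N by [apply: leq_ltn_trans lt_mr];
      case: (r) => // q _; rewrite -{1}(exp1n q.+1) ltn_exp2r // ltnS expn_gt0 /G addn1.
  apply: (@leq_ltn_trans ((G * D) ^ m)); first by rewrite leq_exp2r.
  rewrite expnMn; apply: (@leq_trans (D ^ m.+1)); last by rewrite leq_pexp2l.
  by rewrite expnS ltn_pmul2r ?expn_gt0.
(* Rows are products, columns are monomials. With more rows than columns there is a linear relation
   among the products, whose coefficients form P. *)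
pose Mx := \matrix_(i < #|{: A}|, j < #|{: 'X_{1..m < N}}|) (pa (enum_val i))@_(enum_val j).
have ker_neq0 : kermx Mx != 0.
  rewrite -mxrank_eq0 mxrank_ker subn_eq0 -ltnNge.
  by apply: leq_ltn_trans (rank_leq_col _) card_lt.
have /rowV0Pn[c /sub_kermxP cM c_neq0] := ker_neq0.
have [i0 ci0] : exists i, c 0 i != 0.
  apply/existsP; apply: contraR c_neq0; rewrite negb_exists => /forallP c0.
  by apply/eqP/rowP => i; rewrite mxE; apply/eqP; rewrite -[_ == _]negbK c0.
pose mon (a : A) : 'X_{1..r} := [multinom (a k : nat) | k < r].
have mon_inj : injective mon.
  move=> a b eq_ab; apply/ffunP => k; apply: val_inj => /=.
  by have := congr1 (fun q : 'X_{1..r} => q k) eq_ab; rewrite !mnmE.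
exists (\sum_i c 0 i *: 'X_[mon (enum_val i)]).
  apply: contra ci0 => /eqP/mpolyP/(_ (mon (enum_val i0))).
  rewrite mcoeff0 linear_sum (bigD1 i0) //= big1 => [|i ne_i].
    by rewrite mcoeffZ mcoeffX eqxx mulr1 addr0 => ->.
  rewrite mcoeffZ mcoeffX; case: eqP => [/mon_inj/enum_val_inj E|_]; last by rewrite mulr0.
  by rewrite E eqxx in ne_i.
have sum0 : \sum_i c 0 i *: pa (enum_val i) = 0.
  apply/mpolyP => q; rewrite mcoeff0; have [lt_q|le_q] := ltnP (mdeg q) N.
    have /rowP/(_ (enum_rank (BMultinom lt_q))) := cM; rewrite !mxE => cMq.
    rewrite linear_sum -[RHS]cMq; apply: eq_bigr => i _.
    by rewrite /= mcoeffZ mxE enum_rankK.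
  rewrite linear_sum big1 // => i _; rewrite /= mcoeffZ memN_msupp_eq0 ?mulr0 //.
  by apply: msize_mdeg_ge; apply: leq_trans le_q.
move=> v; rewrite -(meval0 v) -sum0 !rmorph_sum; apply: eq_bigr => i _.
rewrite /= !mevalZ mevalX /pa rmorph_prod; congr (_ * _); apply: eq_bigr => k _.
by rewrite rmorphXn /= mnmE.
Qed.

End AlgebraicDependence.

(** * Covering pairs of automorphisms by finitely many parametrized families *)

Section Covering.
Variables (K : closedFieldType) (l : 'I_4 -> nat).
Hypothesis l_gt0 : forall j, (0 < l j)%N.
Implicit Types V W X : vectType K.

(** A polynomial map from a space of smaller dimension is not dominant: its coordinates satisfy a
    nontrivial relation, and a nonzero polynomial takes a nonzero value. *)
Lemma polymap_dominated W X (F : X -> W) : (\dim {: X} < \dim {: W})%N -> polymap F ->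
  exists psi : W -> K, [/\ polyfun psi, exists x, psi x != 0 & forall z, psi (F z) = 0].
Proof.
move=> lt_XW /fin_all_exists[y yP].
have [P P_neq0 P0] := algebraic_dependence y lt_XW.
have [v Pv] := mpoly_nonvanishing P_neq0.
exists (fun x => P.@[crd x]); split; first by exists P.
  exists (\sum_i v i *: (vbasis {: W})`_i).
  rewrite (_ : P.@[_] = P.@[v]) //; apply: meval_eq => i.
  by rewrite /crd coord_sum_free // (basis_free (vbasisP _)).
by move=> z; rewrite -[RHS](P0 (crd z)); apply: meval_eq => i; rewrite yP.
Qed.

Lemma polyfun_all_common W (I : finType) (F : I -> W -> K) :
  (forall i, polyfun (F i) /\ exists x, F i x != 0) -> exists x, forall i, F i x != 0.
Proof.
move=> FP; suff [x xP] : exists x, forall i, i \in enum I -> F i x != 0.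
  by exists x => i; apply: xP; rewrite mem_enum.
elim: (enum I) => [|i r [x xP]]; first by exists 0.
have [Fi [y Fiy]] := FP i.
have prodP : polyfun (fun z => \prod_(k <- r) F k z).
  by apply: polyfun_prod => k; have [] := FP k.
have prod_neq0 : \prod_(k <- r) F k x != 0 by rewrite prodf_seq_neq0; apply/allP.
have [z [Fiz prodz]] := polyfun_common Fi prodP Fiy prod_neq0.
exists z => k; rewrite inE => /predU1P[-> //|kr].
by move: prodz; rewrite prodf_seq_neq0 => /allP/(_ k kr).
Qed.

(** Finiteness of the number of orbits, freed from the choice of V1, V2, V3. The representatives may
    be arbitrary families of subspaces; only their covering the isomorphism classes matters. *)
Definition finite_type V (lam : quad l) : Prop :=
  exists n (E : 'I_n -> config V),
    forall U : config V, object l U -> dimq l U = lam -> exists i, isom l (E i) U.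

Lemma preserves_inv V m (U : config V) (f : 'End(V)) :
  lker f = 0%VS -> preserves m U U f -> preserves m U U (f^-1)%VF.
Proof.
move=> f0 fU j i le_im; have fUE : (f @: U j i)%VS = U j i.
  by apply/eqP; rewrite eqEdim fU //= limg_dim_eq // f0 capv0.
by rewrite -[in X in (X <= _)%VS]fUE -limg_comp lker0_compVf ?lim1g //; apply/eqP.
Qed.

(** Two pairs giving isomorphic configurations differ by an isomorphism k and by invertible elements
    of the two preservers ([act2_isom_exists]), so one pair is chosen for each class met. *)
Lemma finite_type_parametrization V (U0 : config V) :
  object l U0 -> finite_type V (dimq l U0) ->
  exists n (hg : 'I_n -> 'End(V) * 'End(V)),
    (forall i, lker (hg i).1 = 0%VS /\ lker (hg i).2 = 0%VS) /\
    forall h g : 'End(V), lker h = 0%VS -> lker g = 0%VS -> exists i (k c p : 'End(V)),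
      let U1 := act2 (hg i).1 (hg i).2 U0 in
      [/\ preserves (lenC l) U1 U1 c, preserves (lenD l) U1 U1 p, lker k = 0%VS,
          h = (k \o c \o (hg i).1)%VF & g = (k \o p \o (hg i).2)%VF].
Proof.
move=> oU0 [n [E EP]].
have /fin_all_exists[hg hgP] : forall i : 'I_n, exists hg : 'End(V) * 'End(V),
    (lker hg.1 = 0%VS /\ lker hg.2 = 0%VS) /\
    ((exists h g : 'End(V), [/\ lker h = 0%VS, lker g = 0%VS & isom l (E i) (act2 h g U0)]) ->
     isom l (E i) (act2 hg.1 hg.2 U0)).
  move=> i; have [[h [g [h0 g0 iso]]]|noex] := classic (exists h g : 'End(V),
      [/\ lker h = 0%VS, lker g = 0%VS & isom l (E i) (act2 h g U0)]).
    by exists (h, g).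
  (* A dummy pair for a class which no pair reaches. *)
  by exists (\1%VF, \1%VF); split=> //; split; apply: lker_id.
exists n, hg; split=> [i|h g h0 g0]; first by have [] := hgP i.
have [i isoE] := EP _ (act2_object h0 g0 oU0) (act2_dimq l U0 h0 g0).
have [[hi0 gi0] isoEi] := hgP i.
pose U1 := act2 (hg i).1 (hg i).2 U0.
have oU1 : object l U1 by apply: act2_object.
have isoU1 : isom l U1 (act2 h g U0).
  apply: (isom_trans _ (isoE)); apply: isom_sym; apply: isoEi.
  by exists h, g.
pose a := (h \o (hg i).1^-1)%VF; pose b := (g \o (hg i).2^-1)%VF.
have inj (f f' : 'End(V)) : lker f = 0%VS -> lker f' = 0%VS -> lker (f \o f'^-1)%VF = 0%VS.
  move=> f0 f'0; apply: lker0_comp => //; apply/eqP/lker0P => v w /(congr1 f').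
  by rewrite !lker0_lfunVK //; apply/eqP.
have a0 : lker a = 0%VS by apply: inj.
have b0 : lker b = 0%VS by apply: inj.
have eqP0 (f : 'End(V)) : lker f = 0%VS -> lker f == 0%VS by move=> ->.
have [k [k0 kf kU]] : isom l U1 (act2 a b U1).
  apply: isom_trans isoU1 _; apply: isom_ext => j m _; rewrite act2_comp /a /b.
  by rewrite !lker0_compfVK ?eqP0.
have [c [p [cU pU [c0 p0] ac bp]]] := act2_isom_exists oU1 a0 b0 (And3 k0 kf kU).
exists i, k, (c^-1)%VF, (p^-1)%VF; split=> //.
- exact: preserves_inv.
- exact: preserves_inv.
- by rewrite -ac lker0_compfK ?eqP0 // /a lker0_compfVK ?eqP0.
by rewrite -bp lker0_compfK ?eqP0 // /b lker0_compfVK ?eqP0.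
Qed.

(* The scalars act trivially, so k may be normalized to have one coordinate equal to 1; a
   configuration space of dimension at least that of the group is then not covered by
   finitely many orbits, as each is dominated by a space of smaller dimension. *)
Lemma finite_type_tits V (U0 : config V) :
  object l U0 -> (0 < \dim {: V})%N -> finite_type V (dimq l U0) -> 1 <= tits (dimq l U0).
Proof.
move=> oU0 V_gt0 fin; rewrite leNgt; apply/negP => tits_lt1.
have [n [hg [hg0 hgP]]] := finite_type_parametrization oU0 fin.
pose E : vectType K := 'End(V).
pose H (a : 'I_(\dim {: E})) : {vspace E} :=
  lker (linfun (coord (vbasis {: E}) a : E -> K^o)).
have HP a (x : E) : (x \in H a) = (crd x a == 0) by rewrite memv_ker lfunE.
pose U1 i := act2 (hg i).1 (hg i).2 U0.
have key (ia : 'I_n * 'I_(\dim {: E})) : exists psi : (E * E)%type -> K,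
    polyfun psi /\ (exists x, psi x != 0) /\
    forall (k c p : E), crd k ia.2 = 1 ->
      preserves (lenC l) (U1 ia.1) (U1 ia.1) c -> preserves (lenD l) (U1 ia.1) (U1 ia.1) p ->
      psi ((k \o c \o (hg ia.1).1)%VF, (k \o p \o (hg ia.1).2)%VF) = 0.
  move: ia => [i a] /=; have [h0 g0] := hg0 i.
  have oU1 : object l (U1 i) by apply: act2_object.
  set C := preserver (lenC l) (U1 i) (U1 i); set P := preserver (lenD l) (U1 i) (U1 i).
  (* X parametrizes the normalized k = b + (element of H a) together with c and p. Its dimension is
     below 2 n^2, where n = dim V: the hyperplane loses one dimension, and a form below 1 means dim
     C + dim P <= n^2. *)
  pose X : vectType K := (subvs_of (H a) * (subvs_of C * subvs_of P))%type.
  pose b : E := (vbasis {: E})`_a.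
  pose F (x : X) : (E * E)%type :=
    (((b + vsval x.1) \o vsval x.2.1 \o (hg i).1)%VF,
     ((b + vsval x.1) \o vsval x.2.2 \o (hg i).2)%VF).
  have crd_b : crd b a = 1 by rewrite /crd /b coord_free ?(basis_free (vbasisP _)) // eqxx.
  have lt_X : (\dim {: X} < \dim {: (E * E)%type})%N.
    rewrite !dim_pair !dim_subvs !dim_hom.
    have dimH : (\dim (H a) < \dim {: V} * \dim {: V})%N.
      rewrite -dim_hom ltn_neqAle dimvS ?subvf // andbT (dimv_leqif_eq (subvf _)).
      apply/eqP => Hf; have : b \in H a by rewrite Hf memvf.
      by rewrite HP crd_b oner_eq0.
    have : (\dim C + \dim P <= \dim {: V} * \dim {: V})%N.
      move: tits_lt1; rewrite -(act2_dimq l U0 h0 g0) tits_dimq // -/C -/P.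
      rewrite ltrBlDr -natrD -[1 + _](natrD _ 1 _) ltr_nat add1n ltnS mulnn.
      by [].
    by move: dimH; rewrite -addSn; apply: leq_add.
  have fst_poly (A B Z : vectType K) (G : Z -> (A * B)%type) :
      polymap G -> polymap (fun z => (G z).1).
    by move=> GP; apply: (@polymap_linear _ _ _ _ G fst) => // c x y.
  have snd_poly (A B Z : vectType K) (G : Z -> (A * B)%type) :
      polymap G -> polymap (fun z => (G z).2).
    by move=> GP; apply: (@polymap_linear _ _ _ _ G snd) => // c x y.
  have val_poly (A : {vspace E}) (Z : vectType K) (G : Z -> subvs_of A) :
      polymap G -> polymap (fun z => vsval (G z)).
    by move=> GP; apply: (@polymap_linear _ _ _ _ G vsval) => // c x y; rewrite linearP.
  have idX : polymap (fun x : X => x) by apply: polymap_id.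
  have bP : polymap (fun x : X => b + vsval x.1).
    by apply: polymapD; [apply: polymap_const | apply: (val_poly); apply: (fst_poly)].
  have FP : polymap F.
    apply: polymap_pair; apply: polymap_comp_lfun; try exact: polymap_const.
      apply: polymap_comp_lfun bP _; apply: (val_poly); apply: (fst_poly).
      exact: (snd_poly).
    apply: polymap_comp_lfun bP _; apply: (val_poly); apply: (snd_poly).
    exact: (snd_poly).
  have [psi [psiP psi_neq0 psi0]] := polymap_dominated lt_X FP.
  exists psi; split=> //; split=> // k c p k1 /preserverP cC /preserverP pP.
  have kH : k - b \in H a by rewrite HP /crd linearB /= -/(crd k a) -/(crd b a) k1 crd_b subrr.
  have := psi0 (vsproj (H a) (k - b), (vsproj C c, vsproj P p)).
  by rewrite /F /= !vsprojK // addrC subrK.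
have [psi psiP] := fin_all_exists key.
have [x xP] : exists x, forall i, psi i x != 0.
  by apply: polyfun_all_common => i; have [? [? _]] := psiP i.
have prodP : polyfun (fun x => \prod_i psi i x).
  by apply: polyfun_prod => i; have [] := psiP i.
have prod_neq0 : \prod_i psi i x != 0 by apply/prodf_neq0 => i _.
have detP : polyfun (fun hg : (E * E)%type => dete hg.1 * dete hg.2).
  apply: polyfunM; apply: polyfun_comp (@polyfun_dete _ _).
    by apply: (@polymap_linear _ _ _ _ id fst); [apply: polymap_id | move=> c y z].
  by apply: (@polymap_linear _ _ _ _ id snd); [apply: polymap_id | move=> c y z].
have det1 : dete (\1%VF : E) * dete (\1%VF : E) != 0 by rewrite mulf_neq0 // dete1.
have [[h g] [prodz]] := polyfun_common (y := (\1%VF, \1%VF)) prodP detP prod_neq0 det1.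
rewrite /= mulf_eq0 negb_or !dete_neq0 => /andP[/eqP h0 /eqP g0].
have [i [k [c [p [cU pU k0 hE gE]]]]] := hgP h g h0 g0.
have [a ka] : exists a, crd k a != 0.
  apply/existsP; apply: contraT; rewrite negb_exists => /forallP k_0.
  have /eqP := id_lfun_neq0 V_gt0; case; apply/lfunP => v; rewrite id_lfunE zero_lfunE.
  apply/eqP; rewrite -memv0 -k0 memv_ker (crdE k) sum_lfunE big1 // => a _.
  by have := k_0 a; rewrite negbK => /eqP->; rewrite scale_lfunE scale0r.
have /prodf_neq0/(_ (i, a) isT)/eqP := prodz; apply.
(* Replacing (k, c, p) by (k/s, s c, s p) changes neither composite and brings the coordinate of k
   to 1. *)
have [_ [_ psi0]] := psiP (i, a); pose s := crd k a.
have scale_comp (x1 x2 : E) : (s^-1 *: k \o (s *: x1) \o x2)%VF = (k \o x1 \o x2)%VF.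
  apply/lfunP => v; rewrite !comp_lfunE !scale_lfunE linearZ /= scalerA mulVf //.
  by rewrite scale1r.
have := psi0 (s^-1 *: k) (s *: c) (s *: p); rewrite /= !scale_comp -hE -gE; apply.
- by rewrite /crd linearZ /= mulVf.
- by apply/preserverP; rewrite memvZ //; apply/preserverP.
by apply/preserverP; rewrite memvZ //; apply/preserverP.
Qed.

End Covering.

(** * Direct sums and cancellation *)

Section Existence.
Variables (K : fieldType) (l : 'I_4 -> nat).
Hypothesis l_gt0 : forall j, (0 < l j)%N.
Implicit Types V W : vectType K.

(** The ends [X] of the arms are prescribed because a double flag lives over given V1, V2, V3. *)
Lemma exists_object_over V (X : 'I_4 -> {vspace V}) (lam : quad l) :
  balanced lam (\dim {: V}) -> directv (\sum_j X j) -> (\sum_j X j)%VS = fullv ->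
  (forall j, \dim (X j) = \sum_(i < lenC l j) ent lam j i)%N ->
  exists U, [/\ object l U, dimq l U = lam & forall j, U j (lenC l j) = X j].
Proof.
move=> [sums _] dX sX dimX.
have XD : X armD = 0%VS by apply/eqP; rewrite -dimv_eq0 dimX /lenC eqxx big_ord0.
have /fin_all_exists[c cP] : forall j, exists U : nat -> {vspace V},
    [/\ U 0%N = 0%VS, U (lenC l j) = X j, forall i, (U i <= U i.+1)%VS &
     forall i, (i <= lenC l j)%N -> \dim (U i) = (\sum_(k < i) ent lam j k)%N].
  by move=> j; apply: exists_chain.
have [d [d0 dl dinc dimd]] := exists_chain (sums armD).
pose U j i := if j == armD then d i else if (i <= lenC l j)%N then c j i else fullv.
have U_top j : U j (l j) = fullv.
  by rewrite /U; case: eqP => [->//|_]; rewrite leqNgt lenC_lt.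
have U_C j : U j (lenC l j) = X j.
  rewrite /U; case: eqP => [->|_]; first by rewrite /lenC eqxx d0 XD.
  by rewrite leqnn; have [] := cP j.
have dimU j i : (i <= l j)%N -> \dim (U j i) = (\sum_(k < i) ent lam j k)%N.
  move=> le_il; rewrite /U; case: eqP => [jD|/eqP ne_jD]; first by rewrite dimd -?jD // jD.
  case: ifP => [le_iC|/negbT]; first by have [_ _ _ ->] := cP j.
  rewrite -ltnNge /lenC (negPf ne_jD) prednK // => le_li.
  have -> : i = l j by apply/eqP; rewrite eqn_leq le_il.
  by rewrite sums.
exists U; split=> //; first split=> //.
- move=> j; rewrite /U; case: eqP => // _; rewrite leq0n; by have [] := cP j.
- move=> j i lt_il; rewrite /U; case: eqP => // /eqP ne_jD.
  case: ifP => [le_iC|/negbT nle_iC]; last first.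
    by case: ifP => [lt_iC|_]; [rewrite (ltnW lt_iC) in nle_iC | apply: subvv].
  by case: ifP => _; [have [_ _ ->] := cP j | apply: subvf].
- by rewrite (eq_bigr X).
- move: dX; rewrite !directvE /= => /eqP dX; apply/eqP; rewrite (eq_bigr X) // dX.
  by apply: eq_bigr => j _; rewrite U_C.
apply: eq_quad => j i lt_il; rewrite ent_dimq // !dimU // ?(ltnW lt_il) //.
by rewrite big_ord_recr /= addKn.
Qed.

(** The pieces of a chain of length 4 with steps [w], seen as a multichain indexed by [unit]. *)
Lemma exists_direct V (w : 'I_4 -> nat) : (\sum_j w j)%N = \dim {: V} ->
  exists X : 'I_4 -> {vspace V}, [/\ directv (\sum_j X j), (\sum_j X j)%VS = fullv &
    forall j, \dim (X j) = w j].
Proof.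
move=> sum_w; pose w' i := w (inord i).
have sum_w' : (\sum_(i < 4) w' i)%N = \dim {: V}.
  by rewrite -sum_w; apply: eq_bigr => i _; rewrite /w' inord_val.
have [U [U0 U4 Uinc dimU]] := exists_chain sum_w'.
have mU : multichain (fun _ : unit => 4) (fun _ => U).
  split=> //; first by rewrite big_const /= card_unit /= addv0.
  by rewrite directvEgeq /= !big_const card_unit /= addv0 addn0.
pose f (j : 'I_4) : {_ : unit & 'I_4} := existT (fun _ => 'I_4) tt j.
pose g (x : {_ : unit & 'I_4}) : 'I_4 := tagged x.
have fK : cancel f g by [].
have gK : cancel g f by case=> [[] j].
pose X (j : 'I_4) := piece (m := fun _ : unit => 4) (fun _ => U) (f j).
have sumX (R : Type) (idx : R) (op : Monoid.com_law idx) (F : _ -> R) :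
    \big[op/idx]_x F x = \big[op/idx]_j F (f j).
  by rewrite (reindex f) //; exists g.
exists X; split.
- by have := directv_piece mU; rewrite !directvE /= !sumX.
- by rewrite -(sum_piece mU) sumX.
by move=> j; rewrite dim_piece //= !dimU ?(ltnW (ltn_ord j)) // big_ord_recr /= addKn /w' inord_val.
Qed.

Lemma exists_object V (lam : quad l) : balanced lam (\dim {: V}) ->
  exists U : config V, object l U /\ dimq l U = lam.
Proof.
move=> bal; have [_ sumC] := bal; have [X [dX sX dimX]] := exists_direct sumC.
by have [U [oU dU _]] := exists_object_over bal dX sX dimX; exists U.
Qed.

End Existence.

(** * Direct sums and cancellation of a line *)

Section DirectSums.
Variables (K : fieldType) (l : 'I_4 -> nat).
Hypothesis l_gt0 : forall j, (0 < l j)%N.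
Implicit Types V W : vectType K.

Definition prodv V W (A : {vspace V}) (B : {vspace W}) : {vspace (V * W)%type} :=
  (linfun fst @^-1: A :&: linfun snd @^-1: B)%VS.

Lemma mem_prodv V W (A : {vspace V}) (B : {vspace W}) x :
  (x \in prodv A B) = (x.1 \in A) && (x.2 \in B).
Proof.
by rewrite memv_cap -!memv_preim !linfun_linear.
Qed.

Definition inl_lfun V W : 'Hom(V, (V * W)%type) := linfun (fun x => (x, 0)).
Definition inr_lfun V W : 'Hom(W, (V * W)%type) := linfun (fun y => (0, y)).
Definition fst_lfun V W : 'Hom((V * W)%type, V) := linfun fst.
Definition snd_lfun V W : 'Hom((V * W)%type, W) := linfun snd.

Lemma inlE V W x : inl_lfun V W x = (x, 0).
Proof.
rewrite linfun_linear // => c y z.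
by congr (_, _); rewrite /= scaler0 addr0.
Qed.

Lemma inrE V W y : inr_lfun V W y = (0, y).
Proof.
rewrite linfun_linear // => c z t.
by congr (_, _); rewrite /= scaler0 addr0.
Qed.

Lemma fstE V W x : fst_lfun V W x = x.1.
Proof. by rewrite linfun_linear // => c y z. Qed.

Lemma sndE V W x : snd_lfun V W x = x.2.
Proof. by rewrite linfun_linear // => c y z. Qed.

Lemma dim_prodv V W (A : {vspace V}) (B : {vspace W}) :
  \dim (prodv A B) = (\dim A + \dim B)%N.
Proof.
rewrite -(limg_ker_dim (fst_lfun V W)) addnC; congr (\dim _ + _)%N.
  apply/vspaceP => x; apply/memv_imgP/idP => [[y + ->]|xA].
    by rewrite mem_prodv fstE => /andP[].
  by exists (x, 0); rewrite ?fstE // mem_prodv xA mem0v.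
rewrite -(limg_dim_eq (f := inr_lfun V W) (U := B)).
  congr (\dim _); apply/vspaceP => x; apply/idP/memv_imgP.
    rewrite memv_cap mem_prodv memv_ker fstE => /andP[/andP[_ xB] /eqP x0].
    by exists x.2 => //; rewrite inrE -x0; case: (x).
  by move=> [y yB ->]; rewrite inrE memv_cap mem_prodv memv_ker fstE /= mem0v yB eqxx.
apply/eqP; rewrite -subv0; apply/subvP => y; rewrite memv_cap memv_ker inrE => /andP[_ /eqP[->]].
exact: mem0v.
Qed.

Definition osum V W (U : config V) (U' : config W) j i :=
  prodv (U j i) (U' j i).

Lemma osum_object V W (U : config V) (U' : config W) :
  object l U -> object l U' -> object l (osum U U').
Proof.
move=> oU oU'; have [U0 Uinc Ul sU dU] := oU; have [U'0 U'inc U'l sU' dU'] := oU'; split.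
- move=> j; apply/vspaceP => x; rewrite mem_prodv U0 U'0 !memv0.
  by case: x => x y; rewrite -pair_eqE.
- move=> j i lt_il; apply/subvP => x; rewrite !mem_prodv => /andP[xU yU'].
  by rewrite (subvP (Uinc _ _ lt_il)) // (subvP (U'inc _ _ lt_il)).
- by move=> j; apply/vspaceP => x; rewrite mem_prodv Ul U'l !memvf.
- apply/vspaceP => x; rewrite memvf; apply/memv_sumP.
  have [w1 w1E w1U] := object_decomp x.1 oU; have [w2 w2E w2U] := object_decomp x.2 oU'.
  exists (fun j => (w1 j, w2 j)) => [j _|]; first by rewrite mem_prodv w1U w2U.
  have E1 : (\sum_j (w1 j, w2 j)).1 = \sum_j w1 j.
    by apply: (big_rec2 (fun (p : V * W) v => p.1 = v)) => // j p v _ <-.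
  have E2 : (\sum_j (w1 j, w2 j)).2 = \sum_j w2 j.
    by apply: (big_rec2 (fun (p : V * W) v => p.2 = v)) => // j p v _ <-.
  by rewrite [LHS]surjective_pairing [RHS]surjective_pairing E1 E2 w1E w2E.
apply/directv_sum_independent => us usU us0 j _.
have us1 : (us j).1 = 0.
  apply: (@object_independent _ l _ U (fun k => (us k).1)) => // [k|].
    by have := usU k isT; rewrite mem_prodv => /andP[].
  have := congr1 (fst_lfun V W) us0; rewrite linear_sum linear0 => E; rewrite -[RHS]E.
  by apply: eq_bigr => k _; rewrite /= fstE.
have us2 : (us j).2 = 0.
  apply: (@object_independent _ l _ U' (fun k => (us k).2)) => // [k|].
    by have := usU k isT; rewrite mem_prodv => /andP[].
  have := congr1 (snd_lfun V W) us0; rewrite linear_sum linear0 => E; rewrite -[RHS]E.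
  by apply: eq_bigr => k _; rewrite /= sndE.
by rewrite [LHS]surjective_pairing us1 us2.
Qed.

Lemma osum_dimq V W (U : config V) (U' : config W) :
  object l U -> object l U' -> dimq l (osum U U') = dimq l U + dimq l U'.
Proof.
move=> [_ Uinc _ _ _] [_ U'inc _ _ _]; apply: eq_quad => j i lt_il.
rewrite entD !ent_dimq // !dim_prodv.
have := dimvS (Uinc j i lt_il); have := dimvS (U'inc j i lt_il).
by lia.
Qed.

Lemma inl_strict V W (U : config V) (U' : config W) :
  strict l U (osum U U') (inl_lfun V W).
Proof.
split=> [|j i w _]; last by rewrite inlE mem_prodv mem0v andbT.
by apply/eqP/lker0P => x y; rewrite !inlE => -[].
Qed.

Lemma inr_strict V W (U : config V) (U' : config W) :
  strict l U' (osum U U') (inr_lfun V W).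
Proof.
split=> [|j i w _]; last by rewrite inrE mem_prodv mem0v.
by apply/eqP/lker0P => x y; rewrite !inrE => -[].
Qed.

Lemma fst_mor V W (U : config V) (U' : config W) :
  mor l (osum U U') U (fst_lfun V W).
Proof. by apply/preserves_mem => j i x _; rewrite mem_prodv fstE => /andP[]. Qed.

Lemma snd_mor V W (U : config V) (U' : config W) :
  mor l (osum U U') U' (snd_lfun V W).
Proof. by apply/preserves_mem => j i x _; rewrite mem_prodv sndE => /andP[]. Qed.

Lemma pair_split V W (x : V * W) :
  x = inl_lfun V W (fst_lfun V W x) + inr_lfun V W (snd_lfun V W x).
Proof.
rewrite inlE inrE fstE sndE; case: x => x y.
by congr (_, _); rewrite /= ?addr0 ?add0r.
Qed.

Lemma fst_inl V W x : fst_lfun V W (inl_lfun V W x) = x.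
Proof. by rewrite inlE fstE. Qed.
Lemma snd_inl V W x : snd_lfun V W (inl_lfun V W x) = 0.
Proof. by rewrite inlE sndE. Qed.
Lemma fst_inr V W y : fst_lfun V W (inr_lfun V W y) = 0.
Proof. by rewrite inrE fstE. Qed.
Lemma snd_inr V W y : snd_lfun V W (inr_lfun V W y) = y.
Proof. by rewrite inrE sndE. Qed.

(* Gaussian elimination of the invertible corner d of an isomorphism. *)
Lemma cancel_corner V V' W (U : config V) (U' : config V')
    (N : config W) (h : 'Hom((V * W)%type, (V' * W)%type)) (t : K) :
  isomorphism l (osum U N) (osum U' N) h -> t != 0 ->
  (forall y, snd_lfun V' W (h (inr_lfun V W y)) = t *: y) -> isom l U U'.
Proof.
move=> /isomorphism_inv[hU gU gh hg] t0 hd.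
move: (h^-1)%VF gU gh hg => g gU gh hg.
have ghv x : g (h x) = x by rewrite -comp_lfunE gh id_lfunE.
have hgv x : h (g x) = x by rewrite -comp_lfunE hg id_lfunE.
pose a := (fst_lfun V' W \o h \o inl_lfun V W)%VF.
pose b := (fst_lfun V' W \o h \o inr_lfun V W)%VF.
pose c := (snd_lfun V' W \o h \o inl_lfun V W)%VF.
pose a' := (fst_lfun V W \o g \o inl_lfun V' W)%VF.
exists (a - t^-1 *: (b \o c)%VF); apply: (@isomorphism_of_inverses _ _ _ _ _ _ _ a').
- have iU := strict_mor (inl_strict U N); have iN := strict_mor (inr_strict U N).
  have pU := fst_mor U' N; have pN := snd_mor U' N.
  apply: mor_sub; first exact: (mor_comp (mor_comp pU hU) iU).
  apply: mor_scale; apply: mor_comp (mor_comp (mor_comp pU hU) iN) _.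
  exact: (mor_comp (mor_comp pN hU) iU).
- exact: (mor_comp (mor_comp (fst_mor U N) gU) (strict_mor (inl_strict U' N))).
- apply/lfunP => x; rewrite comp_lfunE id_lfunE add_lfunE opp_lfunE scale_lfunE !comp_lfunE.
  set cx := snd_lfun V' W (h (inl_lfun V W x)); set y := t^-1 *: cx.
  have <- : fst_lfun V' W (h (inl_lfun V W x - inr_lfun V W y)) =
      fst_lfun V' W (h (inl_lfun V W x)) - t^-1 *: fst_lfun V' W (h (inr_lfun V W cx)).
    by rewrite !linearB /= /y !linearZ.
  have -> : inl_lfun V' W (fst_lfun V' W (h (inl_lfun V W x - inr_lfun V W y))) =
      h (inl_lfun V W x - inr_lfun V W y).
    rewrite [RHS]pair_split; suff -> : snd_lfun V' W (h (inl_lfun V W x - inr_lfun V W y)) = 0.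
      by rewrite linear0 addr0.
    by rewrite !linearB /= hd /y scalerA mulfV // scale1r subrr.
  by rewrite ghv linearB /= fst_inl fst_inr subr0.
apply/lfunP => x; rewrite comp_lfunE id_lfunE add_lfunE opp_lfunE scale_lfunE !comp_lfunE.
set z := g (inl_lfun V' W x).
have zE := pair_split z; set z1 := fst_lfun V W z in zE *; set z2 := snd_lfun V W z in zE.
have hz : h z = inl_lfun V' W x by rewrite hgv.
have z2E : snd_lfun V' W (h (inl_lfun V W z1)) = - (t *: z2).
  apply/eqP; rewrite -addr_eq0 -hd -!linearD /= -zE hz snd_inl.
  by [].
rewrite z2E !linearN /= !linearZ /= scalerA mulVf // scale1r opprK -!linearD /= -zE hz.
exact: fst_inl.
Qed.

(** The corner of h from N to N is a scalar. If it is nonzero, it can be eliminated directly; if it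
    vanishes, composing h with a unipotent automorphism of the source turns it into 1. *)
Lemma cancel_line V V' W (U : config V) (U' : config V')
    (N : config W) :
  \dim {: W} = 1%N -> isom l (osum U N) (osum U' N) -> isom l U U'.
Proof.
move=> dimW [h iso_h]; have [hU gU gh hg] := isomorphism_inv iso_h.
have scal (f : 'End(W)) : exists t, f = t *: \1%VF.
  have /eqP E : <[\1%VF]>%VS == {: 'End(W)}%VS.
    by rewrite eqEdim subvf dim_hom dimW dim_vline id_lfun_neq0 ?dimW.
  by have := memvf f; rewrite -E => /vlineP.
have [t tE] := scal (snd_lfun V' W \o h \o inr_lfun V W)%VF.
have hd y : snd_lfun V' W (h (inr_lfun V W y)) = t *: y.
  by have /lfunP/(_ y) := tE; rewrite !comp_lfunE scale_lfunE id_lfunE.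
have [t0|t_neq0] := eqVneq t 0; last exact: cancel_corner iso_h t_neq0 hd.
(* When the corner is 0, reading h h^-1 = 1 on N shows that the corner of h from U to N is a left
   inverse of b'. Precomposing h with 1 + n, where n sends N into U by b', therefore makes the
   corner equal to 1. *)
pose b' := (fst_lfun V W \o h^-1 \o inr_lfun V' W)%VF.
have b'U : mor l N U b'.
  exact: (mor_comp (mor_comp (fst_mor U N) gU) (strict_mor (inr_strict U' N))).
have cb y : snd_lfun V' W (h (inl_lfun V W (b' y))) = y.
  rewrite !comp_lfunE; set z := (h^-1)%VF (inr_lfun V' W y).
  have hz : h z = inr_lfun V' W y by rewrite -comp_lfunE hg id_lfunE.
  have := hd (snd_lfun V W z); rewrite t0 scale0r => hd0.
  rewrite -[LHS]addr0 -hd0 -!linearD /= -pair_split hz.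
  exact: snd_inr.
clearbody b'; pose n := (inl_lfun V W \o b' \o snd_lfun V W)%VF.
have nU : mor l (osum U N) (osum U N) n.
  exact: (mor_comp (mor_comp (strict_mor (inl_strict U N)) b'U) (snd_mor U N)).
have nn : (n \o n)%VF = 0.
  by apply/lfunP => x; rewrite !comp_lfunE snd_inl !linear0 zero_lfunE.
have tau1 : ((\1 - n) \o (\1 + n))%VF = \1%VF.
  by rewrite comp_lfunDl comp_lfunNl !comp_lfunDr !comp_lfun1r !comp_lfun1l nn addr0 addrK.
have tau2 : ((\1 + n) \o (\1 - n))%VF = \1%VF.
  by rewrite comp_lfunDl !comp_lfunDr !comp_lfunNr !comp_lfun1r !comp_lfun1l nn oppr0 addr0 subrK.
have iso_h' : isomorphism l (osum U N) (osum U' N) (h \o (\1 + n))%VF.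
  apply: (@isomorphism_of_inverses _ _ _ _ _ _ _ ((\1 - n) \o h^-1)%VF).
  - apply: mor_comp hU _; rewrite -[n]scale1r addrC; apply: mor_lin => //; exact: mor_id.
  - apply: mor_comp _ gU; apply: mor_sub => //; exact: mor_id.
  - by rewrite comp_lfunA -(comp_lfunA _ h^-1%VF) gh comp_lfun1r.
  by rewrite comp_lfunA -(comp_lfunA h) tau2 comp_lfun1r.
apply: cancel_corner iso_h' (oner_neq0 K) _ => y.
rewrite comp_lfunE add_lfunE id_lfunE !comp_lfunE snd_inr !linearD /= hd t0 scale0r add0r.
by rewrite cb scale1r.
Qed.

End DirectSums.

(** * Finiteness passes to summands *)

Section Necessity.
Variables (K : closedFieldType) (l : 'I_4 -> nat).
Hypothesis l_gt0 : forall j, (0 < l j)%N.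
Implicit Types V W : vectType K.

Lemma linear_iso V W : \dim {: V} = \dim {: W} ->
  exists h : 'Hom(V, W), lker h = 0%VS /\ limg h = fullv.
Proof.
move=> dVW; have [h hf] := lfun_between dVW; exists h; split=> //.
apply/eqP; rewrite -dimv_eq0; have := limg_ker_dim h fullv.
by rewrite capfv hf dVW => /eqP; rewrite -[X in _ == X]add0n eqn_add2r.
Qed.

Lemma isom_transport V W (U : config V) : \dim {: V} = \dim {: W} ->
  exists U' : config W, isom l U U'.
Proof.
by move=> /linear_iso[h [h0 hf]]; exists (fun j i => (h @: U j i)%VS), h.
Qed.

Lemma sum_eq_ord k c : (\sum_(i < k) (nat_of_ord i == c) = (c < k))%N.
Proof.
elim: k => [|k IHk]; first by rewrite big_ord0.
by rewrite big_ord_recr /= IHk ltnS; case: (ltngtP c k).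
Qed.

(** A vector of total 1 has a single 1 on each arm, which is off the last position on exactly one of
    the arms A, B, C. It is placed at positive entries of lam. *)
Lemma balanced_peel (lam : quad l) n : balanced lam n.+1 ->
  exists nu eps : quad l, lam = nu + eps /\ balanced eps 1.
Proof.
move=> [sums sumC].
have [j0 [i0 lt_i0 ent_i0]] : exists j0, exists2 i0, (i0 < lenC l j0)%N & (0 < ent lam j0 i0)%N.
  apply: NNPP => no; have : (\sum_j \sum_(i < lenC l j) ent lam j i)%N = 0%N.
    rewrite big1 // => j _; rewrite big1 // => i _; apply/eqP; rewrite -leqn0 leqNgt.
    by apply/negP => ent_gt0; apply: no; exists j, i.
  by rewrite sumC.
have ne_j0D : j0 != armD by apply: contraTneq lt_i0 => ->; rewrite /lenC eqxx.
have [m lt_m ent_m] : exists2 m, (m < l armD)%N & (0 < ent lam armD m)%N.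
  apply: NNPP => no; have : (\sum_(i < l armD) ent lam armD i)%N = 0%N.
    rewrite big1 // => i _; apply/eqP; rewrite -leqn0 leqNgt.
    by apply/negP => ent_gt0; apply: no; exists (nat_of_ord i).
  by rewrite sums.
pose c j := if j == armD then m else if j == j0 then i0 else (l j).-1.
have lt_c j : (c j < l j)%N.
  rewrite /c; case: eqP => [->//|_]; case: eqP => [->|_]; last by rewrite prednK.
  exact: leq_trans lt_i0 (lenC_le _ _).
(* On the arms among A, B, C other than j0, the last entry equals the sum of the non-last entries of
   the other two, which includes the positive entry at i0. *)
have ent_c j : (0 < ent lam j (c j))%N.
  rewrite /c; case: eqP => [->//|/eqP ne_jD]; case: eqP => [->//|/eqP ne_jj0].
  have last : (\sum_(i < l j) ent lam j i =
      \sum_(i < (l j).-1) ent lam j i + ent lam j (l j).-1)%N.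
    by rewrite -[in LHS](prednK (l_gt0 j)) big_ord_recr.
  have := sums j; rewrite last.
  have : (\sum_(i < (l j).-1) ent lam j i < n.+1)%N.
    have <- : lenC l j = (l j).-1 by rewrite /lenC (negPf ne_jD).
    rewrite -sumC (bigD1 j0) //= (bigD1 j) //= addnCA -[X in (X < _)%N]addn0 ltn_add2l.
    by rewrite ltn_addr // (bigD1 (Ordinal lt_i0)) //= ltn_addr.
  by lia.
pose eps : quad l := [ffun x : {j : 'I_4 & 'I_(l j)} => (nat_of_ord (tagged x) == c (tag x) : nat)].
pose nu : quad l := [ffun x => (lam x - eps x)%N].
have ent_eps j i : (i < l j)%N -> ent eps j i = (i == c j).
  by move=> lt_il; rewrite (ent_tag _ (Ordinal lt_il)) ffunE.
exists nu, eps; split.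
  apply/ffunP => x; rewrite quadDE [X in (X + _)%N]ffunE subnK // ffunE entE.
  by case: eqP => [->|//]; apply: ent_c.
split=> [j|].
  under eq_bigr => i _ do rewrite ent_eps //.
  by rewrite sum_eq_ord lt_c.
transitivity (\sum_(j < 4) (j == j0))%N; last first.
  by rewrite (bigD1 j0) //= eqxx big1 // => j /negPf->.
apply: eq_bigr => j _.
under eq_bigr => i _ do rewrite ent_eps ?(leq_trans (ltn_ord i) (lenC_le _ _)) //.
rewrite sum_eq_ord /c; case: eqP => [->|/eqP ne_jD].
  by rewrite /lenC eqxx ltn0 eq_sym (negPf ne_j0D).
case: eqP => [->|_]; first by rewrite lt_i0.
by rewrite /lenC (negPf ne_jD) ltnn.
Qed.

(** Adding a one-dimensional object N is injective on isomorphism classes by [cancel_line], so the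
    classes for lam are no more numerous than those for lam + eps. *)
Lemma finite_type_descent V W (lam eps : quad l) : balanced eps 1 ->
  \dim {: V} = (\dim {: W}).+1 -> finite_type V (lam + eps) -> finite_type W lam.
Proof.
move=> bal_eps dimV [n [E EP]].
have dimK : \dim {: K^o} = 1%N by rewrite dimvf.
have [N [oN dN]] := exists_object l_gt0 (V := K^o) (lam := eps) (eq_ind_r _ bal_eps dimK).
have /fin_all_exists[E' E'P] : forall i : 'I_n, exists U' : config W,
    (exists U : config W, isom l (E i) (osum U N)) -> isom l (E i) (osum U' N).
  move=> i; have [[U iso]|no] := classic (exists U : config W, isom l (E i) (osum U N)).
    by exists U.
  by exists (fun _ _ => 0%VS) => /no.
exists n, E' => U oU dU.
have oUN := osum_object oU oN.
have dimWK : \dim {: (W * K^o)%type} = \dim {: V} by rewrite dim_pair dimK dimV addn1.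
have [U1 iso1] := isom_transport (osum U N) dimWK.
have dU1 : dimq l U1 = lam + eps by rewrite -(isom_dimq iso1) osum_dimq // dU dN.
have [i isoE] := EP U1 (isom_object iso1 oUN) dU1.
have isoEU : isom l (E i) (osum U N) by apply: isom_trans isoE (isom_sym iso1).
exists i; apply: (cancel_line (N := N) dimK).
exact: (isom_trans (isom_sym (E'P i (ex_intro _ U isoEU))) isoEU).
Qed.

(** Peel nu one dimension at a time, passing to smaller spaces, until only mu remains and
    [finite_type_tits] applies. *)
Lemma finite_type_summand n V (mu nu : quad l) : balanced nu n -> in_Lambda mu ->
  \dim {: V} = (total mu + n)%N -> finite_type V (mu + nu) -> 1 <= tits mu.
Proof.
elim: n nu V => [|n IHn] nu V bal muL dimV fin.
  rewrite (balanced_eq0 bal) addr0 in fin; rewrite addn0 in dimV.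
  have [U0 [oU0 dU0]] : exists U0 : config V, object l U0 /\ dimq l U0 = mu.
    by apply: exists_object => //; rewrite dimV; apply: Lambda_balanced.
  rewrite -dU0 in fin *; apply: finite_type_tits fin => //.
  by rewrite dimV; apply: Lambda_total_gt0.
have [nu' [eps [nuE bal_eps]]] := balanced_peel bal.
have bal' : balanced nu' n.
  have -> : n = (n.+1 - 1)%N by rewrite subn1.
  by apply: balancedB bal_eps _; rewrite addrC -nuE.
pose W : vectType K := 'rV[K]_(total mu + n).
have dimW : \dim {: W} = (total mu + n)%N by rewrite dimvf; apply: mul1n.
apply: (IHn nu' W bal' muL dimW).
apply: (finite_type_descent (V := V) bal_eps); first by rewrite dimW dimV addnS.
by rewrite -addrA -nuE.
Qed.

End Necessity.

(** * Splitting types *)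

Section Splitting.
Variables (K : fieldType) (l : 'I_4 -> nat).
Implicit Types V W N : vectType K.

Lemma idem_isom V N (U : config V) (UN : config N)
    (i : 'Hom(N, V)) (p : 'Hom(V, N)) (e : 'End(V)) :
  object l U -> mor l UN U i -> mor l U UN p -> (p \o i)%VF = \1%VF -> (i \o p)%VF = e ->
  isom l (induced U (limg e)) UN.
Proof.
move=> oU iU pU pi ip; have eU : mor l U U e by rewrite -ip; apply: mor_comp iU pU.
have pK w : p (i w) = w by rewrite -comp_lfunE pi id_lfunE.
have ipv v : e v = i (p v) by rewrite -ip comp_lfunE.
have ee : (e \o e)%VF = e by apply/lfunP => v; rewrite comp_lfunE !ipv pK.
have [i' [c [si cU ciK icE]]] := split_idem oU eU ee.
have cK w : c (i' w) = w by rewrite -comp_lfunE ciK id_lfunE.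
have icv v : i' (c v) = i (p v) by have /lfunP/(_ v) := icE; rewrite comp_lfunE ipv.
exists (p \o i')%VF; apply: (@isomorphism_of_inverses _ _ _ _ _ _ _ (c \o i)%VF).
- exact: mor_comp pU (strict_mor si).
- exact: mor_comp cU iU.
- by apply/lfunP => w; rewrite !comp_lfunE id_lfunE -icv !cK.
by apply/lfunP => w; rewrite !comp_lfunE id_lfunE icv !pK.
Qed.

Lemma indec_isom V W (U : config V) (U' : config W) :
  isom l U U' -> indec l U -> indec l U'.
Proof.
move=> [h iso_h] [dV indU]; have [hU gU gh hg] := isomorphism_inv iso_h.
have ghv v : (h^-1)%VF (h v) = v by rewrite -comp_lfunE gh id_lfunE.
have hgv v : h ((h^-1)%VF v) = v by rewrite -comp_lfunE hg id_lfunE.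
split=> [|e eU ee].
  by case: iso_h => h0 <- _; rewrite limg_dim_eq // h0 capv0.
pose e' := (h^-1 \o e \o h)%VF.
have eE : e = (h \o e' \o h^-1)%VF by apply/lfunP => v; rewrite !comp_lfunE !hgv.
have [| |e'0|e'1] := indU e'.
- exact: mor_comp (mor_comp gU eU) hU.
- by apply/lfunP => v; rewrite !comp_lfunE hgv -[e (e _)]comp_lfunE ee.
- by left; rewrite eE e'0 comp_lfun0r comp_lfun0l.
by right; rewrite eE e'1 comp_lfun1r hg.
Qed.

Lemma brick_indec V (U : config V) :
  (0 < \dim {: V})%N -> brick l U -> indec l U.
Proof.
move=> dV bU; split=> // e eU ee; have [c eE] := bU e eU.
have id0 : (\1%VF : 'End(V)) != 0 by apply: id_lfun_neq0.
move/eqP: ee; rewrite eE -comp_lfunZl -comp_lfunZr comp_lfun1l scalerA.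
rewrite -subr_eq0 -scalerBl scaler_eq0 (negPf id0) orbF -[X in _ - X]mulr1.
rewrite -mulrBr mulf_eq0 subr_eq0.
by case/orP=> /eqP->; [left; rewrite scale0r | right; rewrite scale1r].
Qed.

Lemma retract_induced V N (U : config V) (UN : config N)
    (i : 'Hom(N, V)) (p : 'Hom(V, N)) (e : 'End(N)) :
  object l U -> object l UN -> mor l UN U i -> mor l U UN p -> (p \o i)%VF = \1%VF ->
  mor l UN UN e -> (e \o e)%VF = e ->
  isom l (induced U (limg (i \o e \o p)%VF)) (induced UN (limg e)).
Proof.
move=> oU oN iU pU pi eU ee; have [i' [c [si cU ciK icE]]] := split_idem oN eU ee.
have pK w : p (i w) = w by rewrite -comp_lfunE pi id_lfunE.
have icv v : i' (c v) = e v by have /lfunP/(_ v) := icE; rewrite comp_lfunE.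
apply: (@idem_isom _ _ _ _ (i \o i')%VF (c \o p)%VF) => //.
- exact: mor_comp iU (strict_mor si).
- exact: mor_comp cU pU.
- by rewrite -[RHS]ciK; apply/lfunP => w; rewrite !comp_lfunE pK.
by apply/lfunP => w; rewrite !comp_lfunE icv.
Qed.

(** Conjugation by i and p moves a decomposition of N to one of the idempotent i p. It serves both
    isomorphisms, where i p = 1, and the two inclusions of a direct sum. *)
Lemma decomp_retract V N (U : config V) (UN : config N)
    (i : 'Hom(N, V)) (p : 'Hom(V, N)) (es : seq 'End(N)) :
  object l U -> object l UN -> mor l UN U i -> mor l U UN p -> (p \o i)%VF = \1%VF ->
  decomp l UN \1%VF es ->
  decomp l U (i \o p)%VF [seq (i \o e \o p)%VF | e <- es] /\
  [seq summand_dim l U e | e <- [seq (i \o e \o p)%VF | e <- es]] =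
  [seq summand_dim l UN e | e <- es].
Proof.
move=> oU oN iU pU pi [ues ses mes ies oes indes].
have pK w : p (i w) = w by rewrite -comp_lfunE pi id_lfunE.
have comp_ip (e f : 'End(N)) : ((i \o e \o p) \o (i \o f \o p))%VF = (i \o (e \o f) \o p)%VF.
  by apply/lfunP => v; rewrite !comp_lfunE pK.
have isoE e : e \in es -> isom l (induced U (limg (i \o e \o p)%VF)) (induced UN (limg e)).
  by move=> ees; apply: retract_induced; [| | | | | exact: mes | exact: ies].
split; last by rewrite -map_comp; apply/eq_in_map => e /isoE/isom_dimq.
split.
- rewrite map_inj_uniq // => e f /lfunP eqef; apply/lfunP => w.
  by have := eqef (i w); rewrite !comp_lfunE pK => /(congr1 p); rewrite !pK.
- rewrite big_map; apply/lfunP => v; rewrite sum_lfunE comp_lfunE.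
  transitivity (i ((\sum_(e <- es) e) (p v))); last by rewrite ses id_lfunE.
  by rewrite sum_lfunE linear_sum; apply: eq_bigr => e _; rewrite !comp_lfunE.
- by move=> _ /mapP[e ees ->]; apply: mor_comp (mor_comp iU (mes e ees)) pU.
- by move=> _ /mapP[e ees ->]; rewrite comp_ip ies.
- move=> _ _ /mapP[e ees ->] /mapP[f ffs ->] ne_ef; rewrite comp_ip oes //.
    by rewrite comp_lfun0r comp_lfun0l.
  by apply: contra ne_ef => /eqP->.
by move=> _ /mapP[e ees ->]; apply: indec_isom (isom_sym (isoE e ees)) (indes e ees).
Qed.

(** A relation, since the decomposition is not unique; under the finiteness condition it determines
    [s] up to permutation ([splits_unique]). *)
Definition splits V (U : config V) (s : seq (quad l)) : Prop :=
  exists2 es, decomp l U \1%VF es & s = [seq summand_dim l U e | e <- es].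

Lemma splits_isom V W (U : config V) (U' : config W) s :
  object l U -> isom l U U' -> splits U s -> splits U' s.
Proof.
move=> oU iso [es des ->]; have oU' := isom_object iso oU.
have [h iso_h] := iso; have [hU gU gh hg] := isomorphism_inv iso_h.
have [] := decomp_retract oU' oU hU gU gh des.
by rewrite hg => des' dE; eexists; first exact: des'.
Qed.

Lemma splits_indec V (U : config V) :
  object l U -> indec l U -> splits U [:: dimq l U].
Proof.
move=> oU indU; have id2 := comp_lfun1l (\1%VF : 'End(V)).
have iso1 : isom l (induced U (limg (\1%VF : 'End(V)))) U.
  exact: (idem_isom oU (mor_id U) (mor_id U) id2 id2).
exists [:: \1%VF]; last by rewrite /= /summand_dim (isom_dimq iso1).
split=> //= [|e|e|e f|e]; rewrite ?big_seq1 ?inE //.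
- by move/eqP->; apply: mor_id.
- by move/eqP->.
- by move=> /eqP-> /eqP->; rewrite eqxx.
by move/eqP->; apply: indec_isom (isom_sym iso1) indU.
Qed.

Lemma splits_osum V W (U : config V) (U' : config W) s s' :
  object l U -> object l U' -> splits U s -> splits U' s' -> splits (osum U U') (s ++ s').
Proof.
move=> oU oU' [es des ->] [fs dfs ->]; have oS := osum_object oU oU'.
have fi : (fst_lfun V W \o inl_lfun V W)%VF = \1%VF.
  by apply/lfunP => v; rewrite comp_lfunE fst_inl id_lfunE.
have si : (snd_lfun V W \o inr_lfun V W)%VF = \1%VF.
  by apply/lfunP => v; rewrite comp_lfunE snd_inr id_lfunE.
have [d1 <-] := decomp_retract oS oU (strict_mor (inl_strict l U U')) (fst_mor U U') fi des.
have [d2 <-] := decomp_retract oS oU' (strict_mor (inr_strict l U U')) (snd_mor U U') si dfs.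
set es' := map _ es in d1 *; set fs' := map _ fs in d2 *.
rewrite -map_cat; exists (es' ++ fs') => //.
have orth e f : e \in es' -> f \in fs' -> (e \o f)%VF = 0 /\ (f \o e)%VF = 0.
  move=> /mapP[e0 _ ->] /mapP[f0 _ ->]; split; apply/lfunP => v; rewrite !comp_lfunE zero_lfunE.
    by rewrite fst_inr !linear0.
  by rewrite snd_inl !linear0.
have [u1 s1 m1 i1 o1 n1] := d1; have [u2 s2 m2 i2 o2 n2] := d2; split.
- rewrite cat_uniq u1 u2 andbT /=; apply/hasPn => f ffs; apply/negP => fes.
  have [f0 _] := orth f f fes ffs; have := i2 f ffs; rewrite f0 => fE.
  by have [] := n2 f ffs; rewrite -fE dim_subvs lim0g dimv0.
- rewrite big_cat /= s1 s2; apply/lfunP => v; rewrite add_lfunE !comp_lfunE id_lfunE.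
  by rewrite -pair_split.
- by move=> e; rewrite mem_cat => /orP[/m1|/m2].
- by move=> e; rewrite mem_cat => /orP[/i1|/i2].
- move=> e f; rewrite !mem_cat => /orP[ee|ee] /orP[ff|ff] ne; try by [apply: o1 | apply: o2].
    by have [] := orth e f ee ff.
  by have [] := orth f e ff ee.
by move=> e; rewrite mem_cat => /orP[/n1|/n2].
Qed.

Lemma splits_perm V (U : config V) s s' :
  perm_eq s s' -> splits U s -> splits U s'.
Proof.
move=> pss' [es des sE]; move: pss'; rewrite sE perm_sym => /(perm_iotaP (summand_dim l U 0)).
rewrite size_map => -[I pI ->]; exists [seq nth 0 es k | k <- I].
  apply: decomp_perm des; rewrite perm_sym (perm_trans (perm_map _ pI)) //.
  by have := mkseq_nth 0 es; rewrite /mkseq => ->.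
rewrite -map_comp; apply/eq_in_map => k; rewrite (perm_mem pI) mem_iota => /andP[_ ltk].
by rewrite (nth_map 0).
Qed.

End Splitting.

(** * Configurations classified by their splitting types *)

Section SplittingTypes.
Variables (K : closedFieldType) (l : 'I_4 -> nat).
Hypothesis l_gt0 : forall j, (0 < l j)%N.
Hypothesis charK0 : has_char0 K.
Implicit Types V W : vectType K.

Lemma exists_splits V (U : config V) : object l U -> exists s : seq (quad l), splits U s.
Proof. by move=> oU; have [es des] := exists_decomp oU; eexists; exists es. Qed.

Lemma splits_decomposition V (U : config V) (s : seq (quad l)) :
  object l U -> finiteness_condition (dimq l U) -> in_Lambda (dimq l U) -> splits U s ->
  decomposition (dimq l U) s.
Proof.
move=> oU finU [dU _ _] [es des ->].
have sumE : \sum_(mu <- [seq summand_dim l U e | e <- es]) mu = dimq l U.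
  by rewrite big_map sum_summand_dim.
split=> // [|_ /mapP[e ees ->]].
  by case: es des sumE => // _; rewrite big_nil => E; rewrite -E eqxx in dU.
by have [_ _ _] := decomp_bricks l_gt0 oU finU des ees.
Qed.

Lemma splits_unique V W (U : config V) (U' : config W) (s s' : seq (quad l)) :
  object l U -> finiteness_condition (dimq l U) -> isom l U U' -> splits U s -> splits U' s' ->
  perm_eq s s'.
Proof.
move=> oU finU iso Us U's'; have [es des ->] := splits_isom oU iso Us.
have oU' := isom_object iso oU; move: finU; rewrite (isom_dimq iso) => finU'.
have [fs dfs ->] := U's'; apply: krull_schmidt => // e ees.
  by have [_ bE _ _ _] := decomp_bricks l_gt0 oU' finU' des ees.
by have [_ bE _ _ _] := decomp_bricks l_gt0 oU' finU' dfs ees.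
Qed.

(** Matched summands are rigid with equal dimension vectors, hence isomorphic by [rigid_unique]. *)
Lemma isom_of_splits V W (U : config V) (U' : config W) (s s' : seq (quad l)) :
  object l U -> object l U' -> finiteness_condition (dimq l U) ->
  finiteness_condition (dimq l U') -> splits U s -> splits U' s' -> perm_eq s s' -> isom l U U'.
Proof.
move=> oU oU' finU finU' /splits_perm Us [fs dfs s'E] /Us[es des]; rewrite s'E => E.
have eq_size : size es = size fs by have := congr1 size E; rewrite !size_map.
apply: (isom_of_decomp oU oU' des dfs eq_size) => k ltk.
have [oe be re _ _] := decomp_bricks l_gt0 oU finU des (mem_nth 0 ltk).
have ltk' : (k < size fs)%N by rewrite -eq_size.
have [of_ bf rf _ _] := decomp_bricks l_gt0 oU' finU' dfs (mem_nth 0 ltk').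
apply: rigid_unique => //; have := congr1 (fun t => nth 0 t k) E.
by rewrite !(nth_map 0).
Qed.

(** A direct sum of the bricks provided by [exists_rigid]. The space grows with [s], so it is
    existentially quantified and later identified with V by its dimension. *)
Lemma realize_splitting (s : seq (quad l)) :
  (forall mu, mu \in s -> [/\ in_Lambda mu, tits mu = 1 & finiteness_condition mu]) ->
  exists (V : vectType K) (U : config V),
    [/\ object l U, splits U s & dimq l U = \sum_(mu <- s) mu].
Proof.
elim: s => [_|mu s IHs sP].
  have [U [oU dU]] : exists U : config 'rV[K]_0, object l U /\ dimq l U = 0.
    apply: exists_object => //; rewrite dimvf dim_matrix.
    by split=> [j|]; rewrite big1 // => *; rewrite ?big1 // => *; rewrite ent0.
  exists 'rV[K]_0, U; split=> //; last by rewrite big_nil.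
  exists [::] => //; split=> //; rewrite big_nil.
  by apply/lfunP => v; rewrite [LHS]thinmx0 [RHS]thinmx0.
have [|W [U' [oU' sU' dU']]] := IHs; first by move=> nu nus; apply: sP; rewrite inE nus orbT.
have [muL mu1 mufin] := sP mu (mem_head _ _).
have dimW : \dim {: 'rV[K]_(total mu)} = total mu by rewrite dimvf dim_matrix mul1r.
have [U0 [oU0 dU0]] : exists U : config 'rV[K]_(total mu),
    object l U /\ dimq l U = mu.
  by apply: exists_object => //; rewrite dimW; apply: Lambda_balanced.
have [||U1 [oU1 dU1 _ bU1]] := exists_rigid l_gt0 oU0; rewrite ?dU0 //.
have iU1 : indec l U1 by apply: brick_indec => //; rewrite dimW; apply: Lambda_total_gt0.
exists ('rV[K]_(total mu) * W)%type, (osum U1 U'); split; first exact: osum_object.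
  have sU1 : splits U1 [:: mu] by rewrite -[mu in [:: mu]]dU0 -dU1; apply: splits_indec.
  by rewrite -cat1s; apply: splits_osum.
by rewrite osum_dimq // dU1 dU0 dU' big_cons.
Qed.

End SplittingTypes.

Lemma finite_bounded_seqs (T : eqType) (Q : seq T) n :
  exists L : seq (seq T), forall s, (size s <= n)%N -> {subset s <= Q} -> s \in L.
Proof.
elim: n => [|n [L LP]].
  by exists [:: [::]] => s; rewrite leqn0 => /nilP->; rewrite inE.
exists ([::] :: [seq x :: s | x <- Q, s <- L]) => -[//|x s] /= lt_n sQ.
rewrite inE /=; apply/allpairsP; exists (x, s); split=> //=; first by rewrite sQ ?mem_head.
by apply: LP => // y ys; rewrite sQ // inE ys orbT.
Qed.

(** The terms are nonzero, so their number is at most the sum N of all entries of lam, and each of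
    their entries is at most N. *)
Lemma finitely_many_decompositions (l : 'I_4 -> nat) (lam : quad l) :
  exists L : seq (seq (quad l)), forall s, decomposition lam s -> s \in L.
Proof.
pose N := (\sum_x lam x)%N.
pose Q := codom (fun f : {ffun {j : 'I_4 & 'I_(l j)} -> 'I_N.+1} =>
  [ffun x => nat_of_ord (f x)] : quad l).
have [L LP] := finite_bounded_seqs Q N.
exists L => s [_ sumE sP]; apply: LP => [|mu mus].
  have -> : N = (\sum_(mu <- s) \sum_x mu x)%N.
    rewrite /N -sumE exchange_big /=; apply: eq_bigr => x _.
    by elim: (s) => [|mu t IH]; rewrite ?big_nil ?ffunE // !big_cons ffunE IH.
  have -> : size s = (\sum_(mu <- s) 1)%N by rewrite sum1_size.
  rewrite !big_seq; apply: leq_sum => mu /sP[[mu0 _ _] _]; rewrite lt0n.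
  apply: contra mu0; rewrite sum_nat_eq0 => /forallP mu0; apply/eqP/ffunP => x.
  by have := mu0 x; rewrite ffunE => /eqP.
have le_mu x : (mu x <= N)%N.
  apply: (@leq_trans (lam x)); last by rewrite /N (bigD1 x) //= leq_addr.
  by rewrite -sumE (big_rem mu mus) /= ffunE leq_addr.
apply/codomP; exists [ffun x => inord (mu x)].
by apply/ffunP => x; rewrite !ffunE inordK // ltnS.
Qed.

(** * Double flags *)

Section Flags.
Variables (K : fieldType) (V : vectType K).

(** The flags of arms A, B, C stop at V1, V2, V3; with the default [fullv] their level [l j] reads
    as V, as required by [object]. *)
Definition flag_level (F : seq {vspace V}) i := nth fullv (0%VS :: F) i.

Definition level (F : point V) j i := flag_level (F j) i.

Lemma is_flagP (W : {vspace V}) (d : seq nat) (F : seq {vspace V}) :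
  is_flag W d F <->
  [/\ size F = size d, flag_level F (size d) = W &
      forall i, (i < size d)%N -> (flag_level F i <= flag_level F i.+1)%VS /\
        \dim (flag_level F i.+1) = (\dim (flag_level F i) + nth 0%N d i)%N].
Proof.
have E (sF : size F = size d) i : (i < size d)%N ->
    nth 0%VS (0%VS :: F) i = flag_level F i /\ nth 0%VS F i = flag_level F i.+1.
  move=> lt_i; rewrite /flag_level; split; apply: set_nth_default; rewrite /= sF //.
  exact: leqW.
have L (sF : size F = size d) : flag_level F (size d) = last 0%VS F.
  by rewrite -sF /flag_level (nth_last fullv (0%VS :: F)).
split=> -[sF lF stepF]; split=> //; rewrite ?L // -?L // => i lt_i.
  by have := stepF i lt_i; have [-> ->] := E sF i lt_i.
by have := stepF i lt_i; have [-> ->] := E sF i lt_i.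
Qed.

End Flags.

Lemma balanced_sum (l : 'I_4 -> nat) (s : seq (quad l)) :
  (forall mu, mu \in s -> in_Lambda mu) ->
  balanced (\sum_(mu <- s) mu) (\sum_(mu <- s) total mu)%N.
Proof.
elim: s => [|mu s IHs] sL; first by rewrite !big_nil; apply: balanced0.
rewrite !big_cons; apply: balancedD; first by apply/Lambda_balanced/sL/mem_head.
by apply: IHs => nu nus; apply: sL; rewrite inE nus orbT.
Qed.

Lemma brick_isom (K : fieldType) (l : 'I_4 -> nat) (V W : vectType K)
    (U : config V) (U' : config W) :
  isom l U U' -> brick l U -> brick l U'.
Proof.
move=> [h iso_h] bU f fU; have [hU gU gh hg] := isomorphism_inv iso_h.
have hgv v : h ((h^-1)%VF v) = v by rewrite -comp_lfunE hg id_lfunE.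
have [c cE] := bU _ (mor_comp (mor_comp gU fU) hU).
exists c; apply/lfunP => w; have /lfunP/(_ ((h^-1)%VF w))/(congr1 h) := cE.
by rewrite !comp_lfunE !hgv !scale_lfunE !id_lfunE linearZ /= hgv.
Qed.

(** * Points of the double flag variety as configurations *)

Section PointsAndObjects.
Variables (K : closedFieldType) (l : 'I_4 -> nat).
Hypothesis l_gt0 : forall j, (0 < l j)%N.
Hypothesis charK0 : has_char0 K.
Variables (lam : quad l) (V : vectType K) (V1 V2 V3 : {vspace V}).
Hypothesis lamL : in_Lambda lam.
Hypotheses (dimV1 : \dim V1 = sumn (chop (part lam armA)))
           (dimV2 : \dim V2 = sumn (chop (part lam armB)))
           (dimV3 : \dim V3 = sumn (chop (part lam armC))).
Hypothesis sumV : (V1 + V2 + V3)%VS = fullv.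
Hypothesis dirV : directv (V1 + V2 + V3).

(** Arm D receives the default 0, so that sums over all arms are V1 + V2 + V3. *)
Definition blocks (j : 'I_4) : {vspace V} := nth 0%VS [:: V1; V2; V3] j.

Lemma sum_blocks : (\sum_j blocks j)%VS = fullv.
Proof. by rewrite big_I4 /blocks /= addv0. Qed.

Lemma directv_blocks : directv (\sum_j blocks j).
Proof.
rewrite directvE /= big_I4 /blocks /= addv0 big_I4 /= dimv0 addn0.
by have := dirV; rewrite directvE.
Qed.

Lemma dim_blocks j : \dim (blocks j) = (\sum_(i < lenC l j) ent lam j i)%N.
Proof.
rewrite /lenC; case: eqP => [->|/eqP ne_jD]; first by rewrite big_ord0 /blocks dimv0.
rewrite -sumn_chop /blocks.
have [-> //|[-> //|[-> //|jD]]] : j = armA \/ j = armB \/ j = armC \/ j = armD.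
  case: j ne_jD => [[|[|[|[|//]]]]] ltj _;
    by [left; apply: val_inj | right; left; apply: val_inj
       | right; right; left; apply: val_inj | right; right; right; apply: val_inj].
by rewrite jD eqxx in ne_jD.
Qed.

Lemma dim_full : \dim {: V} = total lam.
Proof.
have [_ sumC] := Lambda_balanced lamL.
rewrite -sum_blocks (directvP directv_blocks) -sumC /=.
by apply: eq_bigr => j _; rewrite dim_blocks.
Qed.

Definition flag_len (j : 'I_4) := if j == armD then l j else (l j).-1.

Definition flag_dims (j : 'I_4) := if j == armD then part lam j else chop (part lam j).

Lemma size_flag_dims j : size (flag_dims j) = flag_len j.
Proof.
rewrite /flag_dims /flag_len; case: eqP => _; rewrite ?size_part //.
by rewrite /chop size_takel size_part // leq_pred.
Qed.

Lemma nth_flag_dims j i : (i < flag_len j)%N -> nth 0%N (flag_dims j) i = ent lam j i.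
Proof.
rewrite /flag_dims /flag_len; case: eqP => // _ lt_i.
by rewrite /chop nth_take // size_part.
Qed.

Definition flag_top j := if j == armD then fullv else blocks j.

Lemma double_flagE (F : point V) : double_flag V1 V2 V3 lam F <->
  forall j, is_flag (flag_top j) (flag_dims j) (F j).
Proof.
split=> [[FA FB FC FD] j|FP]; last first.
  by split; [have := FP armA | have := FP armB | have := FP armC | have := FP armD].
by case: j => [[|[|[|[|//]]]]] ltj;
  [have -> : Ordinal ltj = armA by apply: val_inj | have -> : Ordinal ltj = armB by apply: val_inj
  |have -> : Ordinal ltj = armC by apply: val_inj | have -> : Ordinal ltj = armD by apply: val_inj].
Qed.

Lemma flag_len_le j : (flag_len j <= l j)%N.
Proof. by rewrite /flag_len; case: eqP => // _; rewrite leq_pred. Qed.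

Lemma flag_len_cases j i : (i <= l j)%N -> (i <= flag_len j)%N \/ (j != armD /\ i = l j).
Proof.
rewrite /flag_len; case: eqP => [_ ->|/eqP ne]; first by left.
rewrite leq_eqVlt => /predU1P[->|lt_il]; first by right.
by left; rewrite -ltnS prednK.
Qed.

Lemma level_last (F : point V) j : j != armD -> size (F j) = flag_len j -> level F j (l j) = fullv.
Proof.
move=> ne_jD sF; rewrite /level /flag_level nth_default //= sF /flag_len (negPf ne_jD).
by rewrite prednK.
Qed.

Lemma lenC_flag_len j : j != armD -> lenC l j = flag_len j.
Proof. by rewrite /lenC /flag_len => /negPf->. Qed.

(** The dictionary through which orbit questions become questions on configurations; the sizes make
    the sequences determined by their levels. *)
Lemma double_flagP (F : point V) : double_flag V1 V2 V3 lam F <->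
  [/\ forall j, size (F j) = flag_len j, object l (level F), dimq l (level F) = lam &
      forall j, level F j (lenC l j) = blocks j].
Proof.
have [sums _] := Lambda_balanced lamL.
rewrite double_flagE; split=> [FP|[sF oF dF tF] j]; last first.
  have [U0 Uinc Ul _ _] := oF.
  apply/is_flagP; rewrite size_flag_dims; split=> // [|i lt_i].
    rewrite /flag_top; case: eqP => [->|/eqP ne_jD].
      by rewrite -(Ul armD) /flag_len eqxx.
    by rewrite -tF lenC_flag_len.
  have lt_il : (i < l j)%N := leq_trans lt_i (flag_len_le j).
  rewrite nth_flag_dims // -dF ent_dimq //; split; first exact: Uinc.
  by rewrite subnKC // dimvS // (Uinc j i lt_il).
have {FP} FP j := (is_flagP _ _ _).1 (FP j).
have sF j : size (F j) = flag_len j by have [-> _ _] := FP j; rewrite size_flag_dims.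
have F_top j : level F j (flag_len j) = flag_top j.
  by have [_ + _] := FP j; rewrite size_flag_dims.
have F_step j i : (i < flag_len j)%N -> (level F j i <= level F j i.+1)%VS /\
    \dim (level F j i.+1) = (\dim (level F j i) + ent lam j i)%N.
  move=> lt_i; have [_ _ /(_ i)] := FP j; rewrite size_flag_dims nth_flag_dims //.
  exact.
have F_block j : level F j (lenC l j) = blocks j.
  have [->|ne_jD] := eqVneq j armD; first by rewrite /lenC eqxx.
  by rewrite lenC_flag_len // F_top /flag_top (negPf ne_jD).
have F_full j : level F j (l j) = fullv.
  have [->|ne_jD] := eqVneq j armD; last exact: level_last.
  by have := F_top armD; rewrite /flag_len /flag_top eqxx.
have oF : object l (level F).
  split=> // [j i lt_il||].
  - have [lt_i|[ne_jD il]] := flag_len_cases lt_il; first by have [] := F_step _ _ lt_i.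
    by rewrite il F_full subvf.
  - by rewrite (eq_bigr blocks) ?sum_blocks.
  have := directv_blocks; rewrite !directvE /= => /eqP dB; apply/eqP.
  by rewrite (eq_bigr blocks) // dB; apply: eq_bigr => j _; rewrite F_block.
split=> //; apply: eq_quad => j i lt_il; rewrite ent_dimq //.
have [lt_i|[ne_jD il]] := flag_len_cases lt_il.
  by have [_ ->] := F_step _ _ lt_i; rewrite addKn.
(* The last entry on arms A, B, C is not imposed by the flags: it is |lam| minus the earlier
   entries, which is the codimension of the block in V. *)
have iE : i = (l j).-1 by rewrite -il.
rewrite il F_full dim_full -(sums j) iE.
have -> : level F j (l j).-1 = blocks j.
  by rewrite -F_block lenC_flag_len // /flag_len (negPf ne_jD).
rewrite dim_blocks lenC_flag_len // /flag_len (negPf ne_jD).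
by rewrite -[in X in (X - _)%N](prednK (l_gt0 j)) big_ord_recr /= addKn.
Qed.

Lemma exists_point (U : config V) :
  object l U -> dimq l U = lam -> (forall j, U j (lenC l j) = blocks j) ->
  exists F : point V, double_flag V1 V2 V3 lam F /\
    forall j i, (i <= l j)%N -> level F j i = U j i.
Proof.
move=> oU dU tU; have [U0 Uinc Ul _ _] := oU.
pose F : point V := [ffun j => mkseq (fun i => U j i.+1) (flag_len j)].
have sF j : size (F j) = flag_len j by rewrite ffunE size_mkseq.
have levF j i : (i <= l j)%N -> level F j i = U j i.
  move=> le_il; have [le_i|[ne_jD ->]] := flag_len_cases le_il; last by rewrite level_last ?Ul.
  case: i le_i {le_il} => [|i] lt_i; first by rewrite U0.
  by rewrite /level /flag_level /= ffunE nth_mkseq.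
exists F; split=> //; apply/double_flagP; split=> //.
- apply: (@isom_object _ _ _ _ U) => //; apply: isom_ext => j i le_il.
  by rewrite levF.
- rewrite -dU; apply: esym; apply: isom_dimq; apply: isom_ext => j i le_il.
  by rewrite levF.
by move=> j; rewrite levF ?lenC_le.
Qed.

Lemma level_act (h g : 'End(V)) (F : point V) j i :
  lker h = 0%VS -> lker g = 0%VS ->
  level (act h g F) j i = act2 h g (level F) j i.
Proof.
move=> h0 g0; rewrite /level /flag_level /act ffunE /act2.
set k := if _ then g else h; have kf : limg k = fullv.
  by rewrite /k; case: ifP => _; apply: lker0_full.
case: i => [|i] /=; first by rewrite limg0.
have [lt_i|le_i] := ltnP i (size (F j)); first by rewrite (nth_map fullv).
by rewrite !nth_default ?size_map // kf.
Qed.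

Lemma eq_point (F F' : point V) :
  (forall j, size (F j) = size (F' j)) -> (forall j, size (F j) = flag_len j) ->
  (forall j i, (i <= l j)%N -> level F j i = level F' j i) -> F = F'.
Proof.
move=> eqs sF levFF'; apply/ffunP => j; apply: (@eq_from_nth _ fullv) => // i.
rewrite sF => lt_i; exact: (levFF' j i.+1 (leq_trans lt_i (flag_len_le j))).
Qed.

Lemma in_L_blocks (h : 'End(V)) : in_L V1 V2 V3 h <->
  lker h = 0%VS /\ forall j, (h @: blocks j)%VS = blocks j.
Proof.
split=> [[/eqP h0 h1 h2 h3]|[h0 hB]].
  split=> // -[[|[|[|[|//]]]] ltj] //=; exact: limg0.
by split; [apply/eqP | apply: (hB armA) | apply: (hB armB) | apply: (hB armC)].
Qed.

(** An isomorphism between two points preserves the ends V1, V2, V3 of the arms, hence belongs to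
    L. *)
Lemma same_orbit_isom (F F' : point V) :
  double_flag V1 V2 V3 lam F -> double_flag V1 V2 V3 lam F' ->
  same_orbit V1 V2 V3 F F' <-> isom l (level F) (level F').
Proof.
move=> /double_flagP[sF oF dF tF] /double_flagP[sF' oF' dF' tF'].
split=> [[h /in_L_blocks[h0 hB] F'E]|[h [h0 hf hU]]].
  exists h; split=> // [|j i _]; first exact: lker0_full.
  by rewrite F'E level_act // /act2; case: ifP.
exists h.
  apply/in_L_blocks; split=> // j.
  by rewrite -tF hU ?lenC_le // tF'.
apply: eq_point => // j; first by rewrite sF' ffunE size_map sF.
move=> i le_il; rewrite level_act // /act2; case: ifP => _; by rewrite hU.
Qed.

Lemma act_double_flag (h g : 'End(V)) (F : point V) :
  in_L V1 V2 V3 h -> in_GL g -> double_flag V1 V2 V3 lam F ->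
  double_flag V1 V2 V3 lam (act h g F).
Proof.
move=> /in_L_blocks[h0 hB] /eqP g0 /double_flagP[sF oF dF tF]; apply/double_flagP.
have isoA : isom l (act2 h g (level F)) (level (act h g F)).
  by apply: isom_ext => j i _; rewrite level_act.
split.
- by move=> j; rewrite ffunE size_map.
- by apply: (isom_object isoA) => //; apply: act2_object.
- by rewrite -(isom_dimq isoA) act2_dimq.
move=> j; rewrite level_act // /act2; case: eqP => [->|_]; last by rewrite tF.
by rewrite /lenC eqxx /level /flag_level /= limg0.
Qed.

Lemma act_transitive (F F' : point V) :
  double_flag V1 V2 V3 lam F -> double_flag V1 V2 V3 lam F' ->
  exists h g : 'End(V), [/\ in_L V1 V2 V3 h, in_GL g & F' = act h g F].
Proof.
move=> /double_flagP[sF oF dF tF] /double_flagP[sF' oF' dF' tF'].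
have [h [g [h0 g0 hf gf hgU]]] := act2_transitive l_gt0 oF oF' (etrans dF (esym dF')).
have hB j : (h @: blocks j)%VS = blocks j.
  rewrite -[in LHS]tF -tF'; have := hgU j _ (lenC_le l j); case: eqP => // -> _.
  by rewrite /lenC eqxx limg0.
exists h, g; split; [by apply/in_L_blocks | by apply/eqP |].
apply: eq_point => // j; first by rewrite sF' ffunE size_map sF.
by move=> i le_il; rewrite level_act // /act2 hgU.
Qed.

(** U is compared with a configuration over V1, V2, V3: the h given by [act2_transitive] carries the
    ends of the arms of U to these subspaces, and U itself to a point. *)
Lemma exists_point_isom (U : config V) :
  object l U -> dimq l U = lam ->
  exists F : point V, double_flag V1 V2 V3 lam F /\ isom l U (level F).
Proof.
move=> oU dU.
have bal : balanced lam (\dim {: V}) by rewrite dim_full; apply: Lambda_balanced.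
have [U0 [oU0 dU0 tU0]] := exists_object_over l_gt0 bal directv_blocks sum_blocks dim_blocks.
have [h [g [h0 g0 hf gf hgU]]] := act2_transitive l_gt0 oU oU0 (etrans dU (esym dU0)).
pose U' := fun j i => (h @: U j i)%VS.
have isoU' : isom l U U' by exists h.
have [F [FP FE]] : exists F : point V, double_flag V1 V2 V3 lam F /\
    forall j i, (i <= l j)%N -> level F j i = U' j i.
  apply: exists_point; first exact: (isom_object isoU' oU).
    by rewrite -(isom_dimq isoU').
  move=> j; have := hgU j _ (lenC_le l j); rewrite tU0 /U'; case: eqP => // -> _.
  have [-> _ _ _ _] := oU; rewrite limg0 -(tU0 armD) /lenC eqxx.
  by have [-> _ _ _ _] := oU0.
exists F; split=> //; apply: (isom_trans isoU'); apply: isom_ext => j i le_il.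
by rewrite FE.
Qed.

Lemma finite_type_of_orbits : finitely_many_orbits V1 V2 V3 lam -> finite_type V lam.
Proof.
move=> [s sP]; exists (size s), (fun k => level (nth [ffun=> [::]] s k)) => U oU dU.
have [F [FP iso]] := exists_point_isom oU dU.
have [F' F's [h /in_L_blocks[h0 hB] FE]] := sP F FP.
have ltk : (index F' s < size s)%N by rewrite index_mem.
exists (Ordinal ltk); rewrite /= nth_index //; apply: isom_trans (isom_sym iso).
exists h; split=> // [|j i _]; first exact: lker0_full.
by rewrite FE level_act // /act2; case: ifP.
Qed.

Lemma finiteness_of_orbits :
  finitely_many_orbits V1 V2 V3 lam -> finiteness_condition lam.
Proof.
move=> /finite_type_of_orbits finV mu muL [nu [nuL lamE]].
have nuB : balanced nu (total nu).
  case: nuL => [/Lambda_balanced //|->].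
  by rewrite (balanced_total (balanced0 l)); apply: balanced0.
apply: (finite_type_summand l_gt0 nuB muL (V := V)); last by rewrite -lamE.
by rewrite dim_full lamE (balanced_total (balancedD (Lambda_balanced muL) nuB)).
Qed.

Lemma double_flag_splits (F : point V) : double_flag V1 V2 V3 lam F ->
  exists s : seq (quad l), splits (level F) s.
Proof. by move=> /double_flagP[_ oF _ _]; apply: exists_splits. Qed.

Lemma double_flag_decomposition (F : point V) (s : seq (quad l)) :
  finiteness_condition lam -> double_flag V1 V2 V3 lam F -> splits (level F) s ->
  decomposition lam s.
Proof.
move=> finL /double_flagP[_ oF dF _] sF; rewrite -dF.
by apply: (splits_decomposition l_gt0 oF); rewrite ?dF.
Qed.

Lemma same_orbit_splits (F F' : point V) (s s' : seq (quad l)) :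
  finiteness_condition lam -> double_flag V1 V2 V3 lam F -> double_flag V1 V2 V3 lam F' ->
  splits (level F) s -> splits (level F') s' ->
  same_orbit V1 V2 V3 F F' <-> perm_eq s s'.
Proof.
move=> finL FP FP' sF sF'.
have [_ oF dF _] := (double_flagP F).1 FP; have [_ oF' dF' _] := (double_flagP F').1 FP'.
rewrite same_orbit_isom //; split=> [iso|].
  by apply: (splits_unique l_gt0 charK0 oF _ iso); rewrite ?dF.
by apply: (isom_of_splits l_gt0 oF oF'); rewrite ?dF ?dF'.
Qed.

Lemma double_flag_of_decomposition (s : seq (quad l)) :
  finiteness_condition lam -> decomposition lam s ->
  exists2 F : point V, double_flag V1 V2 V3 lam F & splits (level F) s.
Proof.
move=> finL [_ sumE sP].
have [|W [U [oU sU dU]]] := @realize_splitting K l l_gt0 s.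
  move=> mu mus; have [muL mu1] := sP mu mus; split=> //.
  apply: finiteness_summand finL; exists (\sum_(nu <- rem mu s) nu).
  split; last by rewrite -sumE (big_rem mu).
  apply: (@balanced_or0 _ _ (\sum_(nu <- rem mu s) total nu)%N).
  apply: balanced_sum => nu /mem_rem/sP[nuL _]; exact: nuL.
have dimW : \dim {: W} = \dim {: V}.
  by rewrite dim_full -sumE -dU total_dimq.
have [U' iso] := isom_transport l U dimW.
have oU' := isom_object iso oU; have sU' := splits_isom oU iso sU.
have [|F [FP iso']] := exists_point_isom oU'; first by rewrite -(isom_dimq iso) dU.
by exists F => //; apply: splits_isom iso' sU'.
Qed.

Lemma orbits_of_finiteness :
  finiteness_condition lam -> finitely_many_orbits V1 V2 V3 lam.
Proof.
move=> finL; have [L LP] := finitely_many_decompositions lam.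
(* One representative is chosen for each candidate splitting type that occurs. *)
have [Fs FsP] : exists Fs : seq (point V), forall F s, double_flag V1 V2 V3 lam F ->
    s \in L -> splits (level F) s ->
    exists F', [/\ F' \in Fs, double_flag V1 V2 V3 lam F' & splits (level F') s].
  elim: (L) => [|s L' [Fs IH]]; first by exists [::].
  have [[F [FP Fs0]]|nF] := classic (exists F, double_flag V1 V2 V3 lam F /\ splits (level F) s).
    exists (F :: Fs) => F' s' F'P; rewrite inE => /predU1P[-> _|s'L sF'].
      by exists F; rewrite mem_head.
    by have [F'' [F''s F''P sF'']] := IH F' s' F'P s'L sF'; exists F''; rewrite inE F''s orbT.
  exists Fs => F' s' F'P; rewrite inE => /predU1P[-> sF'|s'L sF']; last exact: (IH F' s').
  by case: nF; exists F'.
exists Fs => F FP; have [s sF] := double_flag_splits FP.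
have [F' [F's F'P sF']] := FsP F s FP (LP s (double_flag_decomposition finL FP sF)) sF.
by exists F' => //; apply/(same_orbit_splits finL F'P FP sF' sF).
Qed.

Lemma orbits_bijection : finiteness_condition lam ->
  exists f : point V -> seq (quad l),
    quotient_bijection (double_flag V1 V2 V3 lam) (same_orbit V1 V2 V3)
      (decomposition lam) (fun s t => perm_eq s t) f.
Proof.
move=> finL.
(* The map sends a point to some splitting type of it, selected by choice; permutations account for
   the ambiguity. *)
pose f (F : point V) := epsilon (inhabits [::]) (fun s : seq (quad l) => splits (level F) s).
have fP F : double_flag V1 V2 V3 lam F -> splits (level F) (f F).
  by move=> /double_flag_splits FP; apply: epsilon_spec.
exists f; split=> [F FP|F F' FP F'P|s sP].
- exact: double_flag_decomposition (fP F FP).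
- exact: same_orbit_splits (fP F FP) (fP F' F'P).
have [F FP sF] := double_flag_of_decomposition finL sP; exists F => //.
apply: (same_orbit_splits finL FP FP (fP F FP) sF).1.
exact/same_orbit_isom/isom_refl.
Qed.

Notation EE := ('End(V) * 'End(V))%type.

Lemma polymap_fst : polymap (fun x : EE => x.1).
Proof. by apply: (@polymap_linear _ EE EE _ id fst) => //; apply: polymap_id. Qed.

Lemma polymap_snd : polymap (fun x : EE => x.2).
Proof. by apply: (@polymap_linear _ EE EE _ id snd) => //; apply: polymap_id. Qed.

Lemma act_id (F : point V) : act \1%VF \1%VF F = F.
Proof.
by apply/ffunP => j; rewrite ffunE -[RHS]map_id; apply: eq_map => U; case: ifP; rewrite lim1g.
Qed.

Lemma in_L_id : in_L V1 V2 V3 (\1%VF : 'End(V)).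
Proof. by split; rewrite ?lim1g // /in_GL lker_id. Qed.

(** Translate by (h0, g0): the polynomial deforming the moved point near (1, 1) is evaluated at (h
    h0^-1, g g0^-1). *)
Lemma rigid_neighbourhood (F : point V) (h0 g0 : 'End(V)) :
  double_flag V1 V2 V3 lam F -> in_L V1 V2 V3 h0 -> in_GL g0 ->
  rigid l (level (act h0 g0 F)) ->
  exists psi : EE -> K, [/\ polyfun psi, psi (h0, g0) != 0 &
    forall h g, in_L V1 V2 V3 h -> in_GL g -> psi (h, g) != 0 ->
      same_orbit V1 V2 V3 (act h0 g0 F) (act h g F)].
Proof.
move=> FP h0L g0G rF; set F1 := act h0 g0 F in rF *.
have F1P : double_flag V1 V2 V3 lam F1 by apply: act_double_flag.
have [_ oF1 _ _] := (double_flagP F1).1 F1P.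
have [h00 _] := (in_L_blocks h0).1 h0L; have g00 := eqP g0G.
have [phi [phiP phi1 phiU]] := rigid_deformation rF.
exists (fun x : EE => phi ((x.1 \o h0^-1)%VF, (x.2 \o g0^-1)%VF)); split.
- apply: (polyfun_comp (F := fun x : EE => ((x.1 \o h0^-1)%VF, (x.2 \o g0^-1)%VF))) phiP.
  apply: polymap_pair; apply: polymap_comp_lfun;
    by [exact: polymap_fst | exact: polymap_snd | exact: polymap_const].
- by rewrite /= !lker0_compfV ?h00 ?g00.
move=> h g hL gG /= /phiU[c [p [cU pU c0 p0 cp]]].
have [h1 _] := (in_L_blocks h).1 hL; have g1 := eqP gG.
have lk (f k : 'End(V)) : lker f = 0%VS -> lker k = 0%VS -> lker (f \o k^-1)%VF = 0%VS.
  move=> /eqP f0 /eqP k0; apply: lker0_comp; first exact/eqP.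
  by apply/eqP/lker0P => v w /(congr1 k); rewrite !lker0_lfunVK.
apply/same_orbit_isom => //; first exact: act_double_flag.
have iso := act2_isom_of l_gt0 oF1 (lk _ _ h1 h00) (lk _ _ g1 g00) c0 p0 cU pU cp.
apply: (isom_trans (ex_intro _ _ iso)); apply: isom_ext => j i le_il.
rewrite level_act // /act2 level_act // /act2 -limg_comp; case: ifP => _;
  by rewrite -comp_lfunA lker0_compVf ?comp_lfun1r //; apply/eqP.
Qed.

Lemma flag_open_rigid (F0 : point V) :
  double_flag V1 V2 V3 lam F0 -> rigid l (level F0) ->
  flag_open V1 V2 V3 lam (same_orbit V1 V2 V3 F0).
Proof.
move=> F0P rF0 F FP.
(* Take all polynomials whose non-vanishing locus within the group maps into the orbit;
   [rigid_neighbourhood] provides one at each point of the orbit. *)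
exists (fun p => forall x : EE, in_L V1 V2 V3 x.1 /\ in_GL x.2 -> p.@[crd x] != 0 ->
  same_orbit V1 V2 V3 F0 (act x.1 x.2 F)) => -[h0 g0] [/= h0L g0G].
split=> [F0F1|[p pP pN]]; last exact: (pP (h0, g0) (conj h0L g0G) pN).
have F1P := act_double_flag h0L g0G FP.
have iso1 := (same_orbit_isom F0P F1P).1 F0F1.
have [psi [[p pE] psi0 psiP]] := rigid_neighbourhood FP h0L g0G (rigid_isom iso1 rF0).
exists p; last by rewrite -[X in X != 0]pE.
move=> [h g] [/= hL gG]; rewrite -pE => /(psiP h g hL gG) F1F2.
have F2P := act_double_flag hL gG FP.
by apply/same_orbit_isom => //; apply: isom_trans iso1 _; apply/same_orbit_isom.
Qed.

(* The double flag variety is irreducible: two points are joined by the orbit of a line in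
   End(V) x End(V), on which polynomials have finitely many zeros. *)
Lemma flag_open_meet (U U' : point V -> Prop) (F F' : point V) :
  flag_open V1 V2 V3 lam U -> flag_open V1 V2 V3 lam U' ->
  double_flag V1 V2 V3 lam F -> U F -> double_flag V1 V2 V3 lam F' -> U' F' ->
  exists2 G, double_flag V1 V2 V3 lam G & U G /\ U' G.
Proof.
move=> openU openU' FP UF F'P; have [h1 [g1 [h1L g1G ->]]] := act_transitive FP F'P => U'F'.
have [S SU] := openU F FP; have [S' S'U] := openU' F FP.
have [] := SU (\1%VF, \1%VF); first by split; [exact: in_L_id | rewrite /in_GL lker_id].
rewrite /= act_id => /(_ UF)[p Sp pN] _.
have [/(_ U'F')[p' S'p' p'N] _] := S'U (h1, g1) (conj h1L g1G).
have [|t tP] := @polyfun_line_common K EE [:: fun x => p.@[crd x]; fun x => p'.@[crd x];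
    fun x => dete x.1; fun x => dete x.2] (\1%VF, \1%VF) (h1, g1).
  move=> _ [<-|[<-|[<-|[<-|[]]]]]; split.
  - by exists p.
  - by left.
  - by exists p'.
  - by right.
  - exact: polyfun_comp polymap_fst (polyfun_dete V).
  - by left; apply: dete1.
  - exact: polyfun_comp polymap_snd (polyfun_dete V).
  by left; apply: dete1.
set h := (1 - t) *: \1%VF + t *: h1; set g := (1 - t) *: \1%VF + t *: g1.
have hgE : (1 - t) *: (\1%VF, \1%VF) + t *: (h1, g1) = (h, g) :> EE by [].
rewrite hgE in tP.
have p_hg := tP _ (or_introl (erefl _)).
have p'_hg := tP _ (or_intror (or_introl (erefl _))).
have /= := tP _ (or_intror (or_intror (or_introl (erefl _)))); rewrite dete_neq0 => h0.
have /= := tP _ (or_intror (or_intror (or_intror (or_introl (erefl _))))).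
rewrite dete_neq0 => g0.
have [_ h1B] := (in_L_blocks h1).1 h1L.
have hL : in_L V1 V2 V3 h.
  apply/in_L_blocks; split=> [|j]; first exact/eqP.
  apply/eqP; rewrite eqEdim limg_dim_eq ?(eqP h0) ?capv0 // leqnn andbT.
  apply/subvP => _ /memv_imgP[v vB ->]; rewrite add_lfunE !scale_lfunE id_lfunE.
  by rewrite memvD ?memvZ // -(h1B j) memv_img.
exists (act h g F); first exact: act_double_flag.
split; first by apply: ((SU (h, g) (conj hL g0)).2); exists p.
by apply: ((S'U (h, g) (conj hL g0)).2); exists p'.
Qed.

Lemma open_dense_of_rigid (F : point V) :
  double_flag V1 V2 V3 lam F -> rigid l (level F) -> open_dense_orbit V1 V2 V3 lam F.
Proof.
move=> FP rF; have openF := flag_open_rigid FP rF; split=> // U openU [F' F'P UF'].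
apply: (flag_open_meet openU openF F'P UF' FP).
exact/same_orbit_isom/isom_refl.
Qed.

(** A dense orbit meets the open orbit of the rigid point, and two orbits that meet coincide. *)
Lemma open_dense_orbit_unique (F F' : point V) :
  open_dense_orbit V1 V2 V3 lam F -> double_flag V1 V2 V3 lam F' -> rigid l (level F') ->
  isom l (level F) (level F').
Proof.
move=> [FP _ denseF] F'P rF'.
have [|G GP [F'G FG]] := denseF _ (flag_open_rigid F'P rF').
  by exists F' => //; apply/same_orbit_isom/isom_refl.
apply: (isom_trans ((same_orbit_isom FP GP).1 FG)); apply: isom_sym.
exact: ((same_orbit_isom F'P GP).1 F'G).
Qed.

End PointsAndObjects.

(** * Representations of the star quiver *)

Section StarReps.
Variables (K : fieldType) (l : 'I_4 -> nat).

Lemma vtxP j i :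
  (exists2 i' : 'I_(l j).-1, nat_of_ord i' = i &
     vtx l j i = Some (Tagged (fun j => 'I_(l j).-1) i')) \/
  ((l j).-1 <= i)%N /\ vtx l j i = center l.
Proof.
rewrite /vtx; case: insubP => [i' _ <-|]; first by left; exists i'.
by rewrite -leqNgt; right.
Qed.

(** Induction along each arm, from the center outwards against the arrows. *)
Lemma vertex_ind (Q : vertex l -> Prop) :
  Q (center l) -> (forall a, Q (tgt a) -> Q (src a)) -> forall v, Q v.
Proof.
move=> Qc Qa [[j i]|//]; have [n le_n] := ubnP ((l j).-1 - i)%N.
elim: n i le_n => // n IHn i le_n; apply: Qa; rewrite /tgt /=.
have [[i' i'E ->]|[_ ->] //] := vtxP j i.+1.
by apply: IHn; rewrite i'E; have := ltn_ord i; lia.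
Qed.

Lemma rep_zero_center (rho : rep K l) :
  in_Rep' rho -> \dim {: rep_space rho (center l)} = 0%N -> rep_zero rho.
Proof.
move=> [inj _ _] dim0; apply: vertex_ind => // a dim_a.
apply/eqP; rewrite -leqn0 -[in leqRHS]dim_a -(limg_dim_eq (f := rep_map rho a)).
  exact: dimvS (subvf _).
by rewrite (eqP (inj a)) capv0.
Qed.

Lemma rep_sum_mapE (rho sigma : rep K l) a
    (x : (rep_space rho (src a) * rep_space sigma (src a))%type) :
  rep_map (rep_sum rho sigma) a x = (rep_map rho a x.1, rep_map sigma a x.2).
Proof. by rewrite linfun_linear // => c y z; rewrite /= !linearP. Qed.

Lemma dim_last_image (rho : rep K l) j :
  \dim (last_image rho j) = (\sum_(i < (l j).-1 | i.+1 == (l j).-1)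
     \dim (image_at rho (center l) (Tagged (fun j => 'I_(l j).-1) i)))%N.
Proof.
rewrite /last_image; case: (pickP (fun i : 'I_(l j).-1 => i.+1 == (l j).-1)) => [i0 i0E|no_i].
  have i0P : (fun i : 'I_(l j).-1 => i.+1 == (l j).-1) =1 pred1 i0.
    move=> i /=; apply/eqP/eqP => [iE|->]; last exact/eqP.
    by apply/val_inj/succn_inj; rewrite -/(nat_of_ord _) iE (eqP i0E).
  by rewrite !(big_pred1 i0).
by rewrite !big_pred0 // dimv0.
Qed.

Lemma image_at_tgt (rho : rep K l) a v (e : tgt a = v) :
  image_at rho v a = ecast w {vspace rep_space rho w} e (limg (rep_map rho a)).
Proof. by rewrite /image_at; case: eqP => // e'; rewrite (eq_irrelevance e' e). Qed.

End StarReps.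

(** * The representation attached to a point *)

Section RepOfPoint.
Variables (K : fieldType) (l : 'I_4 -> nat) (V : vectType K) (F : point V).
Hypothesis l_gt0 : forall j, (0 < l j)%N.
Hypothesis oF : object l (level F).

Lemma point_space_vtx j i : (i < l j)%N -> point_space F (vtx l j i) = level F j i.+1.
Proof.
move=> lt_il; have [[i' i'E ->]|[le_li ->]] := vtxP l j i; first by rewrite /= i'E.
have -> : i.+1 = l j by have := l_gt0 j; lia.
by have [_ _ ->] := oF.
Qed.

Lemma point_space_arrow (a : arrow l) :
  (point_space F (src a) <= point_space F (tgt a))%VS.
Proof.
case: a => j i; have lt_i : (i.+1 < l j)%N by have := ltn_ord i; lia.
rewrite /tgt point_space_vtx //; have [_ Uinc _ _ _] := oF; exact: (Uinc j i.+1 lt_i).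
Qed.

Lemma rep_of_point_mapE (a : arrow l) (x : subvs_of (point_space F (src a))) :
  vsval (rep_map (rep_of_point l F) a x) = vsval x.
Proof. by rewrite lfunE /= vsprojK // (subvP (point_space_arrow a)) ?subvsP. Qed.

Lemma rep_of_point_dim (x : {j : 'I_4 & 'I_(l j)}) :
  dim_vector (rep_of_point l F) x = (dimq l (level F) x)%:Z.
Proof.
have [U0 Uinc _ _ _] := oF; rewrite /dim_vector [in RHS]entE.
case: x => j i /=; rewrite ent_dimq //.
have dimE k : (k < l j)%N -> \dim {: subvs_of (point_space F (vtx l j k))} = \dim (level F j k.+1).
  by move=> lt_k; rewrite dim_subvs point_space_vtx.
have := ltn_ord i; rewrite dimE //; move: (nat_of_ord i) => [|k] lt_k.
  by rewrite U0 dimv0 subn0 subr0.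
rewrite dimE ?(ltnW lt_k) // -subzn //; exact: dimvS (Uinc _ _ _).
Qed.

Lemma limg_vsval (v : vertex l) (a : arrow l) (e : tgt a = v) :
  (linfun (vsval : subvs_of (point_space F v) -> V) @:
     (image_at (rep_of_point l F) v a : {vspace subvs_of (point_space F v)}))%VS =
  point_space F (src a).
Proof.
rewrite (image_at_tgt _ e); case: v / e => /=; apply/vspaceP => w.
apply/memv_imgP/idP => [[_ /memv_imgP[y _ ->] ->]|wU].
  by rewrite lfunE /= rep_of_point_mapE subvsP.
exists (rep_map (rep_of_point l F) a (vsproj (point_space F (src a)) w)).
  exact: memv_img (memvf _).
by rewrite lfunE /= rep_of_point_mapE vsprojK.
Qed.

Lemma limg_last_image j : j != armD ->
  (linfun (vsval : subvs_of (point_space F (center l)) -> V) @: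
     (last_image (rep_of_point l F) j : {vspace subvs_of (point_space F (center l))}))%VS =
  level F j (lenC l j).
Proof.
move=> ne_jD; have [U0 _ _ _ _] := oF.
rewrite /lenC (negPf ne_jD) /last_image limg_sum.
have [l0|] := posnP (l j).-1.
  by rewrite big1 ?l0 ?U0 // => i _; have := ltn_ord i; rewrite [X in (_ < X)%N]l0.
move=> l_gt1; have lti : ((l j).-2 < (l j).-1)%N by rewrite ltn_predL.
rewrite (big_pred1 (Ordinal lti)) => [|i]; last first.
  apply/eqP/eqP => [iE|->]; last by rewrite /= prednK.
  by apply: val_inj; exact: (congr1 predn iE).
rewrite limg_vsval /=; last first.
  have [[i' i'E _]|[_ //]] := vtxP l j (l j).-2.+1.
  by have := ltn_ord i'; rewrite i'E prednK // ltnn.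
by rewrite /level /flag_level -[in RHS](prednK l_gt1).
Qed.

Lemma rep_of_point_in_Rep' : in_Rep' (rep_of_point l F).
Proof.
have [U0 _ _ sU dU] := oF; set pi := rep_of_point l F.
have iota_inj : lker (linfun (vsval : subvs_of (point_space F (center l)) -> V)) = 0%VS.
  by apply/eqP/lker0P => x y; rewrite !lfunE => /subvs_inj.
have UD0 : level F armD (lenC l armD) = 0%VS by rewrite /lenC eqxx U0.
have dim_iota (X : {vspace subvs_of (point_space F (center l))}) :
    \dim X = \dim (linfun (vsval : subvs_of (point_space F (center l)) -> V) @: X).
  by rewrite limg_dim_eq // iota_inj capv0.
have [LA [LB LC]] := (limg_last_image (isT : armA != armD),
  (limg_last_image (isT : armB != armD), limg_last_image (isT : armC != armD))).
have sumABC : (linfun (vsval : subvs_of (point_space F (center l)) -> V) @: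
    (last_image pi armA + last_image pi armB + last_image pi armC
       : {vspace subvs_of (point_space F (center l))}))%VS = fullv.
  by rewrite !limgD LA LB LC; move: sU; rewrite big_I4 /= UD0 addv0.
split.
- move=> a; apply/lker0P => x y /(congr1 vsval).
  by rewrite !rep_of_point_mapE => /subvs_inj.
- apply/eqP; rewrite eqEdim subvf /=.
  by rewrite [leqRHS]dim_iota sumABC dim_subvs.
suff dimE : \dim (last_image pi armA + last_image pi armB + last_image pi armC) =
    (\dim (last_image pi armA) + \dim (last_image pi armB) + \dim (last_image pi armC))%N.
  by apply/eqP; rewrite dimE !dim_last_image.
rewrite [LHS]dim_iota sumABC.
rewrite [X in (X + _ + _)%N]dim_iota [X in (_ + X + _)%N]dim_iota.
rewrite [X in (_ + _ + X)%N]dim_iota LA LB LC.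
move: dU; rewrite directvE /= sU big_I4 /= UD0 dimv0 addn0 => /eqP; exact.
Qed.

(** A splitting yields a projection at every vertex, compatible with the arrows. Its central
    component is an endomorphism of the configuration, hence a scalar, and a scalar projection kills
    one of the two terms. *)
Lemma indecomposable_rep_of_point :
  (0 < \dim {: V})%N -> brick l (level F) -> indecomposable' (rep_of_point l F).
Proof.
move=> V_gt0 bF; split; first exact: rep_of_point_in_Rep'.
  by move=> /(_ (center l)) /=; rewrite dim_subvs => V0; rewrite V0 in V_gt0.
move=> rho sigma rhoR sigmaR [phi [psi [phiM psiM psiK phiK]]].
have psiKv v x : psi v (phi v x) = x by rewrite -comp_lfunE psiK id_lfunE.
have phiKv v x : phi v (psi v x) = x by rewrite -comp_lfunE phiK id_lfunE.
pose pr v (z : (rep_space rho v * rep_space sigma v)%type) :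
  (rep_space rho v * rep_space sigma v)%type := (z.1, 0).
pose P v (x : subvs_of (point_space F v)) : subvs_of (point_space F v) :=
  psi v (pr v (phi v x)).
have PM a x : rep_map (rep_of_point l F) a (P (src a) x) =
    P (tgt a) (rep_map (rep_of_point l F) a x).
  rewrite /P; have /lfunP/(_ (pr (src a) (phi (src a) x))) := psiM a.
  rewrite !comp_lfunE => <-; have /lfunP/(_ x) := phiM a; rewrite !comp_lfunE => ->.
  by rewrite !rep_sum_mapE /pr /= linear0.
have P_lin v : linear (P v).
  move=> c x y; apply: etrans (linearP (psi v) c (pr v (phi v x)) (pr v (phi v y))).
  suff -> : c *: pr v (phi v x) + pr v (phi v y) = pr v (phi v (c *: x + y)) by [].
  by rewrite linearP /pr; congr (_, _); rewrite /= scaler0 addr0.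
pose E : 'End(V) := linfun (fun w : V => vsval (P (center l) (vsproj fullv w))).
have EE w : E w = vsval (P (center l) (vsproj fullv w)).
  by rewrite linfun_linear // => c x y; rewrite linearP P_lin linearP.
(* The arrows are inclusions, so the central component restricts to the component at each vertex. *)
have E_P v : forall x, E (vsval x) = vsval (P v x).
  elim/vertex_ind: v => [x|a IHa x].
    by rewrite EE; congr (vsval (P _ _)); apply: subvs_inj; rewrite vsprojK ?memvf.
  by rewrite -rep_of_point_mapE IHa -PM rep_of_point_mapE.
have EU : mor l (level F) (level F) E.
  have [U0 _ _ _ _] := oF; apply/preserves_mem => j [|i] w le_il.
    by rewrite U0 !memv0 => /eqP->; rewrite linear0.
  rewrite -point_space_vtx // => wU; rewrite -(vsprojK wU) E_P; exact: subvsP.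
have [c Ec] := bF E EU.
have P_c v x : P v x = c *: x.
  by apply: subvs_inj; rewrite -E_P Ec scale_lfunE id_lfunE linearZ.
have pr_c v z : pr v z = c *: z.
  by rewrite -[LHS]phiKv -[z in LHS]phiKv -/(P v _) P_c linearZ /= phiKv.
(* The projection to rho is multiplication by c: on (y, 0) this reads y = c y, and on (0, y) it
   reads 0 = c y. Vanishing at the center suffices since the arrows are injective. *)
have [c0|c_neq0] := eqVneq c 0; [left | right]; apply: rep_zero_center => //.
  apply/eqP; rewrite dimv_eq0 -subv0; apply/subvP => y _; rewrite memv0.
  by have := pr_c (center l) (y, 0); rewrite c0 scale0r => -[->].
apply/eqP; rewrite dimv_eq0 -subv0; apply/subvP => y _; rewrite memv0.
have := pr_c (center l) (0, y) => -[_ /esym/eqP].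
by rewrite scaler_eq0 (negPf c_neq0).
Qed.

End RepOfPoint.

Theorem theorem2p4 (K : closedFieldType) (charK0 : [pchar K] =i pred0)
    (l : 'I_4 -> nat) (l_gt0 : forall j, (0 < l j)%N)
    (lam : quad l) (lamL : in_Lambda lam)
    (V : vectType K) (V1 V2 V3 : {vspace V})
    (dimV1 : \dim V1 = sumn (chop (part lam armA)))
    (dimV2 : \dim V2 = sumn (chop (part lam armB)))
    (dimV3 : \dim V3 = sumn (chop (part lam armC)))
    (sumV : (V1 + V2 + V3)%VS = fullv) (dirV : directv (V1 + V2 + V3)) :
  [/\ finitely_many_orbits V1 V2 V3 lam <-> finiteness_condition lam,
      finiteness_condition lam ->
        exists f : point V -> seq (quad l),
          quotient_bijection (double_flag V1 V2 V3 lam) (same_orbit V1 V2 V3)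
            (decomposition lam) (fun s t => perm_eq s t) f &
      finiteness_condition lam -> tits lam = 1 ->
        (exists F : point V, open_dense_orbit V1 V2 V3 lam F) /\
        (forall F : point V, open_dense_orbit V1 V2 V3 lam F ->
           indecomposable' (rep_of_point l F) /\
           forall x, dim_vector (rep_of_point l F) x = (lam x)%:Z)].

Proof.
have V_gt0 : (0 < \dim {: V})%N.
  by rewrite (dim_full lamL dimV1 dimV2 dimV3 sumV dirV) Lambda_total_gt0.
split; first by split; [apply: finiteness_of_orbits | apply: orbits_of_finiteness].
  exact: orbits_bijection.
move=> finL lam1.
have [U0 [oU0 dU0]] : exists U : config V, object l U /\ dimq l U = lam.
  apply: exists_object => //; rewrite (dim_full lamL dimV1 dimV2 dimV3 sumV dirV).
  exact: Lambda_balanced.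
have [||U [oU dU rU bU]] := exists_rigid l_gt0 oU0; rewrite ?dU0 //.
have [F0 [F0P iso0]] := exists_point_isom l_gt0 lamL dimV1 dimV2 dimV3 sumV dirV oU (etrans dU dU0).
have rF0 := rigid_isom iso0 rU.
split; first by exists F0; apply: open_dense_of_rigid.
move=> F denseF; have [FP _ _] := denseF.
have [_ oF dF _] := (double_flagP l_gt0 lamL dimV1 dimV2 dimV3 sumV dirV F).1 FP.
(* Every point of an open dense orbit is isomorphic to the rigid brick F0. *)
have isoF := open_dense_orbit_unique l_gt0 lamL dimV1 dimV2 dimV3 sumV dirV denseF F0P rF0.
split; last by move=> x; rewrite rep_of_point_dim // dF.
apply: indecomposable_rep_of_point => //.
by apply: brick_isom (isom_sym isoF) _; apply: brick_isom iso0 bU.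
Qed.
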